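(* Let $0\le\rho\le1$, $m_1,m_2\in\mathbb R$, $\chi_j\in\operatorname{Sp}(d,\mathbb R)$ and suppose $\mathscr K_j\in\mathscr I^{m_j}_\rho(\chi_j)$ for $j=1,2$. Then $\mathscr K_1\mathscr K_2\in\mathscr I^{m_1+m_2}_\rho(\chi_1\chi_2)$.
   Context: Notation. $\langle x\rangle=\sqrt{1+|x|^2}$; $(\cdot,\cdot)$ is the sesquilinear pairing between $\mathscr S'$ and $\mathscr S$, conjugate linear in the second argument. $T^*\mathbb R^d=\mathbb R^d\times\mathbb R^d$ carries $\sigma((x,\xi),(x',\xi'))=\langle x',\xi\rangle-\langle x,\xi'\rangle$; $\operatorname{Sp}(d,\mathbb R)$ is the group of real $2d\times2d$ matrices preserving $\sigma$. Shubin amplitudes: $a\in\Gamma^m_\rho(\mathbb R^n)$ means $a\in C^\infty(\mathbb R^n)$ and $|\partial^\alpha a(x)|\lesssim\langle x\rangle^{m-\rho|\alpha|}$ for all $\alpha\in\mathbb N^n$. Phase functions: for $N\ge0$, a phase function on $\mathbb R^{2d+N}$ is a real quadratic form $\varphi(X,\theta)=\frac12\langle X,FX\rangle+\langle L\theta,X\rangle+\frac12\langle\theta,Q\theta\rangle$, $X=(x,y)\in\mathbb R^{2d}$, $\theta\in\mathbb R^N$, with $F\in\mathbb R^{2d\times2d}$, $Q\in\mathbb R^{N\times N}$ symmetric, $L\in\mathbb R^{2d\times N}$, such that the block matrix $\begin{pmatrix}L\\Q\end{pmatrix}$ is injective (if $N=0$, $L$ and $Q$ are absent). It parametrizes the Lagrangian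 $\Lambda_\varphi=\{(X,\varphi_X'(X,\theta))\in T^*\mathbb R^{2d}:\varphi_\theta'(X,\theta)=0\}$. Oscillatory integrals: for $a\in\Gamma^m_\rho(\mathbb R^{2d+N})$, $K_{\varphi,a}\in\mathscr S'(\mathbb R^{2d})$ is $(K_{\varphi,a},f)=\lim_{\varepsilon\to0+}\int\kappa(\varepsilon\theta)e^{i\varphi(X,\theta)}a(X,\theta)\overline{f(X)}\,d\theta\,dX$, $f\in\mathscr S(\mathbb R^{2d})$, with $\kappa\in\mathscr S(\mathbb R^N)$ equal to $1$ for $|\theta|\le1$ (independent of $\kappa$); if $N=0$, $K_{\varphi,a}(X)=e^{i\varphi(X)}a(X)$. FIOs: $\Lambda_\chi'=\{(x,y,\xi,-\eta)\in T^*\mathbb R^{2d}:(x,\xi)=\chi(y,\eta)\}$; $K^m_\rho(\chi)$ is the set of all $K_{\varphi,a}$ with $N\ge0$, $a\in\Gamma^m_\rho(\mathbb R^{2d+N})$ and $\varphi$ a phase function on $\mathbb R^{2d+N}$ with $\Lambda_\varphi=\Lambda_\chi'$. $\mathscr I^m_\rho(\chi)$ is the set of operators $\mathscr K_{\varphi,a}$ with kernel $K_{\varphi,a}\in K^m_\rho(\chi)$, i.e. $(\mathscr K_{\varphi,a}f,g)=(K_{\varphi,a},g\otimes\overline f)$ for $f,g\in\mathscr S(\mathbb R^d)$. Operators in $\mathscr I^m_\rho(\chi)$ are continuous on $\mathscr S(\mathbb R^d)$, and $\mathscr K_1\mathscr K_2$ denotes composition as operators on $\mathscr S(\mathbb R^d)$.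 *)

(* Defs.v *)
From HB Require Import structures.
From mathcomp Require Import all_boot all_order all_algebra.
From mathcomp Require Import all_classical all_reals all_analysis.
From mathcomp.real_closed Require Import complex.

Set Implicit Arguments.
Unset Strict Implicit.
Unset Printing Implicit Defensive.

Import Order.TTheory GRing.Theory Num.Theory numFieldNormedType.Exports.
Import ComplexField.Normc.

Local Notation Re := complex.Re.
Local Notation Im := complex.Im.

Local Open Scope classical_set_scope.
Local Open Scope complex_scope.
Local Open Scope ring_scope.

(** * Lebesgue measure and Lebesgue integral on R^n

   The library has no Lebesgue measure on R^n.  It is the n-fold product of the
   one-dimensional one, transported from R * R^n to R^n.+1, the latter being
   represented by the measurable type of tuples. *)

(* The canonical instance on [m1 \x m2] only covers finite measures. *)
Lemma product_sigma_finite d1 d2 (T1 : measurableType d1)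
    (T2 : measurableType d2) (R : realType)
    (m1 : {sigma_finite_measure set T1 -> \bar R})
    (m2 : {sigma_finite_measure set T2 -> \bar R}) :
  sigma_finite setT (m1 \x m2)%E.
Proof.
have /sigma_finiteP[F [TF ndF Foo]] := sigma_finiteT m1.
have /sigma_finiteP[G [TG ndG Goo]] := sigma_finiteT m2.
exists (fun n => F n `*` G n).
  rewrite -setXTT TF TG predeqE => -[x y]; split.
    move=> [/= [n _ Fnx] [k _ Gky]]; exists (maxn n k) => //; split.
    - by move: x Fnx; exact/subsetPset/ndF/leq_maxl.
    - by move: y Gky; exact/subsetPset/ndG/leq_maxr.
  by move=> [n _ []/= ? ?]; split; exists n.
move=> k; have [? ?] := Foo k; have [? ?] := Goo k.
split; first exact: measurableX.
by rewrite product_measure1E// lte_mul_pinfty// ge0_fin_numE.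
Qed.

Section lebesgue_measure_n.
Variable R : realType.
Notation tup n := (n.-tuple (measurableTypeR R)).

Definition consT n (p : measurableTypeR R * tup n) : tup n.+1 :=
  [the tup n.+1 of p.1 :: p.2].

Lemma measurable_consT n : measurable_fun [set: _] (@consT n).
Proof. exact: measurable_cons. Qed.

Lemma measurable_unconsT n :
  measurable_fun [set: tup n.+1] (fun t => (thead t, [tuple of behead t])).
Proof.
apply: measurable_fun_pair; first exact: measurable_tnth.
exact: measurable_behead.
Qed.

Section step.
Variables (n : nat) (mu : {sigma_finite_measure set (tup n) -> \bar R}).

Definition lebesgue_step : set (tup n.+1) -> \bar R :=
  pushforward (@lebesgue_measure R \x mu)%E (@consT n).

HB.instance Definition _ := Measure.copy lebesgue_step
  (measure_function_pushforward__canonical__measure_function_Measure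
     (@lebesgue_measure R \x mu)%E (@measurable_consT n)).

Lemma lebesgue_step_sigma_finite : sigma_finite setT lebesgue_step.
Proof.
have [F FT mF] := product_sigma_finite (@lebesgue_measure R) mu.
pose u := fun t : tup n.+1 => (thead t, [tuple of behead t]).
have consK : u \o @consT n = id.
  apply/funext => -[x t]; rewrite /u /consT /=; congr (_, _).
  by apply/val_inj.
exists (fun i => u @^-1` F i) => [|i].
  by rewrite -preimage_bigcup -FT preimage_setT.
have [mFi Fi_fin] := mF i; split.
  by rewrite -[X in measurable X]setTI; exact: measurable_unconsT.
by rewrite /lebesgue_step /pushforward -comp_preimage consK.
Qed.

HB.instance Definition _ := Measure_isSigmaFinite.Build _ _ _ lebesgue_step
  lebesgue_step_sigma_finite.

End step.

Fixpoint lebesgue_tuple n : {sigma_finite_measure set (tup n) -> \bar R} :=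
  match n with
  | 0 => \d_([tuple] : tup 0)
  | n'.+1 => lebesgue_step (lebesgue_tuple n')
  end.

End lebesgue_measure_n.

Definition integralR (R : realType) n (g : 'cV[R]_n -> R) : R :=
  \int[@lebesgue_tuple R n]_(t in setT) g (\col_i tnth t i).

Definition integralC (R : realType) n (g : 'cV[R]_n -> R[i]) : R[i] :=
  integralR (fun x => Re (g x)) +i* integralR (fun x => Im (g x)).

(** * Euclidean structure *)

Section euclidean.
Variable R : realType.

Definition dotv n (u v : 'cV[R]_n) : R := \sum_i u i 0 * v i 0.

(* [`|x|] would be the maximum norm of the library. *)
Definition enorm n (x : 'cV[R]_n) : R := Num.sqrt (dotv x x).

Definition japanese n (x : 'cV[R]_n) : R := Num.sqrt (1 + enorm x ^+ 2).

Definition expi (t : R) : R[i] := cos t +i* sin t.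

End euclidean.

(** * Partial derivatives, smoothness *)

Section smooth.
Variables (R : realType) (n : nat).
Implicit Type f : 'cV[R]_n -> R[i].

Definition ebase (i : 'I_n) : 'cV[R]_n := delta_mx i 0.

Definition gradient (g : 'cV[R]_n -> R) (x : 'cV[R]_n) : 'cV[R]_n :=
  \col_i 'D_(ebase i) g x.

(* R[i] carries no normed R-module structure in the library, so complex-valued
   functions are differentiated componentwise. *)
Definition pderivable (i : 'I_n) f : Prop := forall x,
  derivable (fun y => Re (f y)) x (ebase i) /\
  derivable (fun y => Im (f y)) x (ebase i).

Definition pderiv (i : 'I_n) f : 'cV[R]_n -> R[i] := fun x =>
  'D_(ebase i) (fun y => Re (f y)) x +i* 'D_(ebase i) (fun y => Im (f y)) x.

Definition ccontinuous f : Prop :=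
  continuous (fun y => Re (f y)) /\ continuous (fun y => Im (f y)).

Fixpoint Ck (k : nat) f : Prop :=
  ccontinuous f /\
  match k with
  | 0 => True
  | k'.+1 => forall i, pderivable i f /\ Ck k' (pderiv i f)
  end.

Definition smooth f : Prop := forall k, Ck k f.

Definition mulorder (alpha : 'I_n -> nat) : nat := (\sum_i alpha i)%N.

Definition mulderiv (alpha : 'I_n -> nat) f : 'cV[R]_n -> R[i] :=
  foldr (fun i g => iter (alpha i) (pderiv i) g) f (enum 'I_n).

End smooth.

(** * Shubin amplitudes and Schwartz functions *)

Section symbols.
Variables (R : realType) (n : nat).
Implicit Type f : 'cV[R]_n -> R[i].

Definition shubin (m rho : R) f : Prop :=
  smooth f /\
  forall alpha : 'I_n -> nat, exists C : R, forall x,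
    normc (mulderiv alpha f x) <=
      C * japanese x `^ (m - rho * (mulorder alpha)%:R).

Definition is_schwartz f : Prop :=
  smooth f /\
  forall (alpha : 'I_n -> nat) (k : nat), exists C : R, forall x,
    japanese x ^+ k * normc (mulderiv alpha f x) <= C.

Record schwartz : Type := Schwartz {
  schwartz_fun :> 'cV[R]_n -> R[i];
  schwartzP : is_schwartz schwartz_fun }.

(* The pairing (f, g) of S' and S, for f a function. *)
Definition pairing f (g : 'cV[R]_n -> R[i]) : R[i] :=
  integralC (fun x => f x * conjc (g x)).

End symbols.

(** * Symplectic matrices and twisted graph Lagrangians

   Pairs (x, y) of column vectors are stacked as [col_mx x y], while an element
   of the cotangent space T^*R^n is a Rocq pair (position, covector), except
   that symplectic matrices act on stacked vectors. *)

Section symplectic.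
Variables (R : realType) (d : nat).

Definition sigma (u v : 'cV[R]_(d + d)) : R :=
  dotv (usubmx v) (dsubmx u) - dotv (usubmx u) (dsubmx v).

Definition symplectic (chi : 'M[R]_(d + d)) : Prop :=
  forall u v, sigma (chi *m u) (chi *m v) = sigma u v.

Definition twisted_graph (chi : 'M[R]_(d + d)) :
    set ('cV[R]_(d + d) * 'cV[R]_(d + d)) :=
  [set p | exists x y xi eta : 'cV[R]_d,
     p = (col_mx x y, col_mx xi (- eta)) /\
     col_mx x xi = chi *m col_mx y eta].

End symplectic.

(** * Phase functions *)

Record phase (R : realType) (d N : nat) : Type := Phase {
  phaseF : 'M[R]_(d + d);
  phaseL : 'M[R]_(d + d, N);
  phaseQ : 'M[R]_N;
  phaseF_sym : phaseF^T = phaseF;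
  phaseQ_sym : phaseQ^T = phaseQ;
  phase_inj : injective (fun theta : 'cV[R]_N =>
                col_mx phaseL phaseQ *m theta) }.

Section phase.
Variables (R : realType) (d N : nat).
Implicit Type phi : phase R d N.

Definition phase_fun phi (X : 'cV[R]_(d + d)) (theta : 'cV[R]_N) : R :=
  2^-1 * dotv X (phaseF phi *m X) + dotv (phaseL phi *m theta) X
  + 2^-1 * dotv theta (phaseQ phi *m theta).

Definition lagrangian phi : set ('cV[R]_(d + d) * 'cV[R]_(d + d)) :=
  [set p | exists X theta,
     gradient (phase_fun phi X) theta = 0 /\
     p = (X, gradient (phase_fun phi ^~ theta) X)].

(** * Oscillatory integrals and Fourier integral operators *)

Definition regularized_integral phi (a : 'cV[R]_(d + d + N) -> R[i])
    (kappa : 'cV[R]_N -> R[i]) (f : 'cV[R]_(d + d) -> R[i]) (eps : R) : R[i] :=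
  integralC (fun z : 'cV[R]_(d + d + N) =>
    let X := usubmx z in let theta := dsubmx z in
    kappa (eps *: theta) * expi (phase_fun phi X theta) * a z * conjc (f X)).

(* [K] represents the distribution K_{phi,a}; only its values on Schwartz
   functions matter.  The limit does not depend on the cut-off [kappa], whence
   the universal quantification.  For N = 0 the cut-off factor is kappa 0 = 1
   and the formula is the pairing of e^{i phi} a with [f]. *)
Definition is_osc_kernel phi (a : 'cV[R]_(d + d + N) -> R[i])
    (K : ('cV[R]_(d + d) -> R[i]) -> R[i]) : Prop :=
  forall kappa : schwartz R N,
    (forall theta, enorm theta <= 1 -> kappa theta = 1) ->
  forall f : schwartz R (d + d),
    normc (regularized_integral phi a kappa f eps - K f) @[eps --> 0^'+]
      --> (0 : R).

End phase.

Section fio.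
Variables (R : realType) (d : nat) (m rho : R) (chi : 'M[R]_(d + d)).

Definition fio_kernel (K : ('cV[R]_(d + d) -> R[i]) -> R[i]) : Prop :=
  exists (N : nat) (phi : phase R d N) (a : 'cV[R]_(d + d + N) -> R[i]),
    [/\ shubin m rho a, lagrangian phi = twisted_graph chi
      & is_osc_kernel phi a K].

Definition tensor_conj (g f : 'cV[R]_d -> R[i]) (X : 'cV[R]_(d + d)) : R[i] :=
  g (usubmx X) * conjc (f (dsubmx X)).

(* Operators are maps of the Schwartz space into itself. *)
Definition fio (T : schwartz R d -> schwartz R d) : Prop :=
  exists2 K, fio_kernel K &
    forall f g : schwartz R d, pairing (T f) g = K (tensor_conj g f).

End fio.

(* Main.v *)
From HB Require Import structures.
Require Import Defs.
From mathcomp Require Import all_boot all_order all_algebra.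
From mathcomp Require Import all_classical all_reals all_analysis.
From mathcomp.real_closed Require Import complex.
From mathcomp Require Import measurable_realfun.
From mathcomp Require Import zify ring lra.

Set Implicit Arguments.
Unset Strict Implicit.
Unset Printing Implicit Defensive.

Import Order.TTheory GRing.Theory Num.Theory numFieldNormedType.Exports.
Import ComplexField.Normc.

Local Notation Re := complex.Re.
Local Notation Im := complex.Im.

Local Open Scope classical_set_scope.
Local Open Scope complex_scope.
Local Open Scope ring_scope.

(** Formally, the kernel of the composition is the oscillatory integral with
   phase and amplitude
     Phi(x,y; z,tau,theta) = phi1(x,z,theta) + phi2(z,y,tau),
     A(x,y; z,tau,theta) = a1(x,z,theta) a2(z,y,tau),
   the middle variable z having become a fibre variable.  Three points make
   this rigorous; Z denotes the vector of all variables.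

   The phase.  On the critical set of Phi the equation Phi'_z = 0 says that the
   covector at z produced by phi2 is the one consumed by phi1, so that the
   critical points describe the graph of chi1 chi2 (total_lagrangian).
   Nondegeneracy of Phi comes from that of phi1 and phi2 and from the
   injectivity of symplectic matrices (total_hess_inj).

   The amplitude.  A is not a Shubin amplitude, since a1 only gains decay in
   (x,z,theta) and a2 in (z,y,tau).  Symplecticity also gives, if G denotes the
   gradient of Phi in the fibre variables,
     <Z>^2 <= C (<(x,z,theta)>^2 + |G(Z)|^2)
   and the same with (z,y,tau) (critical_A1, critical_A2, jap_bound).  Where |G|
   is small with respect to <Z> the three weights are thus comparable, and if w
   is a cutoff of order 0 to this region, w A is an amplitude of order
   m1 + m2 (shubin_cut_amp).  Elsewhere |G| dominates <Z>, and integrating by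
   parts in the fibre variables shows that (1 - w) A contributes a Schwartz
   kernel K_r(x,y) (schw_Kr).  A Schwartz kernel is an oscillatory integral with
   phase Phi: its amplitude is exp(-i Phi) K_r(x,y) psi(z,tau,theta), where psi
   has integral 1, and this amplitude is itself a Schwartz function.  Hence the
   amplitude of the composition is w A + exp(-i Phi) K_r psi (osc_replace).

   The pairing.  The gradient of exp(i phi) is i l exp(i phi) with l linear, so
   that the integral of exp(i phi) u is also that of exp(i phi) P u, where
     P u = u / lam + i sum_j d_j (l_j u / lam),   lam = 1 + |l|^2
   (ibp_op, ibp).  Each application of P gains a factor lam^(-1/2).  For a phase function
   and an amplitude multiplied by a Schwartz function of the base variables,
   enough applications give an absolutely convergent integral (osc, osc_dom),
   which is the limit of the integrals regularized by any cutoffs with bounded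
   derivatives that tend to 1 (osc_lim, osc_cont).  Now insert cutoffs in z and
   theta in the integral defining the first operator.  Its pairing with g is
   then a Schwartz function of z, on which the second kernel can be tested; by
   Fubini this gives an integral over Z with cutoffs (fubini_composite), from
   which the cutoff in tau is removed first (right_lim), then the others
   (composed_pairing).

   All integrals that are manipulated are integrals of continuous functions
   bounded by a multiple of the product of the (1 + x_i^2)^-1, a class which is
   stable under freezing or integrating out some of the variables. *)

(** * Integrals over R^n of dominated continuous functions *)

Section continuity_helpers.
Variables (R : realType) (T : topologicalType).
Implicit Types f g : T -> R.

Lemma ccst (k : R) : continuous (fun _ : T => k).
Proof. exact: cst_continuous. Qed.

Lemma cadd f g : continuous f -> continuous g -> continuous (fun x => f x + g x).
Proof. by move=> cf cg x; apply: continuousD; [exact: cf|exact: cg]. Qed.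

Lemma cmul f g : continuous f -> continuous g -> continuous (fun x => f x * g x).
Proof. by move=> cf cg x; apply: continuousM; [exact: cf|exact: cg]. Qed.

Lemma copp f : continuous f -> continuous (fun x => - f x).
Proof. by move=> cf x; apply: continuousN; exact: cf. Qed.
End continuity_helpers.

Section integration_Rn.
Variable R : realType.
Notation tup n := (n.-tuple (measurableTypeR R)).

Definition colt n (t : tup n) : 'cV[R]_n := \col_i tnth t i.

(** A product weight is preferred to a power of [japanese] because it is
   multiplicative for [col_mx]: slices and partial integrals of functions
   dominated by it are dominated by it as well. *)
Definition cauchyw n (x : 'cV[R]_n) : R := \prod_i (1 + x i 0 ^+ 2)^-1.

(** Dominated convergence is about sequences; this turns it into continuity of
   integrals in a parameter. *)
Lemma seq_continuousP n (f : 'cV[R]_n -> R) u :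
  (forall u_ : nat -> 'cV[R]_n, u_ k @[k --> \oo] --> u ->
     f (u_ k) @[k --> \oo] --> f u) -> {for u, continuous f}.
Proof.
move=> H; apply: contrapT => nc.
have [e e0 He] : exists2 e : R, 0 < e &
    forall k : nat, exists v, ball u k.+1%:R^-1 v /\ e <= `|f u - f v|.
  apply: contrapT => ne; apply: nc.
  apply/(@cvgrPdist_lt R R _ (nbhs u) (nbhs_filter u)) => e e0.
  apply: contrapT => nn; apply: ne; exists e => // k.
  apply: contrapT => nv; apply: nn.
  apply/nbhs_ballP; exists k.+1%:R^-1; first by rewrite /= invr_gt0.
  move=> v uv /=; rewrite ltNge; apply/negP => ev.
  by apply: nv; exists v.
have [v Hv] := choice He.
have vu : v k @[k --> \oo] --> u.
  apply/cvg_ballP => r r0; near=> k.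
  apply: (@le_ball _ _ _ k.+1%:R^-1); last by have [] := Hv k.
  apply: ltW; near: k; exact: near_infty_natSinv_lt (PosNum r0).
have /cvgrPdist_lt/(_ e e0) [k _ /(_ k (leqnn k))] := H _ vu.
by have [_] := Hv k => /le_lt_trans/[apply]; rewrite ltxx.
Unshelve. all: by end_near. Qed.

(** Only countably many integer vectors can occur, and each of them is taken on a
   product of intervals. *)
Lemma measurable_grid n (c : R) (g : {ffun 'I_n -> int} -> R) : 0 < c ->
  measurable_fun [set: tup n]
    (fun t => g [ffun i => Num.floor (c * tnth t i)]).
Proof.
move=> c0 _ Y mY; rewrite setTI.
have -> : (fun t : tup n => g [ffun i => Num.floor (c * tnth t i)]) @^-1` Y =
  \bigcup_(s : {ffun 'I_n -> int}) (if `[< Y (g s) >] then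
     \bigcap_(i : 'I_n) [set t : tup n | Num.floor (c * tnth t i) = s i]
     else set0).
  apply/seteqP; split => [t /= Yt|t [s _]].
    exists [ffun i => Num.floor (c * tnth t i)] => //.
    by rewrite (asboolT Yt) => i _ /=; rewrite ffunE.
  case: asboolP => // Ys H /=; suff -> : [ffun i => Num.floor (c * tnth t i)] = s by [].
  by apply/ffunP => i; rewrite ffunE; exact: H.
apply: countable_bigcupT_measurable => // s; case: asboolP => // _.
apply: fin_bigcap_measurable => // i _.
have -> : [set t : tup n | Num.floor (c * tnth t i) = s i] =
   (fun t => tnth t i) @^-1` `[(s i)%:~R / c, (s i + 1)%:~R / c[.
  apply/seteqP; split => t /=; rewrite in_itv /= ler_pdivrMr// ltr_pdivlMr// ![_ * c]mulrC.
    by move=> <-; rewrite ge_floor floorD1_gt.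
  by move=> H; apply/floor_def.
by rewrite -[X in measurable X]setTI; apply: measurable_tnth.
Qed.

(** The sigma-algebra of tuples is generated by the coordinates and is not defined
   from open sets.  But f is the pointwise limit of the functions that evaluate
   it at the corners of the grids of mesh 1/(k+1). *)
Lemma measurable_colt n (f : 'cV[R]_n -> R) : continuous f ->
  measurable_fun [set: tup n] (f \o @colt n).
Proof.
move=> cf.
pose G (k : nat) (t : tup n) :=
  f (\col_i ((Num.floor (k.+1%:R * tnth t i))%:~R / k.+1%:R)).
apply: (@measurable_realfun.measurable_fun_cvg _ _ _ _ G) => [k|t _].
  have := @measurable_grid n k.+1%:R (fun s => f (\col_i ((s i)%:~R / k.+1%:R))) (ltr0Sn _ _).
  rewrite (_ : (fun t : tup n => _) = G k)//.
  by apply/funext => t; rewrite /G; congr f; apply/colP => i; rewrite !mxE ffunE.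
rewrite /G /=; apply: (@cvg_comp _ _ _ (fun k : nat => \col_i ((Num.floor (k.+1%:R * tnth t i))%:~R / k.+1%:R)) f _ (nbhs (colt t))); last exact: cf.
apply/cvg_ballP => e e0; near=> k.
split => // i j; rewrite !mxE /ball /= ltr_norml.
have ke : k.+1%:R^-1 < e by near: k; exact: near_infty_natSinv_lt (PosNum e0).
have k0 : 0 < k.+1%:R^-1 :> R by rewrite invr_gt0.
have /andP[h1 h2] := floor_itv (k.+1%:R * tnth t i).
set q := (Num.floor _)%:~R in h1 *.
rewrite intrD1 -/q in h2.
have -> : tnth t i - q / k.+1%:R = (k.+1%:R * tnth t i - q) * k.+1%:R^-1.
  by rewrite mulrBl mulrAC divff ?mul1r// pnatr_eq0.
have H0 : 0 <= k.+1%:R * tnth t i - q by rewrite subr_ge0.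
have H1 : k.+1%:R * tnth t i - q <= 1 by rewrite lerBlDl ltW.
apply/andP; split.
  by apply: (@lt_le_trans _ _ 0); rewrite ?oppr_lt0// mulr_ge0// ltW.
by apply: le_lt_trans ke; rewrite ler_piMl// ltW.
Unshelve. all: by end_near. Qed.

Lemma cauchyw_gt0 n (x : 'cV[R]_n) : 0 < cauchyw x.
Proof. by apply: prodr_gt0 => i _; rewrite invr_gt0 ltr_pwDl// sqr_ge0. Qed.

Lemma cauchyw_ge0 n (x : 'cV[R]_n) : 0 <= cauchyw x.
Proof. exact/ltW/cauchyw_gt0. Qed.

Lemma cauchyw_le1 n (x : 'cV[R]_n) : cauchyw x <= 1.
Proof.
apply: prodr_ile1 => i; rewrite invr_ge0 addr_ge0 ?sqr_ge0//=.
by rewrite invf_le1 ?lerDl ?sqr_ge0// ltr_pwDl// sqr_ge0.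
Qed.

Lemma cauchyw_col_mx a b (u : 'cV[R]_a) (v : 'cV[R]_b) :
  cauchyw (col_mx u v) = cauchyw u * cauchyw v.
Proof.
rewrite /cauchyw big_split_ord; congr (_ * _); apply: eq_bigr => i _.
  by rewrite col_mxEu.
by rewrite col_mxEd.
Qed.

Lemma cauchyw_continuous n : continuous (@cauchyw n).
Proof.
have c1 (i : 'I_n) : continuous (fun x : 'cV[R]_n => (1 + x i 0 ^+ 2)^-1).
  move=> x; apply: (@continuous_comp _ _ _ (fun x : 'cV[R]_n => x i 0) (fun y => (1 + y ^+ 2)^-1)).
    exact: coord_continuous.
  exact: continuous_oneDsqrV.
rewrite /cauchyw; elim: (index_enum _) => [|i s IH] x.
  rewrite (_ : (fun _ => _) = cst 1); first exact: cst_continuous.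
  by apply/funext => y; rewrite big_nil.
rewrite (_ : (fun _ => _) = (fun x : 'cV[R]_n => (1 + x i 0 ^+ 2)^-1) \*
    (fun x => \prod_(j <- s) (1 + x j 0 ^+ 2)^-1)).
  by apply: continuousM; [exact: c1|exact: IH].
by apply/funext => y; rewrite big_cons.
Qed.

Section fubini.
Context d1 d2 (T1 : measurableType d1) (T2 : measurableType d2).
Variables (m1 : {sigma_finite_measure set T1 -> \bar R})
  (m2 : {sigma_finite_measure set T2 -> \bar R}).
Variables (f : T1 * T2 -> R) (h1 : T1 -> R) (h2 : T2 -> R).
Hypotheses (mf : measurable_fun setT f)
  (ih1 : m1.-integrable setT (EFin \o h1))
  (ih2 : m2.-integrable setT (EFin \o h2))
  (h1_ge0 : forall x, 0 <= h1 x) (h2_ge0 : forall x, 0 <= h2 x)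
  (f_le : forall x y, `|f (x, y)| <= h1 x * h2 y).

(** The dominating product is integrable because its two factors are. *)
Lemma product_integrable : (m1 \x m2)%E.-integrable setT (EFin \o f).
Proof.
have mh1 : measurable_fun setT h1 by apply/measurable_EFinP/(measurable_int m1).
have mh2 : measurable_fun setT h2 by apply/measurable_EFinP/(measurable_int m2).
have mh : measurable_fun setT (fun z : T1 * T2 => h1 z.1 * h2 z.2).
  by apply: measurable_funM; apply: measurableT_comp.
apply: (@le_integrable _ _ _ _ _ measurableT _ (EFin \o (fun z : T1 * T2 => h1 z.1 * h2 z.2))).
- exact/measurable_EFinP.
- move=> [x y] _ /=; rewrite lee_fin (le_trans (f_le x y))//; exact: ler_norm.
apply/integrable12ltyP; first exact/measurable_EFinP.
have -> : (\int[m1]_x \int[m2]_y `|(EFin \o (fun z : T1 * T2 => h1 z.1 * h2 z.2)%R) (x, y)| =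
  \int[m1]_x ((h1 x)%:E * \int[m2]_y (h2 y)%:E))%E.
  apply: eq_integral => x _; rewrite -ge0_integralZl_EFin//=.
  - by apply: eq_integral => y _; rewrite -EFinM ger0_norm// mulr_ge0.
  - by move=> y _; rewrite lee_fin.
  - exact/measurable_EFinP.
rewrite ge0_integralZr//.
- have fin1 : (\int[m1]_x (h1 x)%:E < +oo)%E.
    have /integrableP[_] := ih1; congr (_ < _)%E.
    by apply: eq_integral => x _ /=; rewrite ger0_norm.
  have fin2 : (\int[m2]_x (h2 x)%:E < +oo)%E.
    have /integrableP[_] := ih2; congr (_ < _)%E.
    by apply: eq_integral => x _ /=; rewrite ger0_norm.
  apply: lte_mul_pinfty => //.
  + by apply: integral_ge0 => x _; rewrite lee_fin.
  + by rewrite ge0_fin_numE// integral_ge0// => x _; rewrite lee_fin.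
- exact/measurable_EFinP.
- by move=> x _; rewrite lee_fin.
- by apply: integral_ge0 => x _; rewrite lee_fin.
Qed.

Lemma section1_integrable x :
  m2.-integrable setT (EFin \o (fun y => f (x, y))).
Proof.
apply: (@le_integrable _ _ _ _ _ measurableT _ (EFin \o (fun y => h1 x * h2 y))).
- apply/measurable_EFinP; apply: (measurableT_comp mf).
  exact: measurable_fun_pair.
- move=> y _ /=; rewrite lee_fin (le_trans (f_le x y))//.
  exact: ler_norm.
- have -> : EFin \o (fun y => h1 x * h2 y) = (fun y => (h1 x)%:E * (h2 y)%:E)%E.
    by apply/funext => y /=; rewrite EFinM.
  exact: integrableZl.
Qed.

Lemma section2_integrable y :
  m1.-integrable setT (EFin \o (fun x => f (x, y))).
Proof.
apply: (@le_integrable _ _ _ _ _ measurableT _ (EFin \o (fun x => h2 y * h1 x))).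
- apply/measurable_EFinP; apply: (measurableT_comp mf).
  exact: measurable_fun_pair.
- move=> x _ /=; rewrite lee_fin (le_trans (f_le x y))//.
  by rewrite mulrC; exact: ler_norm.
- have -> : EFin \o (fun x => h2 y * h1 x) = (fun x => (h2 y)%:E * (h1 x)%:E)%E.
    by apply/funext => x /=; rewrite EFinM.
  exact: integrableZl.
Qed.

Lemma RFubini1 : Rintegral (m1 \x m2)%E setT f =
  Rintegral m1 setT (fun x => Rintegral m2 setT (fun y => f (x, y))).
Proof.
rewrite /Rintegral; congr fine.
rewrite -(integral12_prod_meas1 product_integrable).
apply: eq_integral => x _; rewrite /fubini_F/= fineK//.
exact: integrable_fin_num (section1_integrable x).
Qed.

Lemma RFubini2 : Rintegral (m1 \x m2)%E setT f =
  Rintegral m2 setT (fun y => Rintegral m1 setT (fun x => f (x, y))).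
Proof.
rewrite /Rintegral; congr fine.
rewrite -(integral21_prod_meas1 product_integrable).
apply: eq_integral => y _; rewrite /fubini_G/= fineK//.
exact: integrable_fin_num (section2_integrable y).
Qed.

End fubini.

Notation mu1 := (@lebesgue_measure R).

Lemma integrable_oneDsqrV :
  mu1.-integrable setT (EFin \o (fun x : R => (1 + x ^+ 2)^-1)).
Proof.
apply/integrableP; split.
  apply/measurable_EFinP; apply: continuous_measurable_fun.
  exact: continuous_oneDsqrV.
have -> : (\int[mu1]_x `|(EFin \o (fun x : R => (1 + x ^+ 2)^-1)%R) x| =
          \int[mu1]_x ((1 + x ^+ 2)^-1)%:E)%E.
  by apply: eq_integral => x _ /=; rewrite ger0_norm// invr_ge0 addr_ge0// sqr_ge0.
rewrite (@ge0_symfun_integralT _ (fun x => (1 + x ^+ 2)^-1)).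
- have := integral0y_oneDsqr R; rewrite /oneDsqr set_itvcy => ->.
  by rewrite lte_mul_pinfty// ltry.
- by move=> x; rewrite invr_ge0 addr_ge0// sqr_ge0.
- exact: continuous_oneDsqrV.
- by move=> x /=; rewrite sqrrN.
Qed.

Lemma integrable_cauchyw n : (@lebesgue_tuple R n).-integrable setT (EFin \o (@cauchyw n \o @colt n)).
Proof.
elim: n => [|n IH].
  apply/integrableP; split.
    by apply/measurable_EFinP; apply: measurable_colt; exact: cauchyw_continuous.
  rewrite /= integral_dirac//; last first.
    apply/measurable_EFinP/measurableT_comp => //.
    by apply: measurable_colt; exact: cauchyw_continuous.
  by rewrite diracT mul1e ltry.
have cs : @cauchyw n.+1 \o @colt n.+1 \o @consT R n = (fun z => (1 + z.1 ^+ 2)^-1 * cauchyw (colt z.2)).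
  apply/funext => -[x t] /=; rewrite /cauchyw big_ord_recl mxE; congr (_ * _).
  by apply: eq_bigr => i _; rewrite !mxE tnthS.
have mh : measurable_fun [set: tup n.+1] (@cauchyw n.+1 \o @colt n.+1).
  by apply: measurable_colt; exact: cauchyw_continuous.
rewrite /= /lebesgue_step.
apply: integrable_pushforward => //.
- exact: measurable_consT.
- exact/measurable_EFinP.
rewrite preimage_setT.
apply: (@product_integrable _ _ _ _ _ _ (@cauchyw n.+1 \o @colt n.+1 \o @consT R n)
  (fun x => (1 + x ^+ 2)^-1) (@cauchyw n \o @colt n)) => //.
- by apply: measurableT_comp => //; exact: measurable_consT.
- exact: integrable_oneDsqrV.
- by move=> x; rewrite invr_ge0 addr_ge0// sqr_ge0.
- by move=> x; exact: cauchyw_ge0.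
- move=> x t; rewrite cs /= ger0_norm// mulr_ge0 ?cauchyw_ge0//.
  by rewrite invr_ge0 addr_ge0// sqr_ge0.
Qed.

(** The constant is a parameter because dominated convergence needs the same one
   for a whole sequence. *)
Definition dominated n (c : R) (f : 'cV[R]_n -> R) :=
  continuous f /\ forall x, `|f x| <= c * cauchyw x.

Lemma integrable_dominated n c (f : 'cV[R]_n -> R) : dominated c f ->
  (@lebesgue_tuple R n).-integrable setT (EFin \o (f \o @colt n)).
Proof.
move=> [cf fc].
apply: (@le_integrable _ _ _ _ _ measurableT _ (EFin \o (fun t => c * cauchyw (colt t)))).
- by apply/measurable_EFinP; exact: measurable_colt.
- by move=> t _ /=; rewrite lee_fin (le_trans (fc _))// ler_norm.
- rewrite [X in integrable _ _ X](_ : _ = (fun t => (c)%:E * (cauchyw (colt t))%:E)%E).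
    by apply: integrableZl => //; exact: integrable_cauchyw.
  by apply/funext => t /=; rewrite EFinM.
Qed.

Lemma integralR_dct n c (f_ : nat -> 'cV[R]_n -> R) (f : 'cV[R]_n -> R) :
  (forall k, dominated c (f_ k)) -> (forall x, f_ k x @[k --> \oo] --> f x) ->
  integralR (f_ k) @[k --> \oo] --> integralR f.
Proof.
move=> nf cf; rewrite /integralR /Rintegral.
have I := @dominated_cvg _ _ _ (@lebesgue_tuple R n) _ measurableT
   (fun k t => (f_ k (colt t))%:E) (fun t => (f (colt t))%:E)
   (fun t => (c * cauchyw (colt t))%:E).
have mf : measurable_fun [set: tup n] (f \o @colt n).
  apply: (@measurable_realfun.measurable_fun_cvg _ _ _ _ (fun k => f_ k \o @colt n)) => [k|t _].
    by apply: measurable_colt; case: (nf k).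
  exact: cf.
have nc : dominated c (fun x : 'cV[R]_n => c * cauchyw x).
  split; first by apply: cmul; [exact: ccst|exact: cauchyw_continuous].
  move=> x; rewrite ger0_norm// mulr_ge0 ?cauchyw_ge0//.
  have [_ /(_ 0)] := nf 0; rewrite -(ler_pdivrMr _ _ (cauchyw_gt0 _)).
  by apply: le_trans; rewrite mulr_ge0 ?invr_ge0 ?cauchyw_ge0.
have ic := integrable_dominated nc.
have iff : (@lebesgue_tuple R n).-integrable setT (EFin \o (f \o @colt n)).
  apply: (@le_integrable _ _ _ _ _ measurableT _ (EFin \o (fun t => c * cauchyw (colt t)))) => //.
    exact/measurable_EFinP.
  move=> t _ /=; rewrite lee_fin.
  apply: le_trans (ler_norm _).
  have cn : `|f_ k (colt t)| @[k --> \oo] --> `|f (colt t)|.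
    by apply: cvg_norm; exact: cf.
  apply: (cvgr_to_le cn); near=> k; case: (nf k) => _; exact.
apply: fine_cvg; rewrite fineK; last exact: integrable_fin_num iff.
apply: I => //.
- by move=> k; apply/measurable_EFinP; apply: measurable_colt; case: (nf k).
- by move=> t _; apply: cvg_EFin; [exact: nearW|exact: cf].
- by move=> k t _; rewrite lee_fin; case: (nf k).
Unshelve. all: by end_near. Qed.

Lemma dominated_ge0 n c (f : 'cV[R]_n -> R) : dominated c f -> 0 <= c.
Proof.
move=> [_ /(_ 0)]; rewrite -(ler_pdivrMr _ _ (cauchyw_gt0 _)).
by apply: le_trans; rewrite mulr_ge0 ?invr_ge0 ?cauchyw_ge0.
Qed.

Lemma dominated_cauchyw n : dominated 1 (@cauchyw n).
Proof.
split; first exact: cauchyw_continuous.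
by move=> x; rewrite mul1r ger0_norm ?cauchyw_ge0.
Qed.

Lemma dominatedZ n c k (f : 'cV[R]_n -> R) : dominated c f ->
  dominated (`|k| * c) (fun x => k * f x).
Proof.
move=> [cf fc]; split; first by apply: cmul => //; exact: ccst.
by move=> x; rewrite normrM -mulrA ler_wpM2l.
Qed.

Lemma integralRD n c c' (f g : 'cV[R]_n -> R) : dominated c f -> dominated c' g ->
  integralR (fun x => f x + g x) = integralR f + integralR g.
Proof. by move=> /integrable_dominated nf /integrable_dominated ng; exact: RintegralD. Qed.

Lemma integralRZ n c k (f : 'cV[R]_n -> R) : dominated c f ->
  integralR (fun x => k * f x) = k * integralR f.
Proof. by move=> /integrable_dominated nf; exact: RintegralZl. Qed.

Lemma integralR_cauchyw_ge0 n : 0 <= integralR (@cauchyw n).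
Proof. by apply: Rintegral_ge0 => x _; exact: cauchyw_ge0. Qed.

Lemma integralR_le n c (f : 'cV[R]_n -> R) : dominated c f ->
  `|integralR f| <= c * integralR (@cauchyw n).
Proof.
move=> nf; have inf := integrable_dominated nf.
apply: (le_trans (le_normr_Rintegral measurableT inf)).
have nc := dominatedZ c (dominated_cauchyw n).
rewrite -(integralRZ c (dominated_cauchyw n)); apply: le_Rintegral => //.
- rewrite (_ : EFin \o _ = (fun t => `|(EFin \o (f \o @colt n)) t|%E)).
    exact: integrable_abse.
  by apply/funext.
- exact: integrable_dominated nc.
- by move=> t _; case: nf => _; exact.
Qed.

Lemma continuous_cV n (T : topologicalType) (F : T -> 'cV[R]_n) :
  (forall i, continuous (fun t => F t i 0)) -> continuous F.
Proof.
move=> cF t; apply/cvg_ballP => e e0.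
have : \forall t' \near t, forall i : 'I_n, ball (F t i 0) e (F t' i 0).
  apply: filter_forall => i.
  by have /cvg_ballP/(_ e e0) := cF i t.
by apply: filterS => t' H; split=> // i j; rewrite (ord1 j); exact: H.
Qed.

Lemma coord_cont n (i : 'I_n) : continuous (fun x : 'cV[R]_n => x i 0).
Proof. exact: coord_continuous. Qed.

Lemma col_mx_contr a b (u : 'cV[R]_a) : continuous (fun v : 'cV[R]_b => col_mx u v).
Proof.
apply: continuous_cV => i; rewrite -(fintype.splitK i); case: (fintype.split i) => j /=.
  rewrite (_ : (fun _ => _) = cst (u j 0)); first exact: cst_continuous.
  by apply/funext => v; rewrite col_mxEu.
rewrite (_ : (fun _ => _) = (fun v : 'cV[R]_b => v j 0)); first exact: coord_cont.
by apply/funext => v; rewrite col_mxEd.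
Qed.

Lemma col_mx_contl a b (v : 'cV[R]_b) : continuous (fun u : 'cV[R]_a => col_mx u v).
Proof.
apply: continuous_cV => i; rewrite -(fintype.splitK i); case: (fintype.split i) => j /=.
  rewrite (_ : (fun _ => _) = (fun v : 'cV[R]_a => v j 0)); first exact: coord_cont.
  by apply/funext => u; rewrite col_mxEu.
rewrite (_ : (fun _ => _) = cst (v j 0)); first exact: cst_continuous.
by apply/funext => u; rewrite col_mxEd.
Qed.

Lemma ccomp (T U V : topologicalType) (f : T -> U) (g : U -> V) :
  continuous f -> continuous g -> continuous (fun x => g (f x)).
Proof. by move=> cf cg x; apply: continuous_comp; [exact: cf|exact: cg]. Qed.

Lemma dominated_slicer a b c (f : 'cV[R]_(a + b) -> R) u : dominated c f ->
  dominated (c * cauchyw u) (fun v => f (col_mx u v)).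
Proof.
move=> [cf fc]; split; first by apply: ccomp => //; exact: col_mx_contr.
by move=> v; rewrite -mulrA -cauchyw_col_mx.
Qed.

Lemma dominated_slicel a b c (f : 'cV[R]_(a + b) -> R) v : dominated c f ->
  dominated (c * cauchyw v) (fun u => f (col_mx u v)).
Proof.
move=> [cf fc]; split; first by apply: ccomp => //; exact: col_mx_contl.
by move=> u; rewrite -mulrA [cauchyw v * _]mulrC -cauchyw_col_mx.
Qed.

Lemma dominated_le n c c' (f : 'cV[R]_n -> R) : c <= c' -> dominated c f -> dominated c' f.
Proof.
move=> cc [cf fc]; split=> // x; apply: le_trans (fc x) _.
by rewrite ler_wpM2r ?cauchyw_ge0.
Qed.

Lemma dominated_partial a b c (f : 'cV[R]_(a + b) -> R) : dominated c f ->
  dominated (c * integralR (@cauchyw b)) (fun u => integralR (fun v => f (col_mx u v))).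
Proof.
move=> nf; have c0 := dominated_ge0 nf; split.
  move=> u; apply: seq_continuousP => u_ uu.
  apply: (@integralR_dct _ c) => [k|v].
    apply: dominated_le (dominated_slicer (u_ k) nf).
    by rewrite ler_piMr// cauchyw_le1.
  apply: (@cvg_comp _ _ _ u_ (fun u => f (col_mx u v)) _ _ _ uu).
  by apply: (ccomp (@col_mx_contl a b v)); case: nf.
move=> u; apply: le_trans (integralR_le (dominated_slicer u nf)) _.
by rewrite mulrAC.
Qed.

(** Unfolds one step of the recursive definition of [lebesgue_tuple]. *)
Lemma integralR_step n c (f : 'cV[R]_(1 + n) -> R) : dominated c f ->
  integralR f = \int[mu1]_(x in setT) integralR (fun v : 'cV[R]_n => f (col_mx (const_mx x) v)).
Proof.
move=> nf; have fi := integrable_dominated nf.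
have [cf fc] := nf; have c0 := dominated_ge0 nf.
have mf : measurable_fun [set: tup n.+1] (f \o @colt (1 + n)) by exact: measurable_colt.
have mfc : measurable_fun [set: measurableTypeR R * tup n] (f \o @colt (1 + n) \o @consT R n).
  by apply: measurableT_comp => //; exact: measurable_consT.
have colE (x : R) (t : tup n) : @colt (1 + n) (@consT R n (x, t)) = col_mx (const_mx x) (colt t).
  apply/colP => i; rewrite -(fintype.splitK i) mxE; case: (fintype.split i) => j /=.
    by rewrite col_mxEu mxE (ord1 j).
  by rewrite col_mxEd mxE !(tnth_nth 0) /=.
have hle (x : R) (t : tup n) : `|(f \o @colt (1 + n) \o @consT R n) (x, t)| <=
    c * (1 + x ^+ 2)^-1 * (@cauchyw n \o @colt n) t.
  rewrite /= colE (le_trans (fc _))// cauchyw_col_mx mulrA ler_wpM2r ?cauchyw_ge0//.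
  by rewrite ler_wpM2l// /cauchyw big_ord1 mxE.
have ih1 : mu1.-integrable setT (EFin \o (fun x : R => c * (1 + x ^+ 2)^-1)).
  rewrite [X in integrable _ _ X](_ : _ = (fun x => c%:E * ((1 + x ^+ 2)^-1)%:E)%E).
    by apply: integrableZl => //; exact: integrable_oneDsqrV.
  by apply/funext => x /=; rewrite EFinM.
have ih1_ge0 (x : R) : 0 <= c * (1 + x ^+ 2)^-1.
  by rewrite mulr_ge0// invr_ge0 addr_ge0// sqr_ge0.
have ih2_ge0 (t : tup n) : 0 <= (@cauchyw n \o @colt n) t by exact: cauchyw_ge0.
have pint := product_integrable mfc ih1 (integrable_cauchyw n) ih1_ge0 ih2_ge0 hle.
have -> : integralR f = Rintegral (mu1 \x @lebesgue_tuple R n)%E setT (f \o @colt (1 + n) \o @consT R n).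
  rewrite /integralR /Rintegral; congr fine.
  rewrite /= /lebesgue_step.
  rewrite (@integral_pushforward _ _ _ _ _ _ (@measurable_consT R n) _ _ (fun t => (f (colt t))%:E))//.
  exact/measurable_EFinP.
rewrite (RFubini1 mfc ih1 (integrable_cauchyw n) ih1_ge0 ih2_ge0 hle).
by apply: eq_Rintegral => x _; apply: eq_Rintegral => t _ /=; rewrite colE.
Qed.

Lemma integralR0 c (f : 'cV[R]_0 -> R) : dominated c f -> integralR f = f 0.
Proof.
move=> [cf _]; rewrite /integralR /Rintegral /= integral_dirac//.
  by rewrite diracT mul1e /=; congr f; apply/colP => -[].
by apply/measurable_EFinP; exact: measurable_colt.
Qed.

(** Induction on a, one coordinate at a time.  The vectors of size a.+1 + b and
   of size 1 + (a + b) are the same ones, but they are split differently, whence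
   the case analysis on coordinates. *)
Lemma integralR_block a b c (f : 'cV[R]_(a + b) -> R) : dominated c f ->
  integralR f = integralR (fun u => integralR (fun v => f (col_mx u v))).
Proof.
elim: a c f => [|a IH] c f nf.
  rewrite (integralR0 (dominated_partial nf)); congr integralR.
  apply/funext => v; congr f; apply/colP => i.
  rewrite (_ : i = rshift 0 i); first by rewrite col_mxEd; congr (v _ _); apply/val_inj.
  exact/val_inj.
have nf' : dominated c (f : 'cV[R]_(1 + (a + b)) -> R) by [].
rewrite (integralR_step nf') (integralR_step (n := a) (dominated_partial nf)).
apply: eq_Rintegral => x _.
rewrite (IH (c * cauchyw (const_mx x : 'cV[R]_1))); last exact: dominated_slicer nf'.
congr integralR; apply/funext => u; congr integralR; apply/funext => v; congr f.
apply/colP => i; rewrite [LHS]mxE [RHS]mxE.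
case: splitP => j ij.
  have -> : (@fintype.split a.+1 b i) = inl (lshift a j : 'I_(1 + a)).
    by apply: (canLR (@unsplitK _ _)); apply/val_inj.
  exact/esym/(col_mxEu (const_mx x : 'cV[R]_1) u j 0).
rewrite mxE; case: splitP => k jk.
  have -> : (@fintype.split a.+1 b i) = inl (rshift 1 k : 'I_(1 + a)).
    by apply: (canLR (@unsplitK _ _)); apply/val_inj; rewrite /= ij jk.
  exact/esym/(col_mxEd (const_mx x : 'cV[R]_1) u k 0).
have -> : (@fintype.split a.+1 b i) = inr k.
  by apply: (canLR (@unsplitK _ _)); apply/val_inj; rewrite /= ij jk.
by [].
Qed.

(** Both sides are iterated integrals of the same function of a pair of tuples. *)
Lemma integralR_swap a b c (f : 'cV[R]_(a + b) -> R) : dominated c f ->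
  integralR (fun u => integralR (fun v => f (col_mx u v))) =
  integralR (fun v => integralR (fun u => f (col_mx u v))).
Proof.
move=> nf; have [cf fc] := nf; have c0 := dominated_ge0 nf.
pose cat (z : tup a * tup b) : tup (a + b) := [tuple of z.1 ++ z.2].
have catE z : colt (cat z) = col_mx (colt z.1) (colt z.2).
  apply/colP => i; rewrite -(fintype.splitK i) mxE; case: (fintype.split i) => j /=.
    by rewrite col_mxEu mxE tnth_lshift.
  by rewrite col_mxEd mxE tnth_rshift.
have mcat : measurable_fun setT cat.
  apply/measurable_fun_tnthP => i; rewrite -(fintype.splitK i); case: (fintype.split i) => j /=.
    rewrite (_ : _ \o _ = (fun z => tnth z.1 j)).
      by apply: (@measurableT_comp _ _ _ _ _ _ (fun t : tup a => tnth t j)) => //; exact: measurable_tnth.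
    by apply/funext => z /=; rewrite tnth_lshift.
  rewrite (_ : _ \o _ = (fun z => tnth z.2 j)).
    by apply: (@measurableT_comp _ _ _ _ _ _ (fun t : tup b => tnth t j)) => //; exact: measurable_tnth.
  by apply/funext => z /=; rewrite tnth_rshift.
have mf : measurable_fun setT (f \o @colt (a + b) \o cat).
  by apply: measurableT_comp => //; exact: measurable_colt.
have hle (s : tup a) (t : tup b) : `|(f \o @colt (a + b) \o cat) (s, t)| <=
    (c * cauchyw (colt s)) * (@cauchyw b \o @colt b) t.
  by rewrite /= catE (le_trans (fc _))// cauchyw_col_mx mulrA.
have ih1 : (@lebesgue_tuple R a).-integrable setT (EFin \o (fun s => c * cauchyw (colt s))).
  exact: integrable_dominated (dominatedZ c (dominated_cauchyw a)).
have h1 (s : tup a) : 0 <= c * cauchyw (colt s) by rewrite mulr_ge0// cauchyw_ge0.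
have h2 (s : tup b) : 0 <= (@cauchyw b \o @colt b) s by exact: cauchyw_ge0.
have := RFubini1 mf ih1 (integrable_cauchyw b) h1 h2 hle.
rewrite (RFubini2 mf ih1 (integrable_cauchyw b) h1 h2 hle) => E.
transitivity (Rintegral (@lebesgue_tuple R a) setT (fun x => Rintegral (@lebesgue_tuple R b) setT
       (fun y => (f \o @colt (a + b) \o cat) (x, y)))).
  by apply: eq_Rintegral => x _; apply: eq_Rintegral => y _ /=; rewrite catE.
rewrite -E.
by apply: eq_Rintegral => x _; apply: eq_Rintegral => y _ /=; rewrite catE.
Qed.
End integration_Rn.

(** * Derivatives and integrals of complex-valued functions *)

Section calculus.
Variable R : realType.

(** Reduction to one real variable, where the chain rule and the mean value
   theorem are available. *)
Lemma is_deriveP n (F : 'cV[R]_n -> R) x v d :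
  is_derive x v F d <-> is_derive (0 : R) (1 : R) (fun h : R => F (x + h *: v)) d.
Proof.
have E : (fun h : R => h^-1 *: ((F \o shift x) (h *: v) - F x)) =
  (fun h : R => h^-1 *: (((fun h : R => F (x + h *: v)) \o shift (0 : R)) (h *: (1 : R)) -
     (fun h : R => F (x + h *: v)) 0)).
  apply/funext => h /=; rewrite addr0 scale0r addr0.
  by rewrite (_ : h *: (1 : R) = h) ?[h *: v + x]addrC// /GRing.scale /= mulr1.
split => -[dF eF]; apply: DeriveDef; move: dF eF; rewrite /derivable /derive E //.
Qed.

Lemma is_derive_line n (F : 'cV[R]_n -> R) x v s d :
  is_derive (x + s *: v) v F d -> is_derive (s : R) (1 : R) (fun h : R => F (x + h *: v)) d.
Proof.
have E : (fun h : R => h^-1 *: ((F \o shift (x + s *: v)) (h *: v) - F (x + s *: v))) =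
  (fun h : R => h^-1 *: (((fun h : R => F (x + h *: v)) \o shift (s : R)) (h *: (1 : R)) -
     (fun h : R => F (x + h *: v)) s)).
  apply/funext => h /=.
  rewrite (_ : h *: (1 : R) = h); last by rewrite /GRing.scale /= mulr1.
  by rewrite scalerDl addrCA.
move=> -[dF eF]; apply: DeriveDef; move: dF eF; rewrite /derivable /derive E //.
Qed.

(** The second difference of g along h u and h v is h^2 gij at some point close to
   x, and also h^2 gji at another one, by two applications of the mean value
   theorem in one order or in the other; let h tend to 0. *)
Lemma clairaut n (g gi gj gij gji : 'cV[R]_n -> R) u v :
  (forall x, is_derive x u g (gi x)) -> (forall x, is_derive x v g (gj x)) ->
  (forall x, is_derive x v gi (gij x)) -> (forall x, is_derive x u gj (gji x)) ->
  continuous gij -> continuous gji -> gij = gji.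
Proof.
move=> di dj dij dji cij cji; apply/funext => x.
have key (k ki kij : 'cV[R]_n -> R) a b :
  (forall x, is_derive x a k (ki x)) -> (forall x, is_derive x b ki (kij x)) ->
  forall h : R, 0 < h -> exists s t : R, [/\ 0 < s < h, 0 < t < h &
    k (x + h *: a + h *: b) - k (x + h *: a) - k (x + h *: b) + k x =
    h ^+ 2 * kij (x + s *: a + t *: b)].
  move=> da db h h0.
  pose p s := k (x + h *: b + s *: a) - k (x + s *: a).
  pose dp s := ki (x + h *: b + s *: a) - ki (x + s *: a).
  have dpE (s : R) : is_derive s (1 : R) p (dp s).
    by apply: is_deriveB; apply: is_derive_line; exact: da.
  have cp : {within `[0, h], continuous p}.
    by apply: derivable_within_continuous => s _; have [] := dpE s.
  have [s] := MVT h0 (fun s _ => dpE s) cp; rewrite in_itv /= subr0 => sh ps.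
  have dqE (t : R) : is_derive t (1 : R) (fun t => ki (x + s *: a + t *: b)) (kij (x + s *: a + t *: b)).
    by apply: is_derive_line; exact: db.
  have cq : {within `[0, h], continuous (fun t => ki (x + s *: a + t *: b))}.
    by apply: derivable_within_continuous => t _; have [] := dqE t.
  have [t] := MVT h0 (fun t _ => dqE t) cq; rewrite in_itv /= subr0 scale0r addr0 => th qt.
  exists s, t; split=> //.
  move: ps; rewrite /p /dp !scale0r !addr0 [x + h *: b + s *: a]addrAC qt => ps.
  by rewrite [x + h *: a + h *: b]addrAC expr2 [h * h * _]mulrC mulrA -ps; ring.
apply/eqP; rewrite -subr_eq0 -normr_eq0 eq_le normr_ge0 andbT leNgt; apply/negP => e0.
set e := `| _ | in e0.
have e20 : 0 < e / 2 by rewrite divr_gt0.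
have /cvgrPdist_lt/(_ _ e20) c1 := cij x.
have /cvgrPdist_lt/(_ _ e20) c2 := cji x.
have [r /= r0 rP] := (nbhs_ballP _ _).1 (filterI c1 c2).
(* The parallelogram with sides h u and h v lies in the ball of radius r. *)
pose M := `|u| + `|v| + 1.
have M0 : 0 < M by rewrite ltr_wpDl// addr_ge0.
pose h := r / M.
have h0 : 0 < h by rewrite divr_gt0.
have inb s t u' v' : 0 < s < h -> 0 < t < h -> `|u'| + `|v'| + 1 = M -> ball x r (x + s *: u' + t *: v').
  move=> /andP[s0 sh] /andP[t0 th] ME; rewrite -ball_normE /ball_/= -addrA opprD addNKr normrN.
  apply: le_lt_trans (ler_normD _ _) _; rewrite !normrZ !gtr0_norm//.
  apply: (@le_lt_trans _ _ (h * (`|u'| + `|v'|))).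
    by rewrite mulrDr lerD// ler_wpM2r// ltW.
  by rewrite /h mulrAC -mulrA gtr_pMr// ltr_pdivrMr// mul1r -ME ltrDl.
have [s [t [sh th E1]]] := key _ _ _ _ _ di dij h h0.
have [s' [t' [sh' th' E2]]] := key _ _ _ _ _ dj dji h h0.
have E : gij (x + s *: u + t *: v) = gji (x + s' *: v + t' *: u).
  apply: (mulfI (x := h ^+ 2)); first by rewrite expf_neq0// gt_eqF.
  by rewrite -E1 -E2 [x + h *: v + _]addrAC; ring.
have [b1 _] := rP _ (inb _ _ _ _ sh th erefl).
have [_ b2] := rP (x + s' *: v + t' *: u) (inb _ _ _ _ sh' th' (congr1 (fun z => z + 1) (addrC _ _))).
have : e < e / 2 + e / 2.
  rewrite {1}/e; apply: le_lt_trans (ltrD b1 b2).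
  rewrite E; apply: le_trans (ler_normB _ _); rewrite le_eqVlt; apply/orP; left; apply/eqP.
  by congr `| _ |; ring.
by rewrite -splitr ltxx.
Qed.
End calculus.

Section complex_calculus.
Variable R : realType.
Local Notation C := R[i].

Lemma normc_ge0 (z : C) : 0 <= normc z.
Proof. by case: z => a b; exact: sqrtr_ge0. Qed.

Lemma Re_le_normc (z : C) : `|Re z| <= normc z.
Proof.
case: z => a b /=; rewrite -sqrtr_sqr ler_sqrt ?addr_ge0 ?sqr_ge0//.
by rewrite lerDl sqr_ge0.
Qed.

Lemma Im_le_normc (z : C) : `|Im z| <= normc z.
Proof.
case: z => a b /=; rewrite -sqrtr_sqr ler_sqrt ?addr_ge0 ?sqr_ge0//.
by rewrite lerDr sqr_ge0.
Qed.

Lemma normc_le (z : C) : normc z <= `|Re z| + `|Im z|.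
Proof.
case: z => a b /=; rewrite -(@ger0_norm _ (`|a| + `|b|)) ?addr_ge0//.
rewrite -sqrtr_sqr ler_sqrt ?sqr_ge0// sqrrD !real_normK ?num_real//.
by rewrite lerD2r lerDl mulrn_wge0// mulr_ge0.
Qed.

Lemma normcD (z w : C) : normc (z + w) <= normc z + normc w.
Proof. exact: le_normcD. Qed.

(** The form in which limits appear in [is_osc_kernel]. *)
Definition ccvg (u : nat -> C) (l : C) := normc (u k - l) @[k --> \oo] --> (0 : R).

Lemma ReB (z w : C) : Re (z - w) = Re z - Re w.
Proof. by case: z w => [a b] [c d]. Qed.
Lemma ImB (z w : C) : Im (z - w) = Im z - Im w.
Proof. by case: z w => [a b] [c d]. Qed.
Lemma ReD (z w : C) : Re (z + w) = Re z + Re w.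
Proof. by case: z w => [a b] [c d]. Qed.
Lemma ImD (z w : C) : Im (z + w) = Im z + Im w.
Proof. by case: z w => [a b] [c d]. Qed.
Lemma ReM (z w : C) : Re (z * w) = Re z * Re w - Im z * Im w.
Proof. by case: z w => [a b] [c d]. Qed.
Lemma ImM (z w : C) : Im (z * w) = Re z * Im w + Im z * Re w.
Proof. by case: z w => [a b] [c d] /=. Qed.

Lemma ccvgP u l : ccvg u l <->
  (Re (u k) @[k --> \oo] --> Re l) /\ (Im (u k) @[k --> \oo] --> Im l).
Proof.
split=> [ul|[ur ui]].
  split; apply/subr_cvg0; apply/norm_cvg0P;
    apply: (@squeeze_cvgr _ _ _ _ (cst 0) _ _ _ _ _ ul); try exact: cvg_cst;
    apply: nearW => k; rewrite normr_ge0 /=.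
    by rewrite -ReB Re_le_normc.
  by rewrite -ImB Im_le_normc.
apply: (@squeeze_cvgr _ _ _ _ (cst 0) (fun k => `|Re (u k) - Re l| + `|Im (u k) - Im l|)).
- by apply: nearW => k; rewrite normc_ge0 /= -ReB -ImB normc_le.
- exact: cvg_cst.
- have H : `|Re (u k) - Re l| + `|Im (u k) - Im l| @[k --> \oo] --> (0 : R) + 0.
    by apply: cvgD; apply/norm_cvg0P; exact/subr_cvg0.
  by rewrite addr0 in H.
Qed.

Lemma ccvg_unique u l l' : ccvg u l -> ccvg u l' -> l = l'.
Proof.
move=> /ccvgP[r i] /ccvgP[r' i'].
case: l r i => a b /= r i; case: l' r' i' => a' b' /= r' i'.
by congr (_ +i* _); [exact: (cvg_unique _ r r')|exact: (cvg_unique _ i i')].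
Qed.

Lemma ccvg_eq u u' l : u =1 u' -> ccvg u l -> ccvg u' l.
Proof. by move=> /funext ->. Qed.

Lemma ccvgD u v l m : ccvg u l -> ccvg v m -> ccvg (fun k => u k + v k) (l + m).
Proof.
move=> /ccvgP[r i] /ccvgP[r' i']; apply/ccvgP; rewrite ReD ImD; split.
  by under eq_fun do rewrite ReD; exact: cvgD.
by under eq_fun do rewrite ImD; exact: cvgD.
Qed.

Definition dominatedC n (c : R) (f : 'cV[R]_n -> C) :=
  ccontinuous f /\ forall x, normc (f x) <= c * cauchyw x.

Lemma dominatedC_Re n c (f : 'cV[R]_n -> C) : dominatedC c f -> dominated c (fun x => Re (f x)).
Proof.
by move=> [[cr ci] fc]; split=> // x; exact: le_trans (Re_le_normc _) (fc x).
Qed.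

Lemma dominatedC_Im n c (f : 'cV[R]_n -> C) : dominatedC c f -> dominated c (fun x => Im (f x)).
Proof.
by move=> [[cr ci] fc]; split=> // x; exact: le_trans (Im_le_normc _) (fc x).
Qed.

Lemma integralC_dct n c (f_ : nat -> 'cV[R]_n -> C) (f : 'cV[R]_n -> C) :
  (forall k, dominatedC c (f_ k)) -> (forall x, ccvg (f_ ^~ x) (f x)) ->
  ccvg (fun k => integralC (f_ k)) (integralC f).
Proof.
move=> nf cf; apply/ccvgP; split.
  apply: (@integralR_dct _ _ c) => [k|x]; first exact: dominatedC_Re.
  by have /ccvgP[] := cf x.
apply: (@integralR_dct _ _ c) => [k|x]; first exact: dominatedC_Im.
by have /ccvgP[] := cf x.
Qed.

Lemma integralC_le n c (f : 'cV[R]_n -> C) : dominatedC c f ->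
  normc (integralC f) <= c * (2 * integralR (@cauchyw R n)).
Proof.
move=> nf; apply: le_trans (normc_le _) _ => /=.
rewrite mulrCA mulr_natl mulr2n; apply: lerD.
  exact: integralR_le (dominatedC_Re nf).
exact: integralR_le (dominatedC_Im nf).
Qed.

Lemma integralCD n c c' (f g : 'cV[R]_n -> C) : dominatedC c f -> dominatedC c' g ->
  integralC (fun x => f x + g x) = integralC f + integralC g.
Proof.
move=> nf ng; rewrite /integralC; apply/eqP; rewrite eq_complex /=.
apply/andP; split; apply/eqP.
  rewrite -(integralRD (dominatedC_Re nf) (dominatedC_Re ng)); congr integralR.
  by apply/funext => x; rewrite ReD.
rewrite -(integralRD (dominatedC_Im nf) (dominatedC_Im ng)); congr integralR.
by apply/funext => x; rewrite ImD.
Qed.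

Lemma integralCZ n c k (f : 'cV[R]_n -> C) : dominatedC c f ->
  integralC (fun x => k * f x) = k * integralC f.
Proof.
move=> nf; have nr := dominatedC_Re nf; have ni := dominatedC_Im nf.
rewrite /integralC; apply/eqP; rewrite eq_complex ReM ImM /=.
apply/andP; split; apply/eqP.
  rewrite -(integralRZ _ nr) -(integralRZ _ ni) -mulN1r -(integralRZ _ (dominatedZ _ ni)).
  rewrite -(integralRD (dominatedZ _ nr) (dominatedZ _ (dominatedZ _ ni))); congr integralR.
  by apply/funext => x; rewrite ReM mulN1r.
rewrite -(integralRZ _ nr) -(integralRZ _ ni).
rewrite -(integralRD (dominatedZ _ ni) (dominatedZ _ nr)); congr integralR.
by apply/funext => x; rewrite ImM.
Qed.

Lemma integralC_block a b c (f : 'cV[R]_(a + b) -> C) : dominatedC c f ->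
  integralC f = integralC (fun u => integralC (fun v => f (col_mx u v))).
Proof.
move=> nf; rewrite /integralC /= -(integralR_block (dominatedC_Re nf)).
by rewrite -(integralR_block (dominatedC_Im nf)).
Qed.

Lemma integralC_swap a b c (f : 'cV[R]_(a + b) -> C) : dominatedC c f ->
  integralC (fun u => integralC (fun v => f (col_mx u v))) =
  integralC (fun v => integralC (fun u => f (col_mx u v))).
Proof.
move=> nf; rewrite /integralC /= (integralR_swap (dominatedC_Re nf)).
by rewrite (integralR_swap (dominatedC_Im nf)).
Qed.

Lemma dominatedC_partial a b c (f : 'cV[R]_(a + b) -> C) : dominatedC c f ->
  dominatedC (c * (2 * integralR (@cauchyw R b))) (fun u => integralC (fun v => f (col_mx u v))).
Proof.
move=> nf; split.
  by split; [have [] := dominated_partial (dominatedC_Re nf)|have [] := dominated_partial (dominatedC_Im nf)].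
move=> u; have ns : dominatedC (c * cauchyw u) (fun v => f (col_mx u v)).
  case: nf => -[cr ci] fc; split.
    by split; [apply: (ccomp (@col_mx_contr _ a b u) cr)|apply: (ccomp (@col_mx_contr _ a b u) ci)].
  by move=> v; rewrite -mulrA -cauchyw_col_mx.
by apply: le_trans (integralC_le ns) _; rewrite mulrAC.
Qed.
End complex_calculus.

(** * Functions with prescribed bounds on their derivatives *)

Section derivation.
Variables (R : realType) (n : nat).
Local Notation C := R[i].
Local Notation V := 'cV[R]_n.
Implicit Types (f g : V -> C) (i : 'I_n).

(** A derivative together with its value: such statements compose by rules, unlike
   [pderivable] and [pderiv]. *)
Definition isD i f df := forall x,
  is_derive x (ebase R i) (fun y => Re (f y)) (Re (df x)) /\
  is_derive x (ebase R i) (fun y => Im (f y)) (Im (df x)).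

Lemma isD_pderiv i f df : isD i f df -> pderivable i f /\ pderiv i f = df.
Proof.
move=> H; split; first by move=> x; have [[? _] [? _]] := H x.
apply/funext => x; have [[_ e1] [_ e2]] := H x.
by rewrite /pderiv e1 e2; case: (df x).
Qed.

Lemma pderivable_isD i f : pderivable i f -> isD i f (pderiv i f).
Proof. by move=> H x; have [h1 h2] := H x; split; exact: DeriveDef. Qed.

Lemma isD_eq i f df dg : isD i f df -> df =1 dg -> isD i f dg.
Proof. by move=> H /funext <-. Qed.

Lemma isD_cst i (k : C) : isD i (fun=> k) (fun=> 0).
Proof. by move=> x; split; exact: is_derive_cst. Qed.

Lemma isDD i f g df dg : isD i f df -> isD i g dg ->
  isD i (fun x => f x + g x) (fun x => df x + dg x).
Proof.
move=> Hf Hg x; have [f1 f2] := Hf x; have [g1 g2] := Hg x; split.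
  by rewrite ReD (_ : (fun _ => _) = (fun y => Re (f y)) \+ (fun y => Re (g y)));
    [exact: is_deriveD|apply/funext => y; rewrite ReD].
by rewrite ImD (_ : (fun _ => _) = (fun y => Im (f y)) \+ (fun y => Im (g y)));
    [exact: is_deriveD|apply/funext => y; rewrite ImD].
Qed.

Lemma isDM i f g df dg : isD i f df -> isD i g dg ->
  isD i (fun x => f x * g x) (fun x => df x * g x + f x * dg x).
Proof.
move=> Hf Hg x; have [f1 f2] := Hf x; have [g1 g2] := Hg x.
have H1 := is_deriveB (is_deriveM f1 g1) (is_deriveM f2 g2).
have H2 := is_deriveD (is_deriveM f1 g2) (is_deriveM f2 g1).
split.
  rewrite (_ : (fun _ => _) = ((fun y => Re (f y)) * (fun y => Re (g y)) -
     (fun y => Im (f y)) * (fun y => Im (g y)))); last first.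
    by apply/funext => y; rewrite ReM.
  apply: (is_derive_eq H1).
  rewrite (ReD (df x * g x) (f x * dg x)) (ReM (df x)) (ReM (f x)) /GRing.scale /=.
  move: (Re (f x)) (Im (f x)) (Re (g x)) (Im (g x)) (Re (df x)) (Im (df x)) (Re (dg x)) (Im (dg x)).
  by move=> *; ring.
rewrite (_ : (fun _ => _) = ((fun y => Re (f y)) * (fun y => Im (g y)) +
     (fun y => Im (f y)) * (fun y => Re (g y)))); last first.
  by apply/funext => y; rewrite ImM.
apply: (is_derive_eq H2).
rewrite (ImD (df x * g x) (f x * dg x)) (ImM (df x)) (ImM (f x)) /GRing.scale /=.
move: (Re (f x)) (Im (f x)) (Re (g x)) (Im (g x)) (Re (df x)) (Im (df x)) (Re (dg x)) (Im (dg x)).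
by move=> *; ring.
Qed.

Lemma isDZ i (k : C) f df : isD i f df -> isD i (fun x => k * f x) (fun x => k * df x).
Proof.
move=> Hf; apply: isD_eq (isDM (isD_cst i k) Hf) _ => x.
by rewrite mul0r add0r.
Qed.

Lemma isDconj i f df : isD i f df -> isD i (fun x => conjc (f x)) (fun x => conjc (df x)).
Proof.
move=> Hf x; have [f1 f2] := Hf x; split.
  rewrite (_ : Re (conjc (df x)) = Re (df x)); last by case: (df x).
  rewrite (_ : (fun _ => _) = fun y => Re (f y)) //.
  by apply/funext => y; case: (f y).
rewrite (_ : Im (conjc (df x)) = - Im (df x)); last by case: (df x).
rewrite (_ : (fun _ => _) = - (fun y => Im (f y))).
  by apply: is_deriveN.
by apply/funext => y; rewrite fctE; case: (f y).
Qed.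

Lemma isD_real i (u du : V -> R) : (forall x, is_derive x (ebase R i) u (du x)) ->
  isD i (fun x => (u x)%:C) (fun x => (du x)%:C).
Proof. by move=> H x; split; [exact: H|exact: is_derive_cst]. Qed.

Lemma is_derive_coord (i j : 'I_n) x :
  is_derive x (ebase R j) (fun y : V => y i 0) ((i == j)%:R).
Proof.
apply/is_deriveP.
rewrite (_ : (fun h : R => (x + h *: ebase R j) i 0) = (fun h : R => x i 0 + h * (i == j)%:R)); last first.
  by apply/funext => h; rewrite !mxE eqxx andbT.
apply: is_derive_eq; rewrite /GRing.scale /= ?mulr1 ?mul1r ?mulr0 ?mul0r ?add0r ?addr0 ?mul1r.
by [].
Qed.

Lemma is_derive_real_comp (g dg : R -> R) (u : V -> R) v x (du : R) :
  (forall t : R, is_derive t (1 : R) g (dg t)) -> is_derive x v u du ->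
  is_derive x v (fun y => g (u y)) (dg (u x) * du).
Proof.
move=> dg' /is_deriveP du'; apply/is_deriveP.
have H := @is_derive1_comp R g (fun h : R => u (x + h *: v)) 0 _ _ _ du'.
rewrite /comp scale0r addr0 in H.
exact: (H _ (dg' (u x))).
Qed.

Lemma cc_cst (k : C) : ccontinuous (fun _ : V => k).
Proof. by split; exact: ccst. Qed.

Lemma ccD f g : ccontinuous f -> ccontinuous g -> ccontinuous (fun x => f x + g x).
Proof.
move=> [fr fi] [gr gi]; split.
  by rewrite (_ : (fun _ => _) = fun y => Re (f y) + Re (g y)); [exact: cadd|apply/funext => y; rewrite ReD].
by rewrite (_ : (fun _ => _) = fun y => Im (f y) + Im (g y)); [exact: cadd|apply/funext => y; rewrite ImD].
Qed.

Lemma ccM f g : ccontinuous f -> ccontinuous g -> ccontinuous (fun x => f x * g x).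
Proof.
move=> [fr fi] [gr gi]; split.
  rewrite (_ : (fun _ => _) = fun y => Re (f y) * Re (g y) + - (Im (f y) * Im (g y))).
    by apply: cadd; [|apply: copp]; exact: cmul.
  by apply/funext => y; rewrite ReM.
rewrite (_ : (fun _ => _) = fun y => Re (f y) * Im (g y) + Im (f y) * Re (g y)).
  by apply: cadd; exact: cmul.
by apply/funext => y; rewrite ImM.
Qed.

Lemma cc_conj f : ccontinuous f -> ccontinuous (fun x => conjc (f x)).
Proof.
move=> [fr fi]; split.
  by rewrite (_ : (fun _ => _) = fun y => Re (f y)) //; apply/funext => y; case: (f y).
rewrite (_ : (fun _ => _) = fun y => - Im (f y)); first exact: copp.
by apply/funext => y; case: (f y).
Qed.

Lemma cc_real (u : V -> R) : continuous u -> ccontinuous (fun x => (u x)%:C).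
Proof. by move=> cu; split=> //; exact: ccst. Qed.

(** The bound depends on the order j of the derivative, so that this covers both
   symbol estimates, in which every derivative gains decay, and estimates that
   are uniform in j.  Derivatives are taken in any order, which suits
   inductions better than multi-indices do. *)
Fixpoint Dc (k : nat) (W : nat -> V -> R) f : Prop :=
  [/\ ccontinuous f, (forall x, normc (f x) <= W 0 x) &
    match k with
    | 0 => True
    | k'.+1 => forall i, pderivable i f /\ Dc k' (fun j => W j.+1) (pderiv i f)
    end].

Lemma DcS k W f : ccontinuous f -> (forall x, normc (f x) <= W 0 x) ->
  (forall i, exists2 df, isD i f df & Dc k (fun j => W j.+1) df) -> Dc k.+1 W f.
Proof.
move=> cf fW H; split=> // i; have [df /isD_pderiv[fi ->]] := H i.
by [].
Qed.

Lemma Dc_isD k W f : Dc k.+1 W f ->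
  forall i, isD i f (pderiv i f) /\ Dc k (fun j => W j.+1) (pderiv i f).
Proof. by move=> [_ _ H] i; have [h1 h2] := H i; split=> //; exact: pderivable_isD. Qed.

Lemma Dc_cc k W f : Dc k W f -> ccontinuous f.
Proof. by case: k => [|k] []. Qed.

Lemma Dc_bound k W f x : Dc k W f -> normc (f x) <= W 0 x.
Proof. by case: k => [|k] []. Qed.

Lemma Dc_ge0 k W f x : Dc k W f -> 0 <= W 0 x.
Proof. by move=> /(@Dc_bound _ _ _ x); apply: le_trans; exact: normc_ge0. Qed.

Lemma Dc_le k W W' f : (forall j x, (j <= k)%N -> W j x <= W' j x) ->
  Dc k W f -> Dc k W' f.
Proof.
elim: k W W' f => [|k IH] W W' f WW' [cf fW H]; split=> //.
- by move=> x; exact: le_trans (fW x) (WW' _ _ _).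
- by move=> x; exact: le_trans (fW x) (WW' _ _ _).
- move=> i; have [h1 h2] := H i; split=> //; apply: IH h2 => j x jk.
  exact: WW'.
Qed.

Lemma Dc_leq k k' W f : (k' <= k)%N -> Dc k W f -> Dc k' W f.
Proof.
elim: k k' W f => [|k IH] [|k'] W f //=; first by move=> _ [].
by rewrite ltnS => kk [cf fW H]; split=> // i; have [h1 h2] := H i; split=> //; exact: IH h2.
Qed.

Lemma Dc_Ck k W f : Dc k W f -> Ck k f.
Proof.
elim: k W f => [|k IH] W f [cf fW H]; split=> // i; have [h1 h2] := H i.
by split=> //; exact: IH h2.
Qed.

Lemma Dc_cst k W (c : C) : (forall x, normc c <= W 0 x) ->
  (forall j x, (j <= k)%N -> 0 <= W j x) -> Dc k W (fun=> c).
Proof.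
elim: k W c => [|k IH] W c cW W0; first by split=> //; exact: cc_cst.
apply: DcS => //; first exact: cc_cst.
move=> i; exists (fun=> 0); first exact: isD_cst.
apply: IH => [x|j x jk]; first by rewrite normc0; exact: W0.
exact: W0.
Qed.

Lemma DcD k W W' f g : Dc k W f -> Dc k W' g ->
  Dc k (fun j x => W j x + W' j x) (fun x => f x + g x).
Proof.
elim: k W W' f g => [|k IH] W W' f g Hf Hg.
  split=> //; first by apply: ccD; [exact: Dc_cc Hf|exact: Dc_cc Hg].
  move=> x; apply: le_trans (normcD _ _) _.
  by rewrite lerD// ?(Dc_bound x Hf) ?(Dc_bound x Hg).
apply: DcS; first by apply: ccD; [exact: Dc_cc Hf|exact: Dc_cc Hg].
  move=> x; apply: le_trans (normcD _ _) _.
  by rewrite lerD// ?(Dc_bound x Hf) ?(Dc_bound x Hg).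
move=> i; have [df Df] := Dc_isD Hf i; have [dg Dg] := Dc_isD Hg i.
exists (fun x => pderiv i f x + pderiv i g x); first exact: isDD.
exact: (IH _ _ _ _ Df Dg).
Qed.

(** 2^k is the number of terms produced by the Leibniz rule. *)
Lemma DcM k W W' W'' f g : Dc k W f -> Dc k W' g ->
  (forall (a b : nat) x, (a + b <= k)%N -> 2 ^+ k * (W a x * W' b x) <= W'' (a + b)%N x) ->
  Dc k W'' (fun x => f x * g x).
Proof.
elim: k W W' W'' f g => [|k IH] W W' W'' f g Hf Hg HW.
  split=> //; first by apply: ccM; [exact: Dc_cc Hf|exact: Dc_cc Hg].
  move=> x; rewrite normcM; apply: le_trans (HW 0%N 0%N x _) => //.
  by rewrite expr0 mul1r ler_pM ?normc_ge0 ?(Dc_bound x Hf) ?(Dc_bound x Hg).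
apply: DcS; first by apply: ccM; [exact: Dc_cc Hf|exact: Dc_cc Hg].
  move=> x; rewrite normcM; apply: le_trans (HW 0%N 0%N x _) => //.
  apply: (@le_trans _ _ (W 0 x * W' 0 x)).
    by rewrite ler_pM ?normc_ge0 ?(Dc_bound x Hf) ?(Dc_bound x Hg).
  rewrite ler_peMl ?exprn_ege1 ?ler1n//.
  by rewrite mulr_ge0 ?(Dc_ge0 x Hf) ?(Dc_ge0 x Hg).
move=> i; have [df Df] := Dc_isD Hf i; have [dg Dg] := Dc_isD Hg i.
exists (fun x => pderiv i f x * g x + f x * pderiv i g x); first exact: isDM.
have H1 : Dc k (fun j x => 2^-1 * W'' j.+1 x) (fun x => pderiv i f x * g x).
  apply: IH Df (Dc_leq (leqnSn k) Hg) _ => a b x ab.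
  have := HW a.+1 b x; rewrite addSn => /(_ ab).
  by rewrite exprS -mulrA -ler_pdivlMl.
have H2 : Dc k (fun j x => 2^-1 * W'' j.+1 x) (fun x => f x * pderiv i g x).
  apply: IH (Dc_leq (leqnSn k) Hf) Dg _ => a b x ab.
  have := HW a b.+1 x; rewrite addnS => /(_ ab).
  by rewrite exprS -mulrA -ler_pdivlMl.
apply: Dc_le (DcD H1 H2) => j x _.
by rewrite -mulrDl -[X in (X + X) * _](mul1r) -splitr mul1r.
Qed.

Lemma DcZ k W (c : C) f : Dc k W f -> Dc k (fun j x => normc c * W j x) (fun x => c * f x).
Proof.
elim: k W f => [|k IH] W f Hf.
  split=> //; first by apply: ccM; [exact: cc_cst|exact: Dc_cc Hf].
  by move=> x; rewrite normcM ler_wpM2l ?normc_ge0 ?(Dc_bound x Hf).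
apply: DcS; first by apply: ccM; [exact: cc_cst|exact: Dc_cc Hf].
  by move=> x; rewrite normcM ler_wpM2l ?normc_ge0 ?(Dc_bound x Hf).
move=> i; have [df Df] := Dc_isD Hf i.
by exists (fun x => c * pderiv i f x); [exact: isDZ|exact: IH].
Qed.

Lemma normc_conj (z : C) : normc (conjc z) = normc z.
Proof. by case: z => a b /=; rewrite sqrrN. Qed.

Lemma Dc_conj k W f : Dc k W f -> Dc k W (fun x => conjc (f x)).
Proof.
elim: k W f => [|k IH] W f Hf.
  split=> //; first by apply: cc_conj; exact: Dc_cc Hf.
  by move=> x; rewrite normc_conj (Dc_bound x Hf).
apply: DcS; first by apply: cc_conj; exact: Dc_cc Hf.
  by move=> x; rewrite normc_conj (Dc_bound x Hf).
move=> i; have [df Df] := Dc_isD Hf i.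
by exists (fun x => conjc (pderiv i f x)); [exact: isDconj|exact: IH].
Qed.

Lemma Dc_sum k (I : Type) (s : seq I) (W : I -> nat -> V -> R) (F : I -> V -> C) :
  (forall a, Dc k (W a) (F a)) ->
  Dc k (fun j x => \sum_(a <- s) W a j x) (fun x => \sum_(a <- s) F a x).
Proof.
move=> H; elim: s => [|a s IH].
  rewrite (_ : (fun x : V => \sum_(k <- [::]) F k x) = fun=> 0); last by apply/funext => x; rewrite big_nil.
  by apply: Dc_cst => [x|j x _]; rewrite big_nil ?normc0.
rewrite (_ : (fun x => \sum_(k <- a :: s) F k x) = (fun x => F a x + \sum_(k <- s) F k x)).
  by apply: Dc_le (DcD (H a) IH) => j x _; rewrite big_cons.
by apply/funext => x; rewrite big_cons.
Qed.
End derivation.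

(** Projections on some coordinates, permutations of coordinates, dilations: the
   partial derivatives of f o G are e times partial derivatives of f, or 0, so
   that bounds on derivatives are inherited when e <= 1. *)
Definition monomial_map (R : realType) n m (e : R) (G : 'cV[R]_n -> 'cV[R]_m) :=
  continuous G /\ forall j, (exists i, forall Z h, G (Z + h *: ebase R j) = G Z + (e * h) *: ebase R i)
    \/ (forall Z h, G (Z + h *: ebase R j) = G Z).

Section composition.
Variables (R : realType) (n m : nat).
Local Notation C := R[i].

Lemma isD_mono1 (G : 'cV[R]_n -> 'cV[R]_m) (e : R) i j (f df : 'cV[R]_m -> C) :
  (forall Z h, G (Z + h *: ebase R j) = G Z + (e * h) *: ebase R i) ->
  isD i f df -> isD j (fun Z => f (G Z)) (fun Z => e%:C * df (G Z)).
Proof.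
move=> HG Hf Z.
have key (F : 'cV[R]_m -> R) d : is_derive (G Z) (ebase R i) F d ->
    is_derive Z (ebase R j) (fun Z => F (G Z)) (e * d).
  move=> /is_deriveP H; apply/is_deriveP.
  rewrite (_ : (fun h => _) = (fun s : R => F (G Z + s *: ebase R i)) \o (fun h => e * h)); last first.
    by apply/funext => h /=; rewrite HG.
  rewrite mulrC; apply: is_derive1_comp; first by rewrite mulr0.
  by apply: is_derive_eq; rewrite /GRing.scale /= mulr1 // ?mulr0 ?addr0.
have [h1 h2] := Hf (G Z); split.
  by rewrite ReM mul0r subr0; exact: key.
by rewrite ImM mul0r addr0; exact: key.
Qed.

Lemma isD_mono0 (G : 'cV[R]_n -> 'cV[R]_m) j (f : 'cV[R]_m -> C) :
  (forall Z h, G (Z + h *: ebase R j) = G Z) ->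
  isD j (fun Z => f (G Z)) (fun Z => 0).
Proof.
move=> HG Z; split; apply/is_deriveP.
  rewrite (_ : (fun h => _) = cst (Re (f (G Z)))); first exact: is_derive_cst.
  by apply/funext => h; rewrite HG.
rewrite (_ : (fun h => _) = cst (Im (f (G Z)))); first exact: is_derive_cst.
by apply/funext => h; rewrite HG.
Qed.

Lemma Dc_mono k W (G : 'cV[R]_n -> 'cV[R]_m) (e : R) f : monomial_map e G ->
  0 <= e <= 1 -> (forall j x, 0 <= W j x) ->
  Dc k W f -> Dc k (fun j Z => W j (G Z)) (fun Z => f (G Z)).
Proof.
move=> [cG HG] /andP[e0 e1]; elim: k W f => [|k IH] W f W0 Hf.
  case: Hf => -[cr ci] fW _; split=> //.
  by split; [exact: (ccomp cG cr)|exact: (ccomp cG ci)].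
have [cr ci] := Dc_cc Hf.
apply: DcS; first by split; [exact: (ccomp cG cr)|exact: (ccomp cG ci)].
  by move=> x; exact: Dc_bound Hf.
move=> j; have [[i Hi]|H0] := HG j.
  have [df Df] := Dc_isD Hf i.
  exists (fun Z => e%:C * pderiv i f (G Z)); first exact: isD_mono1.
  apply: Dc_le (DcZ e%:C (IH (fun j => W j.+1) _ _ Df)) => // a x _.
  by rewrite ler_piMl//= expr0n addr0 sqrtr_sqr ger0_norm.
exists (fun=> 0); first exact: isD_mono0.
by apply: Dc_cst => [x|a x _]; rewrite ?normc0.
Qed.
End composition.

(** * Symbol classes with general weights *)

Section symbol_classes.
Variables (R : realType) (n : nat).
Local Notation C := R[i].
Local Notation V := 'cV[R]_n.
Implicit Types (f g : V -> C) (chi s : V -> R) (m rho : R).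

(** Symbols of order m and type rho with respect to a weight s, up to k
   derivatives.  The factor chi, most often an indicator function, records that f
   vanishes with its derivatives outside of some region. *)
Definition symk k chi s m rho f := exists2 c : R, 0 <= c &
  Dc k (fun j x => c * (chi x * s x `^ (m - rho * j%:R))) f.

Lemma powR_add (a r t : R) : 0 < a -> a `^ (r + t) = a `^ r * a `^ t.
Proof. by move=> a0; rewrite powRD// (gt_eqF a0) implybT. Qed.

Lemma symk_cc k chi s m rho f : symk k chi s m rho f -> ccontinuous f.
Proof. by move=> [c _ /Dc_cc]. Qed.

Lemma symk_bound k chi s m rho f : symk k chi s m rho f ->
  exists2 c : R, 0 <= c & forall x, normc (f x) <= c * (chi x * s x `^ m).
Proof.
by move=> [c c0 H]; exists c => // x; have := Dc_bound x H; rewrite mulr0 subr0.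
Qed.

Lemma symk0 chi s m rho f : ccontinuous f ->
  (exists2 c : R, 0 <= c & forall x, normc (f x) <= c * (chi x * s x `^ m)) ->
  symk 0 chi s m rho f.
Proof.
by move=> cf [c c0 H]; exists c => //; split=> // x; rewrite mulr0 subr0.
Qed.

Lemma symk_Ck k chi s m rho f : symk k chi s m rho f -> Ck k f.
Proof. by move=> [c _ /Dc_Ck]. Qed.

Lemma symk_isD k chi s m rho f : symk k.+1 chi s m rho f ->
  forall i, isD i f (pderiv i f) /\ symk k chi s (m - rho) rho (pderiv i f).
Proof.
move=> [c c0 H] i; have [d D] := Dc_isD H i; split=> //; exists c => //.
by apply: Dc_le D => j x _; rewrite -natr1 mulrDr mulr1 opprD addrA addrAC.
Qed.

Section hyps.
Variables (chi s : V -> R).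
Hypotheses (chi0 : forall x, 0 <= chi x) (s1 : forall x, 1 <= s x).

Let s0 x : 0 < s x. Proof. exact: lt_le_trans (s1 x). Qed.

Lemma symk_S k m rho f : ccontinuous f ->
  (exists2 c : R, 0 <= c & forall x, normc (f x) <= c * (chi x * s x `^ m)) ->
  (forall i, exists2 df, isD i f df & symk k chi s (m - rho) rho df) ->
  symk k.+1 chi s m rho f.
Proof.
move=> cf [c c0 fc] H.
have H2 i : exists e : R, 0 <= e /\ exists2 df, isD i f df & Dc k (fun j x => e * (chi x * s x `^ (m - rho - rho * j%:R))) df.
  by have [df d1 [d d0 Hd]] := H i; exists d; split=> //; exists df.
have [C HC] := choice H2.
have D0 : 0 <= \sum_i C i by apply: sumr_ge0 => i _; have [] := HC i.
exists (c + \sum_i C i); first exact: addr_ge0.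
apply: DcS => // [x|i].
  rewrite mulr0 subr0 mulrDl (le_trans (fc x))// lerDl mulr_ge0//.
  by rewrite mulr_ge0// powR_ge0.
have [_ [df d1 d2]] := HC i; exists df => //.
apply: Dc_le d2 => j x _.
rewrite -natr1 mulrDr mulr1 opprD addrA [m - rho * _ - _]addrAC.
rewrite ler_wpM2r ?mulr_ge0 ?powR_ge0//.
rewrite (bigD1 i)//= addrCA lerDl addr_ge0// sumr_ge0// => i' _.
by have [] := HC i'.
Qed.

Lemma symk_le k m m' rho rho' f : m <= m' -> rho' <= rho ->
  symk k chi s m rho f -> symk k chi s m' rho' f.
Proof.
move=> mm rr [c c0 H]; exists c => //; apply: Dc_le H => j x _.
rewrite ler_wpM2l// ler_wpM2l// ler_powR// lerB// ler_wpM2r//.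
Qed.

Lemma symk_chi k chi' m rho f : (forall x, chi x <= chi' x) ->
  symk k chi s m rho f -> symk k chi' s m rho f.
Proof.
move=> mm [c c0 H]; exists c => //; apply: Dc_le H => j x _.
by rewrite ler_wpM2l// ler_wpM2r// powR_ge0.
Qed.

Lemma symkD k m rho f g : symk k chi s m rho f -> symk k chi s m rho g ->
  symk k chi s m rho (fun x => f x + g x).
Proof.
move=> [c c0 H] [c' c0' H']; exists (c + c'); first exact: addr_ge0.
by apply: Dc_le (DcD H H') => j x _; rewrite mulrDl.
Qed.

Lemma symkZ k m rho (z : C) f : symk k chi s m rho f ->
  symk k chi s m rho (fun x => z * f x).
Proof.
move=> [c c0 H]; exists (normc z * c); first by rewrite mulr_ge0// normc_ge0.
by apply: Dc_le (DcZ z H) => j x _ /=; rewrite -[leRHS]mulrA.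
Qed.

Lemma symk_conj k m rho f : symk k chi s m rho f ->
  symk k chi s m rho (fun x => conjc (f x)).
Proof. by move=> [c c0 H]; exists c => //; exact: Dc_conj. Qed.

Lemma symk_sum k m rho (I : Type) (r : seq I) (F : I -> V -> C) :
  (forall a, symk k chi s m rho (F a)) ->
  symk k chi s m rho (fun x => \sum_(a <- r) F a x).
Proof.
move=> H; elim: r => [|a r IH].
  exists 0 => //; rewrite (_ : (fun x : V => \sum_(a <- [::]) F a x) = fun=> 0); last by apply/funext => x; rewrite big_nil.
  by apply: Dc_cst => [x|j x _]; rewrite ?normc0 mul0r.
rewrite (_ : (fun x : V => \sum_(a <- _) F a x) = (fun x => F a x + \sum_(k <- r) F k x)).
  exact: symkD (H a) IH.
by apply/funext => x; rewrite big_cons.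
Qed.

End hyps.

Lemma symkM k chi chi' s m m' rho f g :
  (forall x, 0 <= chi x) -> (forall x, 0 <= chi' x) -> (forall x, 1 <= s x) ->
  symk k chi s m rho f -> symk k chi' s m' rho g ->
  symk k (fun x => chi x * chi' x) s (m + m') rho (fun x => f x * g x).
Proof.
move=> chi0 chi0' s1 [c c0 H] [c' c0' H']; exists (2 ^+ k * (c * c')).
  by rewrite mulr_ge0 ?exprn_ge0// mulr_ge0.
apply: DcM H H' _ => i j x _.
rewrite natrD mulrDr (_ : m + m' - _ = (m - rho * i%:R) + (m' - rho * j%:R)); last by ring.
rewrite (@powR_add _ (m - _) (m' - _)) ?(lt_le_trans _ (s1 x))//.
by rewrite le_eqVlt; apply/orP; left; apply/eqP; ring.
Qed.

(** A name for the trivial region, so that it can be recognized by unification. *)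
Definition one1 : V -> R := fun=> 1.

Lemma one1_ge0 x : 0 <= one1 x. Proof. exact: ler01. Qed.

Lemma symkM1 k s m m' rho f g : (forall x, 1 <= s x) ->
  symk k one1 s m rho f -> symk k one1 s m' rho g ->
  symk k one1 s (m + m') rho (fun x => f x * g x).
Proof.
move=> s1 H1 H2; have := symkM one1_ge0 one1_ge0 s1 H1 H2.
by rewrite (_ : (fun x => _ * _) = one1)//; apply/funext => x; rewrite /one1 mulr1.
Qed.
End symbol_classes.
Arguments one1 {R n}.

Lemma normcR (R : realType) (a : R) : normc (a%:C) = `|a|.
Proof. by rewrite /= expr0n addr0 sqrtr_sqr. Qed.

Section forms.
Variables (R : realType) (n : nat).
Local Notation C := R[i].
Local Notation V := 'cV[R]_n.

Lemma dotvC (u v : V) : dotv u v = dotv v u.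
Proof. by apply: eq_bigr => i _; rewrite mulrC. Qed.

Lemma dotvDr (u v w : V) : dotv u (v + w) = dotv u v + dotv u w.
Proof. by rewrite /dotv -big_split; apply: eq_bigr => i _; rewrite mxE mulrDr. Qed.

Lemma dotvZr (u v : V) (k : R) : dotv u (k *: v) = k * dotv u v.
Proof. by rewrite /dotv mulr_sumr; apply: eq_bigr => i _; rewrite mxE mulrCA. Qed.

Lemma dotv_ebase (u : V) i : dotv u (ebase R i) = u i 0.
Proof.
rewrite /dotv (bigD1 i)//= big1 => [|j ji].
  by rewrite mxE !eqxx mulr1 addr0.
by rewrite mxE (negbTE ji) mulr0.
Qed.

Lemma dotv_ge0 (u : V) : 0 <= dotv u u.
Proof. by apply: sumr_ge0 => i _; rewrite -expr2 sqr_ge0. Qed.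

Lemma is_derive_form (u x : V) i : is_derive x (ebase R i) (dotv u) (u i 0).
Proof.
apply/is_deriveP.
rewrite (_ : (fun h => _) = (fun h : R => dotv u x + h * u i 0)); last first.
  by apply/funext => h; rewrite dotvDr dotvZr dotv_ebase.
by apply: is_derive_eq; rewrite /GRing.scale /= ?mulr1 ?mul1r ?mulr0 ?mul0r ?add0r ?addr0 ?mul1r.
Qed.

Lemma continuous_form (u : V) : continuous (dotv u).
Proof.
rewrite /dotv; elim: (index_enum _) => [|i s IH].
  rewrite (_ : (fun _ => _) = cst 0); first exact: cst_continuous.
  by apply/funext => y; rewrite big_nil.
rewrite (_ : (fun _ => _) = (fun x : V => u i 0 * x i 0 + \sum_(j <- s) u j 0 * x j 0)).
  by apply: cadd => //; apply: cmul; [exact: ccst|exact: coord_cont].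
by apply/funext => y; rewrite big_cons.
Qed.

Variables (I : finType) (l : I -> V).

(** lam = 1 + |l|^2, for a family l of linear forms.  The canonical basis gives
   the square of the Japanese bracket, the rows of a Hessian matrix give the size
   of the gradient of a quadratic phase. *)
Definition lamf (x : V) : R := 1 + \sum_a dotv (l a) x ^+ 2.
(** The square root of lam is a weight for which l_a has order 1 and 1/lam
   has order -2, whatever the forms are. *)
Definition sf (x : V) : R := Num.sqrt (lamf x).

Lemma lamf_ge1 x : 1 <= lamf x.
Proof. by rewrite lerDl sumr_ge0// => i _; exact: sqr_ge0. Qed.

Lemma lamf_gt0 x : 0 < lamf x. Proof. exact: lt_le_trans (lamf_ge1 x). Qed.

Lemma sf_ge1 x : 1 <= sf x.
Proof. by rewrite -[1]sqrtr1 ler_sqrt ?lamf_ge1// ltW// lamf_gt0. Qed.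

Lemma sf_gt0 x : 0 < sf x. Proof. exact: lt_le_trans (sf_ge1 x). Qed.

Lemma sf2 x : sf x ^+ 2 = lamf x.
Proof. by rewrite sqr_sqrtr// ltW// lamf_gt0. Qed.

Lemma form_le_sf a x : `|dotv (l a) x| <= sf x.
Proof.
rewrite -sqrtr_sqr ler_sqrt ?(ltW (lamf_gt0 _))// /lamf (bigD1 a)//=.
by rewrite addrCA lerDl addr_ge0// sumr_ge0// => i _; exact: sqr_ge0.
Qed.

Lemma symk_form a k : symk k one1 sf 1 1 (fun x => (dotv (l a) x)%:C).
Proof.
pose c := 1 + \sum_i `|l a i 0|.
have c1 : 1 <= c by rewrite lerDl sumr_ge0.
have c0 : 0 <= c by exact: le_trans c1.
exists c => //; case: k => [|k].
  split=> //; first by apply: cc_real; exact: continuous_form.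
  move=> x; rewrite mulr0 subr0 powRr1 ?(ltW (sf_gt0 _))// mul1r.
  by rewrite normcR (le_trans (form_le_sf a x))// ler_peMl// ltW// sf_gt0.
apply: DcS; first by apply: cc_real; exact: continuous_form.
  move=> x; rewrite mulr0 subr0 powRr1 ?(ltW (sf_gt0 _))// mul1r.
  by rewrite normcR (le_trans (form_le_sf a x))// ler_peMl// ltW// sf_gt0.
move=> i; exists (fun=> (l a i 0)%:C).
  by apply: isD_real => x; exact: is_derive_form.
apply: Dc_cst => [x|j x _].
  rewrite mulr1 subrr powRr0 /one1 !mulr1 normcR /c.
  by rewrite (bigD1 i)//= addrCA lerDl addr_ge0// sumr_ge0.
by rewrite mulr_ge0// mulr_ge0 ?powR_ge0// one1_ge0.
Qed.

Lemma is_derive_lamf x i : is_derive x (ebase R i) lamf (\sum_a 2 * l a i 0 * dotv (l a) x).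
Proof.
rewrite /lamf; rewrite -[X in is_derive _ _ _ X]add0r.
rewrite (_ : (fun x => _) = cst 1 + (fun x => \sum_a dotv (l a) x ^+ 2))//.
apply: is_deriveD.
rewrite (_ : (fun _ => _) = \sum_a (fun x => dotv (l a) x ^+ 2)); last first.
  by apply/funext => y; rewrite fct_sumE.
elim: (index_enum I) => [|a s IH].
  by rewrite !big_nil; exact: is_derive_cst.
rewrite !big_cons; apply: is_deriveD IH.
rewrite (_ : (fun x => _) = (dotv (l a) * dotv (l a))); last by apply/funext => y; rewrite expr2.
have H := is_derive_form (l a) x i.
by apply: (is_derive_eq (is_deriveM H H)); rewrite /GRing.scale /=; ring.
Qed.

Lemma continuous_lamf : continuous lamf.
Proof.
apply: cadd; first exact: ccst.
elim: (index_enum I) => [|a s IH].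
  rewrite (_ : (fun _ => _) = cst 0); first exact: cst_continuous.
  by apply/funext => y; rewrite big_nil.
rewrite (_ : (fun _ => _) = (fun x : V => dotv (l a) x * dotv (l a) x + \sum_(j <- s) dotv (l j) x ^+ 2)).
  by apply: cadd => //; apply: cmul; exact: continuous_form.
by apply/funext => y; rewrite big_cons expr2.
Qed.

Definition dlam i : V -> C := fun x => (\sum_a 2 * l a i 0 * dotv (l a) x)%:C.

Lemma symk_dlam k i : symk k one1 sf 1 1 (dlam i).
Proof.
rewrite (_ : dlam i = (fun x => \sum_a (2 * l a i 0)%:C * (dotv (l a) x)%:C)).
  by apply: symk_sum => a; apply: symkZ => //; exact: symk_form.
apply/funext => x; rewrite /dlam; elim/big_ind2 : _ => // [a b c d <- <-|a _].
  by rewrite -[RHS]rmorphD.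
by rewrite -[RHS]rmorphM.
Qed.

Lemma isD_lamfV i : isD i (fun x => (lamf x)^-1%:C)
  (fun x => - (dlam i x) * ((lamf x)^-1%:C * (lamf x)^-1%:C)).
Proof.
have H x : is_derive x (ebase R i) (fun x => (lamf x)^-1) (- (lamf x)^-2 * \sum_a 2 * l a i 0 * dotv (l a) x).
  have l0 : lamf x != 0 by rewrite gt_eqF// lamf_gt0.
  have := is_derive_lamf x i => -[d1 e1]; apply: DeriveDef; first exact: derivableV.
  by rewrite deriveV// e1.
apply: isD_eq (isD_real H) _ => x.
rewrite /dlam; set A := \sum_a _; set L := lamf x.
rewrite (_ : - A%:C * _ = ((- A) * (L^-1 * L^-1))%:C); last by rewrite !rmorphM rmorphN.
by congr (_ %:C); rewrite -exprVn; ring.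
Qed.

Lemma symk_lamfV k : symk k one1 sf (- 2) 1 (fun x => (lamf x)^-1%:C).
Proof.
have cl : ccontinuous (fun x => (lamf x)^-1%:C).
  apply: cc_real => x; apply: continuousV; first by rewrite gt_eqF// lamf_gt0.
  exact: continuous_lamf.
have bl : exists2 c : R, 0 <= c & forall x, normc ((lamf x)^-1%:C) <= c * (one1 x * sf x `^ (- 2)).
  exists 1 => // x; rewrite /one1 !mul1r normcR ger0_norm ?invr_ge0 ?(ltW (lamf_gt0 _))//.
  by rewrite powRN powR_mulrn ?(ltW (sf_gt0 _))// sf2.
elim: k => [|k IH]; first exact: symk0.
apply: symk_S => //.
move=> i; exists (fun x => - (dlam i x) * ((lamf x)^-1%:C * (lamf x)^-1%:C)).
  exact: isD_lamfV.
rewrite (_ : - 2 - 1 = 1 + (- 2 + - 2)); last by ring.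
apply: symkM1; first exact: sf_ge1.
  rewrite (_ : (fun x => _) = (fun x => (- 1) * dlam i x)); last by apply/funext => x; rewrite mulN1r.
  by apply: symkZ; exact: symk_dlam.
by apply: symkM1 => //; exact: sf_ge1.
Qed.
End forms.

(** * A smooth cutoff on the line *)

Section bump.
Variable R : realType.
Implicit Types (f g : R -> R).

(** Class C^k on the line, with the derivatives as existential witnesses, so that
   stability under products and composition is a plain induction. *)
Fixpoint Ck_line (k : nat) f : Prop :=
  continuous f /\
  match k with
  | 0 => True
  | k'.+1 => exists2 df, (forall t : R, is_derive t (1 : R) f (df t)) & Ck_line k' df
  end.

Lemma Ck_line_cont k f : Ck_line k f -> continuous f.
Proof. by case: k => [|k] []. Qed.

Lemma is_derive_cont f df : (forall t : R, is_derive t (1 : R) f (df t)) -> continuous f.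
Proof.
move=> H t; apply: differentiable_continuous; apply/derivable1_diffP.
by have [] := H t.
Qed.

Lemma Ck_line_S k f df : (forall t : R, is_derive t (1 : R) f (df t)) -> Ck_line k df -> Ck_line k.+1 f.
Proof. by move=> H Hd; split; [exact: is_derive_cont H|exists df]. Qed.

Lemma Ck_line_leq k f : Ck_line k.+1 f -> Ck_line k f.
Proof.
elim: k f => [|k IH] f [cf [df Df Hdf]]; split=> //.
by exists df => //; exact: IH.
Qed.

Lemma Ck_line_cst k (c : R) : Ck_line k (fun=> c).
Proof.
elim: k c => [|k IH] c; first by split=> //; exact: ccst.
by apply: (@Ck_line_S _ _ (fun=> 0)) => // t; exact: is_derive_cst.
Qed.

Lemma Ck_line_D k f g : Ck_line k f -> Ck_line k g -> Ck_line k (fun t => f t + g t).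
Proof.
elim: k f g => [|k IH] f g Hf Hg.
  by split=> //; apply: cadd; [exact: Ck_line_cont Hf|exact: Ck_line_cont Hg].
have [_ [df Df Hdf]] := Hf; have [_ [dg Dg Hdg]] := Hg.
by apply: (@Ck_line_S _ _ (fun t => df t + dg t)); exact: IH.
Qed.

Lemma Ck_line_M k f g : Ck_line k f -> Ck_line k g -> Ck_line k (fun t => f t * g t).
Proof.
elim: k f g => [|k IH] f g Hf Hg.
  by split=> //; apply: cmul; [exact: Ck_line_cont Hf|exact: Ck_line_cont Hg].
have [_ [df Df Hdf]] := Hf; have [_ [dg Dg Hdg]] := Hg.
apply: (@Ck_line_S _ _ (fun t => df t * g t + f t * dg t)).
  move=> t; have := is_deriveM (Df t) (Dg t); rewrite /GRing.scale /= => H.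
  by apply: (is_derive_eq H); ring.
by apply: Ck_line_D; apply: IH => //; exact: Ck_line_leq.
Qed.

Lemma Ck_line_comp k f g : Ck_line k f -> Ck_line k g -> Ck_line k (fun t => f (g t)).
Proof.
elim: k f g => [|k IH] f g Hf Hg.
  by split=> //; apply: ccomp; [exact: Ck_line_cont Hg|exact: Ck_line_cont Hf].
have [_ [df Df Hdf]] := Hf; have [_ [dg Dg Hdg]] := Hg.
apply: (@Ck_line_S _ _ (fun t => df (g t) * dg t)).
by apply: Ck_line_M => //; apply: IH => //; exact: Ck_line_leq.
Qed.

Lemma Ck_line_id k : Ck_line k (fun t => t).
Proof.
case: k => [|k]; first by split=> // t; exact: cvg_id.
by apply: (@Ck_line_S _ _ (fun=> 1)) (Ck_line_cst _ _) => t; exact: is_derive_id.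
Qed.

(** A family containing exp(-1/t), extended by 0, whose span is stable under
   derivation. *)
Definition flat (m : nat) (t : R) : R := if 0 < t then t ^- m * expR (- t^-1) else 0.

Lemma expR_ge_pow (m : nat) (y : R) : 0 <= y -> (y / m.+1%:R) ^+ m.+1 <= expR y.
Proof.
move=> y0; have -> : expR y = expR (y / m.+1%:R) ^+ m.+1.
  by rewrite -expRM_natl mulrC divfK ?pnatr_eq0.
rewrite ler_pXn2r ?nnegrE ?expR_ge0 ?divr_ge0//.
by apply: le_trans (expR_ge1Dx _); rewrite lerDr.
Qed.

(** As exp(-1/t) = O(t^(m+2)), a factor t^2 remains, which makes the function
   differentiable at 0. *)
Lemma flat_le m : exists2 c : R, 0 <= c & forall t, `|flat m t| <= c * t ^+ 2.
Proof.
(* exp(-1/t) <= (m+2)^(m+2) t^(m+2), from the power m+2 of y/(m+2) <= exp(y/(m+2)) at y = 1/t. *)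
exists (m.+2%:R ^+ m.+2) => [|t]; first exact: exprn_ge0.
rewrite /flat; case: ifPn => t0; last by rewrite normr0 mulr_ge0 ?sqr_ge0// exprn_ge0.
rewrite ger0_norm ?mulr_ge0 ?expR_ge0 ?invr_ge0 ?exprn_ge0 ?(ltW t0)//.
rewrite expRN.
have h : (t^-1 / m.+2%:R) ^+ m.+2 <= expR t^-1 by apply: expR_ge_pow; rewrite invr_ge0 ltW.
have p0 : 0 < (t^-1 / m.+2%:R) ^+ m.+2 by rewrite exprn_gt0// divr_gt0// invr_gt0.
have : (expR t^-1)^-1 <= ((t^-1 / m.+2%:R) ^+ m.+2)^-1 by rewrite lef_pV2// posrE expR_gt0.
move=> h2; apply: (@le_trans _ _ (t ^- m * ((t^-1 / m.+2%:R) ^+ m.+2)^-1)).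
  by rewrite ler_wpM2l// invr_ge0 exprn_ge0// ltW.
rewrite le_eqVlt; apply/orP; left; apply/eqP.
rewrite expr_div_n invf_div exprVn invrK -!exprVn.
have tn : t != 0 by rewrite gt_eqF.
rewrite -[m.+2]addn2 [t ^+ (m + 2)]exprD exprVn.
by field; rewrite ?expf_neq0 ?tn.
Qed.

Lemma is_derive_flat m (t : R) :
  is_derive t (1 : R) (flat m) (- m%:R * flat m.+1 t + flat m.+2 t).
Proof.
have [t0|t0|t0] := ltgtP t 0.
- have -> : - m%:R * flat m.+1 t + flat m.+2 t = 0.
    by rewrite /flat ltNge (ltW t0) /= mulr0 addr0.
  apply: (@near_eq_is_derive _ _ _ (cst 0)).
  near=> u; rewrite /flat ifF//; apply/negbTE; rewrite -leNgt ltW//.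
  by near: u; exact: lt_nbhsl.
- have tn : t != 0 by rewrite gt_eqF.
  apply: (@near_eq_is_derive R R R (fun u : R => (u^-1) ^+ m * expR (- u^-1))).
    near=> u; rewrite /flat ifT ?exprVn//.
    by near: u; exact: lt_nbhsr.
  have Hv : is_derive t (1 : R) (fun u : R => u^-1) (- t ^- 2).
      apply: DeriveDef; first by apply: derivableV => //; exact: derivable_id.
      by rewrite deriveV//; first by rewrite derive_id /GRing.scale /= mulr1.
    have H1 : is_derive t (1 : R) (fun u : R => (u^-1) ^+ m) (m%:R * (t^-1) ^+ m.-1 * (- t ^- 2)).
      have := is_deriveX m Hv; rewrite /GRing.scale /= => H.
      by move: H; rewrite exprfctE.
    have H2 : is_derive t (1 : R) (fun u : R => expR (- u^-1)) (expR (- t^-1) * (t ^- 2)).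
      have := @is_derive1_comp R expR (fun u : R => - u^-1) t _ _ (is_derive_expR (- t^-1)) (is_deriveN Hv).
      by rewrite opprK.
    have H3 := is_deriveM H1 H2.
    apply: (is_derive_eq H3); rewrite /GRing.scale /= /flat t0.
    case: m {H1 H3} => [|m] /=; first by rewrite !mul0r mulr0 oppr0 mul0r; ring.
    rewrite -!exprVn; generalize (expR (- t^-1)) (t^-1) => a b.
    by rewrite -[1 *- _]/(- m.+1%:R) !exprS expr0; ring.
have [c c0 Hc] := flat_le m.
rewrite t0 /flat ltxx mulr0 addr0 -/(flat m).
have key : h^-1 *: ((flat m \o shift (0 : R)) (h *: (1 : R)) - flat m 0) @[h --> 0^'] --> (0 : R).
  apply/cvgrPdist_le => e e0.
  near=> h; rewrite sub0r normrN /= addr0 /GRing.scale /= mulr1.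
  rewrite [flat m 0]/flat ltxx subr0 normrM normfV.
  have h0 : 0 < `|h| by rewrite normr_gt0; near: h; exact: nbhs_dnbhs_neq.
  rewrite mulrC ler_pdivrMr//; apply: le_trans (Hc h) _.
  rewrite -real_normK ?num_real// expr2 mulrA ler_wpM2r//.
  apply: (@le_trans _ _ ((c + 1) * `|h|)); first by rewrite ler_wpM2r// lerDl.
  rewrite mulrC -ler_pdivlMr ?ltr_wpDl//.
  near: h; apply: dnbhs0_le; rewrite divr_gt0// ltr_wpDl//.
apply: DeriveDef; first by apply/cvg_ex; exists 0.
exact: cvg_lim key.
Unshelve. all: by end_near. Qed.

Lemma Ck_line_flat k m : Ck_line k (flat m).
Proof.
elim: k m => [|k IH] m.
  by split=> //; exact: is_derive_cont (is_derive_flat m).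
apply: (Ck_line_S (is_derive_flat m)).
by apply: Ck_line_D => //; apply: Ck_line_M => //; exact: Ck_line_cst.
Qed.

Lemma flat0_mono (s t : R) : s <= t -> flat 0 s <= flat 0 t.
Proof.
rewrite /flat => st; case: ifPn => [s0|_].
  rewrite (lt_le_trans s0 st) !expr0 invr1 !mul1r ler_expR lerN2 lef_pV2// posrE//.
  exact: lt_le_trans st.
by case: ifPn => // _; rewrite expr0 invr1 mul1r expR_ge0.
Qed.

(** Equal to 1 for t <= 1, as then flat 0 (t - 1) = 0, and to 0 for t >= 2, as
   then flat 0 (t - 1) >= flat 0 1. *)
Definition bump (t : R) : R := flat 0 (flat 0 1 - flat 0 (t - 1)) / flat 0 (flat 0 1).

Lemma flat0_gt0 (t : R) : 0 < t -> 0 < flat 0 t.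
Proof. by move=> t0; rewrite /flat t0 expr0 invr1 mul1r expR_gt0. Qed.

Lemma bump1 (t : R) : t <= 1 -> bump t = 1.
Proof.
move=> t1; rewrite /bump [flat 0 (t - 1)]/flat ltNge subr_le0 t1 /= subr0 divff//.
by rewrite gt_eqF// flat0_gt0// flat0_gt0.
Qed.

Lemma bump0 (t : R) : 2 <= t -> bump t = 0.
Proof.
move=> t2; rewrite /bump [X in X / _]/flat ltNge subr_le0 flat0_mono ?mul0r//.
by rewrite lerBrDr.
Qed.

Lemma Ck_line_bump k : Ck_line k bump.
Proof.
apply: Ck_line_M; last exact: Ck_line_cst.
apply: (@Ck_line_comp k (flat 0) (fun t => flat 0 1 - flat 0 (t - 1))); first exact: Ck_line_flat.
rewrite (_ : (fun t => _) = (fun t => flat 0 1 + (- 1) * flat 0 (t - 1))).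
  apply: Ck_line_D; first exact: Ck_line_cst.
  apply: Ck_line_M; first exact: Ck_line_cst.
  apply: (@Ck_line_comp k (flat 0) (fun t => t - 1)); first exact: Ck_line_flat.
  by apply: Ck_line_D; [exact: Ck_line_id|exact: Ck_line_cst].
by apply/funext => t; rewrite mulN1r.
Qed.

Definition dbump (i : nat) : R -> R := iter i (@derive1 R R) bump.

Lemma Ck_line_dbump k i : Ck_line k (dbump i).
Proof.
elim: i k => [|i IH] k; first exact: Ck_line_bump.
have [_ [df Df Hdf]] := IH k.+1.
rewrite /dbump iterS (_ : derive1 _ = df)//.
by apply/funext => t; rewrite derive1E; have [] := Df t.
Qed.

Lemma is_derive_dbump i (t : R) : is_derive t (1 : R) (dbump i) (dbump i.+1 t).
Proof.
have [_ [df Df Hdf]] := Ck_line_dbump 1 i.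
by rewrite /dbump iterS derive1E; have [d e] := Df t; exact: DeriveDef.
Qed.

Lemma dbump_near_cst i (t c : R) : (\near t, bump t = c) -> \near t, dbump i.+1 t = 0.
Proof.
move=> H; elim: i => [|i IH].
  have := near_join H; apply: filterS => u Hu.
  by rewrite /dbump /= derive1E (near_eq_derive (g := cst c))// derive_cst.
have := near_join IH; apply: filterS => u Hu.
by rewrite /dbump iterS derive1E (near_eq_derive (g := cst 0))// derive_cst.
Qed.

Lemma dbump_lt1 i (t : R) : t < 1 -> dbump i.+1 t = 0.
Proof.
move=> t1; apply: (nbhs_singleton (@dbump_near_cst i t 1 _)).
by near=> u; apply: bump1; near: u; exact: lt_le_nbhsl.
Unshelve. all: by end_near. Qed.

Lemma dbump_gt2 i (t : R) : 2 < t -> dbump i t = 0.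
Proof.
move=> t2; case: i => [|i]; first by apply: bump0; exact: ltW.
apply: (nbhs_singleton (@dbump_near_cst i t 0 _)).
by near=> u; apply: bump0; apply: ltW; near: u; exact: lt_nbhsr.
Unshelve. all: by end_near. Qed.

(** The derivatives are constant outside of [1, 2], which is compact. *)
Lemma dbump_bounded i : exists2 c : R, 0 <= c & forall t, `|dbump i t| <= c.
Proof.
have cd := Ck_line_cont (Ck_line_dbump 0 i).
have cn : {within `[1 : R, 2], continuous (fun t => `|dbump i t|)}.
  apply: continuous_subspaceT => t.
  by apply: (@continuous_comp _ _ _ (dbump i) Num.norm); [exact: cd|exact: norm_continuous].
have [c _ Hc] := EVT_max (ler1n _ 2) cn.
exists (1 + `|dbump i c|); first by rewrite addr_ge0.
move=> t; have [t1|t1] := ltP t 1.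
  case: i cd cn Hc => [|i] cd cn Hc; last by rewrite dbump_lt1// normr0 addr_ge0.
  by rewrite /dbump /= bump1 ?(ltW t1)// normr1 lerDl.
have [t2|t2] := ltP 2 t; first by rewrite dbump_gt2// normr0 addr_ge0.
apply: le_trans (Hc t _) _; first by rewrite in_itv /= t1 t2.
by rewrite lerDr.
Qed.
End bump.

(** * Japanese bracket, Shubin amplitudes and Schwartz functions *)

Section japanese_bracket.
Variable R : realType.

Lemma japanese_sf n : @japanese R n = sf (@ebase R n).
Proof.
apply/funext => x; rewrite /japanese /enorm sqr_sqrtr ?dotv_ge0// /sf /lamf; congr (Num.sqrt (1 + _)).
by apply: eq_bigr => i _; rewrite dotvC dotv_ebase expr2.
Qed.

Lemma japanese_ge1 n (x : 'cV[R]_n) : 1 <= japanese x.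
Proof. by rewrite japanese_sf sf_ge1. Qed.

Lemma japanese_gt0 n (x : 'cV[R]_n) : 0 < japanese x.
Proof. exact: lt_le_trans (japanese_ge1 x). Qed.

Lemma japanese2 n (x : 'cV[R]_n) : japanese x ^+ 2 = 1 + dotv x x.
Proof. by rewrite sqr_sqrtr ?addr_ge0 ?sqr_ge0// sqr_sqrtr// dotv_ge0. Qed.

Lemma dotv_col_mx a b (u u' : 'cV[R]_a) (v v' : 'cV[R]_b) :
  dotv (col_mx u v) (col_mx u' v') = dotv u u' + dotv v v'.
Proof.
rewrite /dotv big_split_ord; congr (_ + _); apply: eq_bigr => i _.
  by rewrite !col_mxEu.
by rewrite !col_mxEd.
Qed.

Lemma japanese_le a b (u : 'cV[R]_a) (v : 'cV[R]_b) :
  (japanese u <= japanese v) = (dotv u u <= dotv v v).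
Proof.
rewrite -(ler_pXn2r (n := 2)) ?nnegrE ?(ltW (japanese_gt0 _))//.
by rewrite !japanese2 lerD2l.
Qed.

Lemma japanese_col_mxl a b (u : 'cV[R]_a) (v : 'cV[R]_b) :
  japanese u <= japanese (col_mx u v).
Proof. by rewrite japanese_le dotv_col_mx lerDl dotv_ge0. Qed.

Lemma japanese_col_mxr a b (u : 'cV[R]_a) (v : 'cV[R]_b) :
  japanese v <= japanese (col_mx u v).
Proof. by rewrite japanese_le dotv_col_mx lerDr dotv_ge0. Qed.

Lemma japanese_col_mxM a b (u : 'cV[R]_a) (v : 'cV[R]_b) :
  japanese (col_mx u v) <= japanese u * japanese v.
Proof.
rewrite -(ler_pXn2r (n := 2)) ?nnegrE ?mulr_ge0 ?(ltW (japanese_gt0 _))//.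
rewrite exprMn !japanese2 dotv_col_mx mulrDl mul1r mulrDr mulr1.
by have := mulr_ge0 (dotv_ge0 u) (dotv_ge0 v); lra.
Qed.

(** Each of the n factors 1 + x_i^2 is at most <x>^2. *)
Lemma japanese_cauchyw n (x : 'cV[R]_n) : japanese x `^ (- (2 * n%:R)) <= cauchyw x.
Proof.
rewrite powRN -natrM powR_mulrn ?(ltW (japanese_gt0 _))// exprM japanese2.
rewrite /cauchyw prodfV lef_pV2 ?posrE; last 2 first.
- by rewrite exprn_gt0// ltr_pwDl// dotv_ge0.
- by apply: prodr_gt0 => i _; rewrite ltr_pwDl// sqr_ge0.
rewrite -[X in _ <= _ ^+ X]card_ord -prodr_const; apply: ler_prod => i _.
rewrite addr_ge0 ?sqr_ge0//= lerD2l /dotv (bigD1 i)//= expr2 lerDl.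
by apply: sumr_ge0 => j _; rewrite -expr2 sqr_ge0.
Qed.

Lemma japanese_powR_cauchyw n (x : 'cV[R]_n) r : r <= - (2 * n%:R) -> japanese x `^ r <= cauchyw x.
Proof.
by move=> rn; apply: le_trans (japanese_cauchyw x); rewrite ler_powR// japanese_ge1.
Qed.
End japanese_bracket.

Section shubin_class.
Variables (R : realType) (n : nat).
Local Notation C := R[i].
Local Notation V := 'cV[R]_n.
Implicit Type f : V -> C.

(** Iterated derivatives along a list of directions; multi-indices correspond to
   sorted lists, and smoothness makes the order of the list irrelevant. *)
Definition Ds (s : seq 'I_n) f := foldr (fun i g => pderiv i g) f s.

Lemma smooth_pderiv f i : smooth f -> smooth (pderiv i f).
Proof. by move=> sf k; have [_ /(_ i)[]] := sf k.+1. Qed.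

Lemma smooth_Ds f s : smooth f -> smooth (Ds s f).
Proof. by move=> sf; elim: s => //= i s IH; exact: smooth_pderiv. Qed.

Lemma smooth_pderivable f i : smooth f -> pderivable i f.
Proof. by move=> /(_ 1%N)[_ /(_ i)[]]. Qed.

Lemma smooth_cc f : smooth f -> ccontinuous f.
Proof. by move=> /(_ 0%N)[]. Qed.

Lemma pderivC f i j : smooth f -> pderiv i (pderiv j f) = pderiv j (pderiv i f).
Proof.
move=> sf.
have di := pderivable_isD (smooth_pderivable i sf).
have dj := pderivable_isD (smooth_pderivable j sf).
have si := smooth_pderiv i sf; have sj := smooth_pderiv j sf.
have dij := pderivable_isD (smooth_pderivable j si).
have dji := pderivable_isD (smooth_pderivable i sj).
have [ci1 ci2] := smooth_cc (smooth_pderiv j si).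
have [cj1 cj2] := smooth_cc (smooth_pderiv i sj).
have E1 := clairaut (fun x => (di x).1) (fun x => (dj x).1) (fun x => (dij x).1) (fun x => (dji x).1) ci1 cj1.
have E2 := clairaut (fun x => (di x).2) (fun x => (dj x).2) (fun x => (dij x).2) (fun x => (dji x).2) ci2 cj2.
apply/funext => x; apply/eqP; rewrite eq_complex; apply/andP; split; apply/eqP.
  exact: (esym (congr1 (fun F => F x) E1)).
exact: (esym (congr1 (fun F => F x) E2)).
Qed.

Lemma Ds_cat s t f : Ds (s ++ t) f = Ds s (Ds t f).
Proof. by rewrite /Ds foldr_cat. Qed.

Lemma Ds_mid t1 i t2 f : smooth f -> Ds (t1 ++ i :: t2) f = Ds (i :: t1 ++ t2) f.
Proof.
move=> sf; elim: t1 => //= j t1 IH.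
rewrite IH /=; apply: pderivC; exact: smooth_Ds.
Qed.

Lemma Ds_perm s t f : smooth f -> perm_eq s t -> Ds s f = Ds t f.
Proof.
move=> sf; elim: s t => [|i s IH] t; first by rewrite perm_sym => /perm_nilP ->.
move=> st; have it : i \in t by rewrite -(perm_mem st) mem_head.
case/splitPr: it st => t1 t2 st; rewrite Ds_mid//=.
rewrite (IH (t1 ++ t2))//.
by rewrite -(perm_cons i) (perm_trans st)// -cat1s perm_catCA.
Qed.

Definition mulseq (alpha : 'I_n -> nat) := flatten [seq nseq (alpha i) i | i <- enum 'I_n].

Lemma mulderivE alpha f : mulderiv alpha f = Ds (mulseq alpha) f.
Proof.
rewrite /mulderiv /mulseq; elim: (enum _) => //= i s IH.
rewrite Ds_cat -IH; elim: (alpha i) => //= k ->.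
by [].
Qed.

Lemma size_mulseq alpha : size (mulseq alpha) = mulorder alpha.
Proof.
rewrite size_flatten /shape -map_comp sumnE big_map /mulorder big_enum /=.
by apply: eq_bigr => i _; rewrite size_nseq.
Qed.

Lemma mulseq_count (s : seq 'I_n) : perm_eq s (mulseq (fun i => count_mem i s)).
Proof.
apply/allP => i _ /=; apply/eqP; rewrite /mulseq count_flatten -map_comp sumnE big_map big_enum /=.
rewrite (bigD1 i)//= big1 => [|j ji]; rewrite ?addn0 count_nseq /= ?eqxx ?mul1n//.
by rewrite (negbTE ji).
Qed.

(** A derivative in [symk] is taken along any list of directions, and reduces to
   a multi-index by permuting the list. *)
Lemma shubin_symk m rho f : shubin m rho f -> forall k, symk k one1 (@japanese R n) m rho f.
Proof.
move=> [sf bf].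
have : forall s, exists C : R, forall x, normc (Ds s f x) <= C * japanese x `^ (m - rho * (size s)%:R).
  move=> s; have [C HC] := bf (fun i => count_mem i s); exists C => x.
  by rewrite (Ds_perm sf (mulseq_count s)) -mulderivE (perm_size (mulseq_count s)) size_mulseq.
move=> {}bf k; elim: k m f sf bf => [|k IH] m f sf bf.
  apply: symk0; first exact: smooth_cc.
  have [C HC] := bf [::]; exists (Num.max C 0); first by rewrite le_max lexx orbT.
  move=> x; have := HC x; rewrite /= mulr0 subr0 /one1 mul1r => /le_trans; apply.
  by rewrite ler_wpM2r ?powR_ge0// le_max lexx.
apply: symk_S => //; first exact: smooth_cc.
  have [C HC] := bf [::]; exists (Num.max C 0); first by rewrite le_max lexx orbT.
  move=> x; have := HC x; rewrite /= mulr0 subr0 /one1 mul1r => /le_trans; apply.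
  by rewrite ler_wpM2r ?powR_ge0// le_max lexx.
move=> i; exists (pderiv i f); first exact/pderivable_isD/smooth_pderivable.
apply: IH; first exact: smooth_pderiv.
move=> s; have [C HC] := bf (rcons s i); exists C => x.
have := HC x; rewrite -cats1 Ds_cat size_cat addn1 -natr1 /=.
by congr (_ <= _ * _ `^ _); ring.
Qed.

Lemma symk_smooth chi s m rho f : (forall k, symk k chi s m rho f) -> smooth f.
Proof. by move=> H k; exact: symk_Ck (H k). Qed.

Lemma symk_Ds chi s m rho f t : (forall k, symk k chi s m rho f) ->
  (forall k, symk k chi s (m - rho * (size t)%:R) rho (Ds t f)).
Proof.
elim: t => [|i t IH] H k /=; first by rewrite mulr0 subr0.
have [_] := symk_isD (IH H k.+1) i; rewrite -natr1.
by rewrite mulrDr mulr1 opprD addrA.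
Qed.

Lemma symk_shubin m rho f : (forall k, symk k one1 (@japanese R n) m rho f) -> shubin m rho f.
Proof.
move=> H; split; first exact: symk_smooth H.
move=> alpha; have [c c0 Hc] := symk_bound (symk_Ds (mulseq alpha) H 0%N).
exists c => x; rewrite mulderivE; apply: le_trans (Hc x) _.
by rewrite /one1 mul1r size_mulseq.
Qed.

(** Schwartz functions as the symbols of all negative orders. *)
Definition schw f := forall k K : nat, symk k one1 (@japanese R n) (- K%:R) 0 f.

Lemma schwP f : is_schwartz f <-> schw f.
Proof.
split=> [[sf bf] k K|H].
  apply: shubin_symk; split=> // alpha; have [C HC] := bf alpha K; exists C => x.
  rewrite mul0r subr0 powRN powR_mulrn ?(ltW (japanese_gt0 _))//.
  by rewrite ler_pdivlMr ?exprn_gt0 ?japanese_gt0// mulrC.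
have H' (K : nat) := symk_shubin (fun k => H k K).
split; first by case: (H' 0%N).
move=> alpha K; have [_ /(_ alpha)[C HC]] := H' K; exists C => x.
have := HC x; rewrite mul0r subr0 powRN powR_mulrn ?(ltW (japanese_gt0 _))//.
by rewrite ler_pdivlMr ?exprn_gt0 ?japanese_gt0// mulrC.
Qed.
End shubin_class.

Section monomial.
Variable R : realType.

(** The i-th coordinate of G Z is proportional to the coordinate [p i] of Z, or
   constant.  No coordinate of Z may be used twice, since a coordinate line would
   then be mapped to a diagonal. *)
Lemma monomial_mapP n m (e : R) (G : 'cV[R]_n -> 'cV[R]_m) (p : 'I_m -> option 'I_n) (c : 'I_m -> R) :
  (forall Z i, G Z i 0 = if p i is Some j then e * Z j 0 else c i) ->
  (forall i i' j, p i = Some j -> p i' = Some j -> i = i') ->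
  monomial_map e G.
Proof.
move=> HG Hp; split.
  apply: continuous_cV => i; case E : (p i) => [j|].
    rewrite (_ : (fun _ => _) = (fun Z : 'cV[R]_n => e * Z j 0)); last by apply/funext => Z; rewrite HG E.
    by apply: cmul; [exact: ccst|exact: coord_cont].
  rewrite (_ : (fun _ => _) = cst (c i)); first exact: cst_continuous.
  by apply/funext => Z; rewrite HG E.
move=> j; have [[i pi]|no] := pselect (exists i, p i = Some j); [left|right].
  exists i => Z h; apply/colP => i'; rewrite HG [in RHS]mxE HG !mxE eqxx andbT.
  case E : (p i') => [j'|]; last first.
    have [ii|] := eqVneq i' i; last by rewrite mulr0 addr0.
    by rewrite ii pi in E.
  rewrite !mxE eqxx andbT mulrDr mulrA; congr (_ + _ * _).
  have [jj|jj] := eqVneq j' j.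
    by rewrite jj in E; rewrite (Hp _ _ _ E pi) eqxx.
  have [ii|//] := eqVneq i' i.
  by move: E; rewrite ii pi => -[] /esym/eqP; rewrite (negbTE jj).
move=> Z h; apply/colP => i'; rewrite !HG; case E : (p i') => [j'|//].
rewrite !mxE eqxx andbT; have [jj|] := eqVneq j' j; last by rewrite mulr0 addr0.
by case: no; exists i'; rewrite E jj.
Qed.

Lemma symk_mono n m (G : 'cV[R]_n -> 'cV[R]_m) (e : R) k chi s mu rho (f : 'cV[R]_m -> R[i]) :
  monomial_map e G -> 0 <= e <= 1 -> (forall x, 0 <= chi x) ->
  symk k chi s mu rho f ->
  symk k (fun Z => chi (G Z)) (fun Z => s (G Z)) mu rho (fun Z => f (G Z)).
Proof.
move=> mG e01 chi0 [c c0 H]; exists c => //.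
apply: (Dc_mono mG e01 (W := fun j x => c * (chi x * s x `^ (mu - rho * j%:R)))) => // j x.
by rewrite mulr_ge0// mulr_ge0 ?powR_ge0.
Qed.
End monomial.

Section cutoffs.
Variables (R : realType) (n : nat).
Local Notation C := R[i].
Local Notation V := 'cV[R]_n.

Lemma isD_real_comp (g dg : R -> R) (u du : V -> R) i :
  (forall t : R, is_derive t (1 : R) g (dg t)) ->
  (forall x, is_derive x (ebase R i) u (du x)) ->
  isD i (fun x => (g (u x))%:C) (fun x => (dg (u x))%:C * (du x)%:C).
Proof.
move=> Hg Hu; apply: isD_eq (@isD_real _ _ _ _ (fun x => dg (u x) * du x) _) _ => x.
  exact: is_derive_real_comp.
by rewrite -rmorphM.
Qed.

Lemma dotv_lamf (x : V) : dotv x x = lamf (@ebase R n) x - 1.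
Proof. by rewrite -sf2 -japanese_sf japanese2 addrC addKr. Qed.

Lemma is_derive_sqnorm (x : V) i : is_derive x (ebase R i) (fun x => dotv x x) (2 * x i 0).
Proof.
rewrite (_ : (fun x => dotv x x) = lamf (@ebase R n) + cst (-1)); last first.
  by apply/funext => y; rewrite dotv_lamf.
apply: (is_derive_eq (is_deriveD (is_derive_lamf (@ebase R n) x i) (is_derive_cst _ _ _))).
rewrite addr0 (bigD1 i)//= big1 => [|j ji]; last by rewrite mxE eq_sym (negbTE ji) mulr0 mul0r.
by rewrite mxE !eqxx mulr1 dotvC dotv_ebase addr0.
Qed.

Lemma continuous_sqnorm : continuous (fun x : V => dotv x x).
Proof.
rewrite (_ : (fun _ => _) = (fun x : V => lamf (@ebase R n) x + - 1)).
  by apply: cadd; [exact: continuous_lamf|exact: ccst].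
by apply/funext => y; rewrite dotv_lamf.
Qed.

Lemma symk_coord k (i : 'I_n) : symk k one1 (@japanese R n) 1 1 (fun x : V => (x i 0)%:C).
Proof.
have := symk_form (@ebase R n) i k; rewrite -japanese_sf.
by congr symk; apply/funext => x; rewrite dotvC dotv_ebase.
Qed.

Lemma dbump_sqnorm_bound i (K : nat) : exists2 c : R, 0 <= c &
  forall x : V, normc ((dbump i (dotv x x))%:C) <= c * (one1 x * japanese x `^ (- K%:R)).
Proof.
have [c c0 Hc] := dbump_bounded R i.
exists (c * 2 ^+ K); first by rewrite mulr_ge0// exprn_ge0.
move=> x; rewrite normcR /one1 mul1r powRN powR_mulrn ?(ltW (japanese_gt0 _))//.
rewrite ler_pdivlMr ?exprn_gt0 ?japanese_gt0//.
have [x2|x2] := ltP 2 (dotv x x).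
  by rewrite dbump_gt2// normr0 mul0r mulr_ge0// exprn_ge0.
rewrite ler_pM// ?exprn_ge0 ?(ltW (japanese_gt0 _))//.
rewrite lerXn2r ?nnegrE ?(ltW (japanese_gt0 _))//.
rewrite -(ler_pXn2r (n := 2)) ?nnegrE ?(ltW (japanese_gt0 _))// japanese2.
lra.
Qed.

Lemma cc_dbump_sqnorm i : ccontinuous (fun x : V => (dbump i (dotv x x))%:C).
Proof. by apply: cc_real; apply: (ccomp continuous_sqnorm (Ck_line_cont (Ck_line_dbump R 0 i))). Qed.

(** All the derivatives of the bump function are treated at once, for the gradient of
   dbump i (|x|^2) is dbump i.+1 (|x|^2) times a symbol of order 1, which is
   harmless on the support. *)
Lemma symk_dbump_sqnorm k (i K : nat) :
  symk k one1 (@japanese R n) (- K%:R) 0 (fun x : V => (dbump i (dotv x x))%:C).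
Proof.
elim: k i K => [|k IH] i K.
  by apply: symk0; [exact: cc_dbump_sqnorm|exact: dbump_sqnorm_bound].
apply: symk_S => //; [exact: cc_dbump_sqnorm|exact: dbump_sqnorm_bound|].
move=> j; exists (fun x : V => (dbump i.+1 (dotv x x))%:C * (2 * x j 0)%:C).
  by apply: isD_real_comp => [t|x]; [exact: is_derive_dbump|exact: is_derive_sqnorm].
rewrite subr0 (_ : - K%:R = - K.+1%:R + 1 :> R); last by rewrite -natr1 opprD addrNK.
apply: symkM1 => //; first exact: japanese_ge1.
rewrite (_ : (fun x => _) = (fun x : V => 2%:C * (x j 0)%:C)).
  by apply: symkZ => //; apply: symk_le (symk_coord k j) => //; exact: japanese_ge1.
by apply/funext => x; rewrite -rmorphM.
Qed.

Lemma schw_bump : schw (fun x : V => (bump (dotv x x))%:C).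
Proof. by move=> k K; exact: (symk_dbump_sqnorm k 0). Qed.

(** Here D is the family of the iterated derivatives of a function on the line.
   The derivatives of D_i(u) are D_(i+1)(u) du_j, so that one induction on k, for
   all i at once, replaces the formula for the higher derivatives of a composite
   function. *)
Lemma symk_dcomp (D : nat -> R -> R) (P : R -> bool) (u : V -> R) (du : 'I_n -> V -> R) :
  (forall i (t : R), is_derive t (1 : R) (D i) (D i.+1 t)) ->
  (forall i, exists2 c : R, 0 <= c & forall t, `|D i t| <= c) ->
  (forall i t, ~~ P t -> D i t = 0) ->
  (forall i x, is_derive x (ebase R i) u (du i x)) -> continuous u ->
  (forall k i, symk k one1 (@japanese R n) (- 1) 1 (fun x => (du i x)%:C)) ->
  forall k i, symk k (fun x => (P (u x))%:R) (@japanese R n) 0 1 (fun x => (D i (u x))%:C).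
Proof.
move=> HD bD PD Hu cu sdu.
have cc i : ccontinuous (fun x => (D i (u x))%:C).
  by apply: cc_real; exact: (ccomp cu (is_derive_cont (HD i))).
have bd i : exists2 c : R, 0 <= c &
    forall x, normc ((D i (u x))%:C) <= c * ((P (u x))%:R * japanese x `^ 0).
  have [c c0 Hc] := bD i; exists c => // x; rewrite normcR powRr0 mulr1.
  case: (boolP (P (u x))) => [_|/PD ->]; first by rewrite mulr1.
  by rewrite normr0 mulr0.
elim=> [|k IH] i; first exact: symk0.
apply: symk_S => //.
move=> j; exists (fun x => (D i.+1 (u x))%:C * (du j x)%:C); first exact: isD_real_comp.
have := symkM _ _ _ (IH i.+1) (sdu k j); rewrite add0r.
rewrite (_ : (fun x => (P (u x))%:R * one1 x) = (fun x => (P (u x))%:R)); last first.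
  by apply/funext => x; rewrite /one1 mulr1.
by apply => // x; exact: japanese_ge1.
Qed.

Section form_cutoff.
Variables (I : finType) (l : I -> V) (c : R).

(** The ratio c |l(x)|^2 / <x>^2, a symbol of order 0. *)
Definition uform (x : V) : R := c * (\sum_a dotv (l a) x ^+ 2) * (lamf (@ebase R n) x)^-1.

Lemma symk_dotv k (v : V) : symk k one1 (@japanese R n) 1 1 (fun x => (dotv v x)%:C).
Proof.
rewrite (_ : (fun x => _) = (fun x : V => \sum_i (v i 0)%:C * (x i 0)%:C)).
  by apply: symk_sum => i; apply: symkZ => //; exact: symk_coord.
apply/funext => x; rewrite /dotv; elim/big_ind2 : _ => // [a b a' b' <- <-|i _].
  by rewrite -[RHS]rmorphD.
by rewrite -[RHS]rmorphM.
Qed.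

Lemma symk_uform k : symk k one1 (@japanese R n) 0 1 (fun x => (uform x)%:C).
Proof.
rewrite (_ : (fun x => _) = (fun x : V => (c%:C * \sum_a (dotv (l a) x)%:C * (dotv (l a) x)%:C) *
   (lamf (@ebase R n) x)^-1%:C)).
  rewrite (_ : 0 = 2 + (- 2) :> R); last by rewrite subrr.
  apply: symkM1; first exact: japanese_ge1.
    apply: symkZ => //; apply: symk_sum => a.
    by rewrite (_ : 2 = 1 + 1 :> R)//; apply: symkM1; [exact: japanese_ge1|exact: symk_dotv..].
  by rewrite japanese_sf; exact: symk_lamfV.
apply/funext => x; rewrite /uform 2!rmorphM; congr (_ * _ * _).
elim/big_ind2 : _ => // [a b a' b' <- <-|i _].
  by rewrite -[RHS]rmorphD.
by rewrite -[RHS]rmorphM expr2.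
Qed.

Lemma uform_deriv : exists du : 'I_n -> V -> R,
  [/\ forall i x, is_derive x (ebase R i) uform (du i x), continuous uform &
   forall k i, symk k one1 (@japanese R n) (- 1) 1 (fun x => (du i x)%:C)].
Proof.
exists (fun i x => Re (pderiv i (fun x => (uform x)%:C) x)); split.
- by move=> i x; have [H _] := symk_isD (symk_uform 1) i; have [] := H x.
- by have [] := symk_cc (symk_uform 0).
- move=> k i; have [H S] := symk_isD (symk_uform k.+1) i.
  move: S; rewrite sub0r; congr symk; apply/funext => x.
  apply/eqP; rewrite eq_complex /= eqxx /=.
  by apply/eqP; exact: derive_cst.
Qed.

(** Equal to 1 where |l(x)| is small compared with <x>, to 0 where it
   exceeds a multiple of <x>. *)
Definition wcut (x : V) : C := (bump (uform x))%:C.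

Lemma symk_wcut k : symk k (fun x => (uform x <= 2)%R%:R) (@japanese R n) 0 1 wcut.
Proof.
have [du [d1 d2 d3]] := uform_deriv.
apply: (symk_dcomp (D := @dbump R) (P := fun t => t <= 2) _ _ _ d1 d2 d3 k 0).
- exact: is_derive_dbump.
- exact: dbump_bounded.
- by move=> i t; rewrite -ltNge; exact: dbump_gt2.
Qed.

Lemma symk_1wcut k : symk k (fun x => (1 <= uform x)%R%:R) (@japanese R n) 0 1 (fun x => 1 - wcut x).
Proof.
have [du [d1 d2 d3]] := uform_deriv.
(* The iterated derivatives of 1 - bump. *)
pose D (i : nat) (t : R) := if i is 0 then 1 - bump t else - dbump i t.
have := (symk_dcomp (D := D) (P := fun t => 1 <= t) _ _ _ d1 d2 d3 k 0).
rewrite (_ : (fun x => (D 0%N _)%:C) = (fun x => 1 - wcut x)); last first.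
  by apply/funext => x; rewrite /wcut /D rmorphB.
apply.
- move=> [|i] t; rewrite /D.
    have := is_deriveB (is_derive_cst (1 : R) t (1 : R)) (is_derive_dbump 0 t).
    by rewrite sub0r.
  by apply: is_deriveN; exact: is_derive_dbump.
- move=> i; have [e e0 He] := dbump_bounded R i; exists (1 + e); first by rewrite addr_ge0.
  case: i He => [|i] He t; rewrite /D.
    by apply: le_trans (ler_normB _ _) _; rewrite normr1 lerD2l; exact: He.
  by rewrite normrN (le_trans (He t))// lerDr.
- move=> [|i] t; rewrite -ltNge => t1; rewrite /D.
    by rewrite bump1 ?subrr// ltW.
  by rewrite dbump_lt1// oppr0.
Qed.
End form_cutoff.
End cutoffs.

(** * Derivatives and integrals *)

Section integration_by_parts.
Variable R : realType.
Local Notation C := R[i].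
Notation mu1 := (@lebesgue_measure R).

(** The fundamental theorem of calculus on [-n, n], with boundary terms that tend
   to 0. *)
Lemma integral_derive_line (p dp : R -> R) (c : R) :
  (forall t : R, is_derive t (1 : R) p (dp t)) -> continuous dp ->
  (forall t, `|p t| <= c * (1 + t ^+ 2)^-1) ->
  (forall t, `|dp t| <= c * (1 + t ^+ 2)^-1) ->
  \int[mu1]_(t in setT) dp t = 0.
Proof.
move=> Hp cdp bp bdp.
have c0 : 0 <= c.
  by have := le_trans (normr_ge0 _) (bp 0); rewrite expr0n addr0 invr1 mulr1.
have iG : mu1.-integrable setT (EFin \o (fun t : R => c * (1 + t ^+ 2)^-1)).
  rewrite [X in integrable _ _ X](_ : _ = (fun x => c%:E * ((1 + x ^+ 2)^-1)%:E)%E).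
    by apply: integrableZl => //; exact: integrable_oneDsqrV.
  by apply/funext => x /=; rewrite EFinM.
have mdp : measurable_fun [set: R] dp by exact: continuous_measurable_fun.
have idp : mu1.-integrable setT (EFin \o dp).
  apply: (le_integrable measurableT _ _ iG); first exact/measurable_EFinP.
  by move=> t _ /=; rewrite lee_fin (le_trans (bdp t))// ler_norm.
pose J (n : nat) : set R := `[(- (n.+1%:R)), n.+1%:R]%classic.
have lim1 : \int[mu1]_(t in setT) (dp \_ (J n)) t @[n --> \oo] --> \int[mu1]_(t in setT) dp t.
  rewrite /Rintegral; apply: fine_cvg; rewrite fineK; last exact: integrable_fin_num idp.
  apply: (@dominated_cvg _ _ _ mu1 _ measurableT _ _ (fun t => (c * (1 + t ^+ 2)^-1)%:E)) => //.
  - move=> n; apply/measurable_EFinP; apply/(measurable_restrictT _ (measurable_itv _)).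
    exact: measurable_funS mdp.
  - move=> t _; apply: cvg_EFin; first exact: nearW.
    apply: (cvg_near_cst (dp t)); near=> n.
    rewrite /= patchE mem_set// /J /= in_itv /= -ler_norml ltW//.
    have : (Num.truncn `|t|).+1%:R <= n.+1%:R :> R.
      by rewrite ler_nat ltnS; near: n; exact: nbhs_infty_ge.
    by apply: lt_le_trans; exact: truncnS_gt.
  - move=> n t _ /=; rewrite lee_fin patchE; case: ifP => _; first exact: bdp.
    by rewrite normr0 mulr_ge0// invr_ge0 addr_ge0// sqr_ge0.
have E n : \int[mu1]_(t in setT) (dp \_ (J n)) t = p n.+1%:R - p (- n.+1%:R).
  rewrite -Rintegral_mkcond /Rintegral /J (@continuous_FTC2 _ dp p)//.
  - by rewrite -subr_gt0 opprK addr_gt0.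
  - exact: continuous_subspaceT.
  - have cp := is_derive_cont Hp; split.
    + by move=> t _; have [] := Hp t.
    + exact/cvg_at_right_filter/cp.
    + exact/cvg_at_left_filter/cp.
  - by move=> t _; rewrite derive1E; have [] := Hp t.
have lim2 : \int[mu1]_(t in setT) (dp \_ (J n)) t @[n --> \oo] --> (0 : R).
  apply/norm_cvg0P; apply: (@squeeze_cvgr _ _ _ _ (cst 0) (fun n : nat => (c + c) * n.+1%:R^-1)).
  - apply: nearW => n; rewrite normr_ge0 E /= (le_trans (ler_normB _ _))// mulrDl.
    have h : c * (1 + n.+1%:R ^+ 2)^-1 <= c / n.+1%:R.
      rewrite ler_wpM2l// lef_pV2 ?posrE ?ltr0n// ?ltr_pwDl ?sqr_ge0//.
      rewrite -natrX nat1r ler_nat; apply: leqW; exact: leq_pexp2l (isT : 1 <= 2)%N.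
    by apply: lerD; [exact: le_trans (bp _) h|apply: le_trans (bp _) _; rewrite sqrrN].
  - exact: cvg_cst.
  - rewrite -(mulr0 (c + c)); apply: cvgM; first exact: cvg_cst.
    exact: cvg_harmonic.
exact: (cvg_unique _ lim1 lim2).
Unshelve. all: by end_near. Qed.

Lemma cauchyw1 (x : R) : cauchyw (const_mx x : 'cV[R]_1) = (1 + x ^+ 2)^-1.
Proof. by rewrite /cauchyw big_ord1 mxE. Qed.

Lemma ccont_comp_cV n (T : topologicalType) (F : T -> 'cV[R]_n) (g : 'cV[R]_n -> R) :
  (forall i, continuous (fun t => F t i 0)) -> continuous g -> continuous (fun t => g (F t)).
Proof. by move=> cF cg; apply: (ccomp (continuous_cV cF) cg). Qed.

Lemma integralR_cV1 (g dg : 'cV[R]_1 -> R) c :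
  (forall x, is_derive x (ebase R ord0) g (dg x)) ->
  dominated c g -> dominated c dg -> integralR dg = 0.
Proof.
move=> Hg [cg bg] ndg; have [cdg bdg] := ndg.
have E (x : R) : (col_mx (const_mx x) 0 : 'cV[R]_(1 + 0)) = const_mx x.
  by apply/colP => i; rewrite [RHS]mxE mxE; case: splitP => [j _|[]//]; rewrite mxE.
rewrite (@integralR_step _ 0 c dg ndg).
rewrite (_ : (fun x : R => _) = fun x : R => dg (const_mx x)); last first.
  apply/funext => x; rewrite (@integralR0 _ (c * cauchyw (const_mx x : 'cV[R]_1))) ?E//.
  exact: (@dominated_slicer _ 1 0).
apply: (@integral_derive_line (fun x : R => g (const_mx x)) _ c).
- move=> t; have := @is_derive_line _ _ g 0 (ebase R ord0) t (dg (const_mx t)).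
  have E2 (s : R) : 0 + s *: ebase R (ord0 : 'I_1) = const_mx s.
    by apply/colP => i; rewrite !mxE (ord1 i) eqxx add0r mulr1.
  by rewrite E2; under eq_fun do rewrite E2; apply; exact: Hg.
- by apply: (@ccont_comp_cV _ R (fun x : R => const_mx x)) => // i; under eq_fun do rewrite mxE; move=> x; exact: cvg_id.
- by move=> t; rewrite -cauchyw1.
- by move=> t; rewrite -cauchyw1.
Qed.

Lemma ebase_lshift a b (i : 'I_a) : ebase R (lshift b i) = col_mx (ebase R i) 0.
Proof.
apply/colP => j; rewrite [LHS]mxE [RHS]mxE; case: splitP => k jk.
  by rewrite mxE eqxx !andbT -!val_eqE /= jk.
rewrite mxE (_ : (j == _) = false)//; apply/eqP => jE.
by have := ltn_ord i; rewrite -[X in (X < _)%N]/(nat_of_ord (lshift b i)) -jE jk ltnNge leq_addr.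
Qed.

Lemma ebase_rshift a b (i : 'I_b) : ebase R (rshift a i) = col_mx 0 (ebase R i).
Proof.
apply/colP => j; rewrite [LHS]mxE [RHS]mxE; case: splitP => k jk.
  rewrite mxE (_ : (j == _) = false)//; apply/eqP => jE.
  by have := ltn_ord k; rewrite -jk jE /= ltnNge leq_addr.
by rewrite mxE eqxx !andbT -!val_eqE /= jk eqn_add2l.
Qed.

Lemma is_derive_slicel a b (g : 'cV[R]_(a + b) -> R) u v i d :
  is_derive (col_mx u v) (ebase R (lshift b i)) g d ->
  is_derive u (ebase R i) (fun u => g (col_mx u v)) d.
Proof.
move=> /is_deriveP H; apply/is_deriveP; move: H; congr is_derive.
by apply/funext => h; rewrite ebase_lshift scale_col_mx scaler0 add_col_mx addr0.
Qed.

Lemma is_derive_slicer a b (g : 'cV[R]_(a + b) -> R) u v i d :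
  is_derive (col_mx u v) (ebase R (rshift a i)) g d ->
  is_derive v (ebase R i) (fun v => g (col_mx u v)) d.
Proof.
move=> /is_deriveP H; apply/is_deriveP; move: H; congr is_derive.
by apply/funext => h; rewrite ebase_rshift scale_col_mx scaler0 add_col_mx addr0.
Qed.

Lemma integralR_cst0 n : integralR (fun _ : 'cV[R]_n => 0 : R) = 0.
Proof. by rewrite /integralR Rintegral_cst// mul0r. Qed.

(** By Fubini the variable of derivation may be integrated first. *)
Lemma integralR_derive0 n (i : 'I_n) (g dg : 'cV[R]_n -> R) c :
  (forall x, is_derive x (ebase R i) g (dg x)) ->
  dominated c g -> dominated c dg -> integralR dg = 0.
Proof.
elim: n i g dg c => [|n IH] i g dg c Hg ng ndg; first by case: i Hg.
rewrite (@integralR_block _ 1 n _ dg ndg).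
have [j ij|j ij] := @splitP 1 n i.
  have ei : i = lshift n j by apply/val_inj.
  rewrite (@integralR_swap _ 1 n _ dg ndg).
  rewrite (_ : (fun v => _) = fun=> 0); first exact: integralR_cst0.
  apply/funext => v; apply: (@integralR_cV1 (fun u => (g : 'cV[R]_(1 + n) -> R) (col_mx u v)) _ (c * cauchyw v)).
  - by move=> u; apply: is_derive_slicel; rewrite (ord1 j) in ei; rewrite -ei; exact: Hg.
  - exact: (@dominated_slicel _ 1 n).
  - exact: (@dominated_slicel _ 1 n).
have ei : i = rshift 1 j by apply/val_inj.
rewrite (_ : (fun u => _) = fun=> 0); first exact: integralR_cst0.
apply/funext => u; apply: (IH j (fun v => (g : 'cV[R]_(1 + n) -> R) (col_mx u v)) _ (c * cauchyw u)).
- by move=> v; apply: is_derive_slicer; rewrite -ei; exact: Hg.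
- exact: (@dominated_slicer _ 1 n).
- exact: (@dominated_slicer _ 1 n).
Qed.

Lemma integralC_isD0 n (i : 'I_n) (f df : 'cV[R]_n -> C) c :
  isD i f df -> dominatedC c f -> dominatedC c df -> integralC df = 0.
Proof.
move=> H nf ndf; rewrite /integralC.
rewrite (integralR_derive0 (fun x => (H x).1) (dominatedC_Re nf) (dominatedC_Re ndf)).
by rewrite (integralR_derive0 (fun x => (H x).2) (dominatedC_Im nf) (dominatedC_Im ndf)).
Qed.

(** Domination in v, uniform in the parameter u. *)
Definition rdom a b c (g : 'cV[R]_(a + b) -> R) :=
  continuous g /\ forall u v, `|g (col_mx u v)| <= c * cauchyw v.

Lemma rdom_dominated a b c (g : 'cV[R]_(a + b) -> R) u : rdom c g -> dominated c (fun v => g (col_mx u v)).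
Proof. by move=> [cg bg]; split=> //; apply: (ccomp (@col_mx_contr _ a b u) cg). Qed.

Lemma is_derive_partial a b c (g dg : 'cV[R]_(a + b) -> R) i :
  (forall x, is_derive x (ebase R (lshift b i)) g (dg x)) -> rdom c g -> rdom c dg ->
  forall u, is_derive u (ebase R i) (fun u => integralR (fun v => g (col_mx u v)))
    (integralR (fun v => dg (col_mx u v))).
Proof.
move=> Hg ng ndg u; apply/is_deriveP.
pose f (h : R) (t : b.-tuple (measurableTypeR R)) := g (col_mx (u + h *: ebase R i) (colt t)).
have df h t : is_derive h (1 : R) (f ^~ t) (dg (col_mx (u + h *: ebase R i) (colt t))).
  apply: (@is_derive_line _ _ (fun u => g (col_mx u (colt t)))).
  by apply: is_derive_slicel; exact: Hg.
have d1E h t : partial1of2 f h t = dg (col_mx (u + h *: ebase R i) (colt t)).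
  by rewrite partial1of2E; have [] := df h t.
have Ia : `](-1 : R), 1[%classic (0 : R) by rewrite /= in_itv /= ltrN10 ltr01.
have c0 : 0 <= c by have := dominated_ge0 (rdom_dominated 0 ng).
have iG : (@lebesgue_tuple R b).-integrable setT (EFin \o (fun t => c * cauchyw (colt t))).
  exact: integrable_dominated (dominatedZ c (dominated_cauchyw R b)).
have intf h : `](-1 : R), 1[%classic h -> (@lebesgue_tuple R b).-integrable setT (EFin \o f h).
  by move=> _; exact: integrable_dominated (rdom_dominated _ ng).
have H1 := derivable_under_integral measurableT Ia intf (fun h t _ _ => let: DeriveDef d _ := df h t in d)
   (fun t => mulr_ge0 c0 (cauchyw_ge0 _)) iG.
have H2 := differentiation_under_integral measurableT Ia intf (fun h t _ _ => let: DeriveDef d _ := df h t in d)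
   (fun t => mulr_ge0 c0 (cauchyw_ge0 _)) iG.
have GB : forall (x : R) t, `](-1 : R), 1[%classic x -> [set: b.-tuple (measurableTypeR R)] t -> `|partial1of2 f x t| <= c * cauchyw (colt t).
  by move=> x t _ _; rewrite d1E; case: ndg => _; exact.
apply: DeriveDef; first exact: H1.
rewrite -derive1E (H2 GB) /integralR.
by apply: eq_Rintegral => t _; rewrite d1E scale0r addr0.
Qed.

Definition cdom a b c (f : 'cV[R]_(a + b) -> C) :=
  ccontinuous f /\ forall u v, normc (f (col_mx u v)) <= c * cauchyw v.

Lemma cdom_Re a b c (f : 'cV[R]_(a + b) -> C) : cdom c f -> rdom c (fun x => Re (f x)).
Proof.
by move=> [[cr ci] fc]; split=> // u v; exact: le_trans (Re_le_normc _) (fc u v).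
Qed.

Lemma cdom_Im a b c (f : 'cV[R]_(a + b) -> C) : cdom c f -> rdom c (fun x => Im (f x)).
Proof.
by move=> [[cr ci] fc]; split=> // u v; exact: le_trans (Im_le_normc _) (fc u v).
Qed.

Lemma isD_partial a b c (f df : 'cV[R]_(a + b) -> C) i :
  isD (lshift b i) f df -> cdom c f -> cdom c df ->
  isD i (fun u => integralC (fun v => f (col_mx u v))) (fun u => integralC (fun v => df (col_mx u v))).
Proof.
move=> H nf ndf u; split => /=.
  exact: (is_derive_partial (fun x => (H x).1) (cdom_Re nf) (cdom_Re ndf)).
exact: (is_derive_partial (fun x => (H x).2) (cdom_Im nf) (cdom_Im ndf)).
Qed.

Lemma rdom_continuous a b c (g : 'cV[R]_(a + b) -> R) : rdom c g ->
  continuous (fun u => integralR (fun v => g (col_mx u v))).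
Proof.
move=> ng u; apply: seq_continuousP => u_ uu.
apply: (@integralR_dct _ _ c) => [k|v]; first exact: rdom_dominated.
apply: (@cvg_comp _ _ _ u_ (fun u => g (col_mx u v)) _ _ _ uu).
by apply: (ccomp (@col_mx_contl _ a b v)); case: ng.
Qed.

(** Derivatives pass under the integral as long as the domination is uniform in u;
   the weights W keep track of the dependence on u. *)
Lemma Dc_partial a b k (W : nat -> 'cV[R]_a -> R) c (f : 'cV[R]_(a + b) -> C) :
  (forall j u, (j <= k)%N -> W j u <= c) -> (forall j u, 0 <= W j u) ->
  Dc k (fun j Z => W j (usubmx Z) * cauchyw (dsubmx Z)) f ->
  Dc k (fun j u => W j u * (2 * integralR (@cauchyw R b))) (fun u => integralC (fun v => f (col_mx u v))).
Proof.
elim: k W f => [|k IH] W f Wc W0 Hf.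
all: have cf := Dc_cc Hf.
all: have df : cdom c f.
1,3: split=> // u v; apply: le_trans (Dc_bound _ Hf) _;
   by rewrite col_mxKu col_mxKd ler_wpM2r ?cauchyw_ge0 ?Wc.
all: have cI : ccontinuous (fun u => integralC (fun v => f (col_mx u v))).
1,3: by split; [exact: rdom_continuous (cdom_Re df)|exact: rdom_continuous (cdom_Im df)].
all: have bI u : normc (integralC (fun v => f (col_mx u v))) <= W 0%N u * (2 * integralR (@cauchyw R b)).
1,3: apply: integralC_le; split;
  [case: cf => cr ci; split; [exact: (ccomp (@col_mx_contr _ a b u) cr)|exact: (ccomp (@col_mx_contr _ a b u) ci)]|
   move=> v; apply: le_trans (Dc_bound _ Hf) _; by rewrite col_mxKu col_mxKd].
  by split.
apply: DcS => // i; have [d D] := Dc_isD Hf (lshift b i).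
exists (fun u => integralC (fun v => pderiv (lshift b i) f (col_mx u v))).
  apply: (isD_partial (c := c) d df); split; first exact: Dc_cc D.
  move=> u v; apply: le_trans (Dc_bound _ D) _.
  by rewrite col_mxKu col_mxKd ler_wpM2r ?cauchyw_ge0 ?Wc.
by apply: (IH (fun j => W j.+1)) => // j u jk; exact: Wc.
Qed.
End integration_by_parts.

(** * Integration by parts against an oscillating exponential *)

Lemma eqle (R : realType) (a b : R) : a = b -> a <= b.
Proof. by move=> ->. Qed.

Section oscillation.
Variables (R : realType) (n : nat).
Local Notation C := R[i].
Local Notation V := 'cV[R]_n.
Implicit Type u : V -> C.

Lemma Dc_mulc k (w1 w2 : V -> R) (f g : V -> C) :
  Dc k (fun _ => w1) f -> Dc k (fun _ => w2) g ->
  Dc k (fun _ x => 2 ^+ k * (w1 x * w2 x)) (fun x => f x * g x).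
Proof. by move=> Hf Hg; apply: DcM Hf Hg _. Qed.

Lemma symk_Dc k (s : V -> R) (m rho : R) f : (forall x, 1 <= s x) -> 0 <= rho ->
  symk k one1 s m rho f -> exists2 c : R, 0 <= c & Dc k (fun _ x => c * s x `^ m) f.
Proof.
move=> s1 r0 [c c0 H]; exists c => //; apply: Dc_le H => j x _.
by rewrite /one1 mul1r ler_wpM2l// ler_powR// gerBl mulr_ge0.
Qed.

Variable l : 'I_n -> V.
Variable lJ : 'I_n -> V.
Hypothesis lJP : forall j, lJ j = l j \/ lJ j = 0.
Variable E : V -> C.
Hypotheses (cE : ccontinuous E) (E1 : forall x, normc (E x) <= 1)
  (dE : forall j, isD j E (fun x => ('i%C * (dotv (l j) x)%:C) * E x)).

Local Notation s := (sf lJ).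
Local Notation linv := (fun x => (lamf lJ x)^-1%:C).

Definition vJ u j : V -> C := fun x => (dotv (lJ j) x)%:C * (linv x * u x).
(** The formal transpose of lam^-1 (1 - i sum_j l_j d_j), an operator that fixes E
   when d_j E = i l_j E and lam = 1 + sum_j l_j^2.  The family [lJ] contains the
   components of the gradient [l] along which one integrates by parts, the other
   ones being replaced by 0. *)
Definition ibp_op u : V -> C := fun x => linv x * u x + 'i%C * \sum_j pderiv j (vJ u j) x.

Lemma pderiv_cst (k : C) (j : 'I_n) : pderiv j (fun _ : V => k) = fun=> 0.
Proof. exact: (isD_pderiv (@isD_cst R n j k)).2. Qed.

Lemma dot0 (x : V) : dotv 0 x = 0.
Proof. by apply: big1 => i _; rewrite mxE mul0r. Qed.

(** 1/lam and l_j/lam have orders -2 and -1 with respect to the square root of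
   lam. *)
Lemma coef_bound k : exists2 c : R, 0 <= c &
  (Dc k (fun _ x => c * s x `^ (- 2)) linv) /\
  (forall j, Dc k (fun _ x => c * s x `^ (- 1)) (fun x => (dotv (lJ j) x)%:C * linv x)).
Proof.
have [c c0 H] := symk_Dc (@sf_ge1 _ _ _ lJ) ler01 (symk_lamfV lJ k).
have /choice[d Hd] j : exists d : R, 0 <= d /\ Dc k (fun _ x => d * s x `^ (- 1)) (fun x => (dotv (lJ j) x)%:C * linv x).
  have := symkM1 (@sf_ge1 _ _ _ lJ) (symk_form lJ j k) (symk_lamfV lJ k).
  rewrite (_ : 1 + - 2 = - 1); last by ring.
  by move=> /(symk_Dc (@sf_ge1 _ _ _ lJ) ler01)[d d0 Hd]; exists d.
have d0 : 0 <= \sum_j d j by apply: sumr_ge0 => j _; have [] := Hd j.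
exists (c + \sum_j d j); first exact: addr_ge0.
split.
  by apply: Dc_le H => j x _; rewrite ler_wpM2r ?powR_ge0// lerDl.
move=> j; apply: Dc_le (Hd j).2 => _ x _; rewrite ler_wpM2r ?powR_ge0//.
rewrite (bigD1 j)//= addrCA lerDl addr_ge0// sumr_ge0// => i _.
by have [] := Hd i.
Qed.

Lemma vJ_bound k : exists2 c : R, 0 <= c & forall (w : V -> R) u j,
  Dc k (fun _ => w) u -> Dc k (fun _ x => c * (w x * s x `^ (- 1))) (vJ u j).
Proof.
have [c c0 [_ H]] := coef_bound k.
exists (2 ^+ k * c); first by rewrite mulr_ge0// exprn_ge0.
move=> w u j Hu; have := Dc_mulc (H j) Hu.
rewrite (_ : vJ u j = (fun x => (dotv (lJ j) x)%:C * linv x * u x)).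
  by apply: Dc_le => _ x _; apply: eqle; ring.
by apply/funext => x; rewrite /vJ mulrA.
Qed.

Lemma ibp_op_bound k : exists2 c : R, 0 <= c & forall (w : V -> R) u,
  Dc k.+1 (fun _ => w) u -> Dc k (fun _ x => c * (w x * s x `^ (- 1))) (ibp_op u).
Proof.
have [c c0 [H1 _]] := coef_bound k.
have [d d0 H2] := vJ_bound k.+1.
exists (2 ^+ k * c + \sum_(j : 'I_n) d).
  by rewrite addr_ge0 ?sumr_ge0// mulr_ge0// exprn_ge0.
move=> w u Hu; rewrite /ibp_op.
have w0 x : 0 <= w x by exact: Dc_ge0 Hu.
have h1 := Dc_mulc H1 (Dc_leq (leqnSn k) Hu).
have h2 : Dc k (fun _ x => \sum_(j : 'I_n) d * (w x * s x `^ (- 1))) (fun x => 'i%C * \sum_j pderiv j (vJ u j) x).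
  apply: Dc_le (DcZ 'i%C (Dc_sum (W := fun _ _ x => d * (w x * s x `^ (- 1))) (index_enum 'I_n) (fun j => (Dc_isD (H2 w u j Hu) j).2))) => j x _.
  by rewrite /= expr0n expr1n add0r sqrtr1 mul1r.
apply: Dc_le (DcD h1 h2) => j x _; rewrite mulrDl mulr_suml lerD2r.
rewrite -[leRHS]mulrA ler_wpM2l ?exprn_ge0// -[leLHS]mulrA ler_wpM2l// [leLHS]mulrC ler_wpM2l//.
by rewrite ler_powR ?sf_ge1// lerN2 ler1n.
Qed.

(** Every integration by parts costs one derivative of u and gains one power of
   the size of the gradient. *)
Lemma iterP_bound k m : exists2 c : R, 0 <= c & forall (w : V -> R) u,
  Dc (m + k) (fun _ => w) u -> Dc k (fun _ x => c * (w x * s x `^ (- m%:R))) (iter m ibp_op u).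
Proof.
elim: m k => [|m IH] k.
  by exists 1 => // w u Hu; apply: Dc_le Hu => j x _; rewrite oppr0 powRr0 mulr1 mul1r.
have [c c0 Hc] := IH k.+1; have [d d0 Hd] := ibp_op_bound k.
exists (d * c); first exact: mulr_ge0.
move=> w u; rewrite addSnnS => /Hc /Hd; rewrite -iterS; apply: Dc_le => j x _.
have -> : - m.+1%:R = - m%:R + - 1 :> R by rewrite -natr1 opprD.
by rewrite powR_add ?sf_gt0//; apply: eqle; ring.
Qed.

Section functional.
Variable Ig : (V -> C) -> C.
Hypotheses (Ig_D : forall c c' f g, dominatedC c f -> dominatedC c' g -> Ig (fun x => f x + g x) = Ig f + Ig g)
  (Ig_Z : forall c k f, dominatedC c f -> Ig (fun x => k * f x) = k * Ig f)
  (Ig_d : forall j c f df, lJ j != 0 -> isD j f df -> dominatedC c f -> dominatedC c df -> Ig df = 0).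

Lemma dominatedC_le c c' (f : V -> C) : c <= c' -> dominatedC c f -> dominatedC c' f.
Proof. by move=> cc [cf bf]; split=> // x; apply: le_trans (bf x) _; rewrite ler_wpM2r ?cauchyw_ge0. Qed.

Lemma dominatedC_sum c (F : 'I_n -> V -> C) : (forall j, dominatedC c (F j)) -> forall r,
  dominatedC (c *+ size r) (fun x => \sum_(j <- r) F j x).
Proof.
move=> H r; elim: r => [|j r [c2 b2]].
  rewrite (_ : (fun _ => _) = fun=> 0); last by apply/funext => x; rewrite big_nil.
  by split=> [|x]; [exact: cc_cst|rewrite normc0 mulr0n mul0r].
have [c1 b1] := H j.
rewrite (_ : (fun _ => _) = fun x => F j x + \sum_(j <- r) F j x); last by apply/funext => x; rewrite big_cons.
split=> [|x]; first exact: ccD.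
by rewrite (le_trans (normcD _ _))// mulrS mulrDl lerD.
Qed.

Lemma Ig_sum0 c (F : 'I_n -> V -> C) : (forall j, dominatedC c (F j)) -> (forall j, Ig (F j) = 0) ->
  forall r, Ig (fun x => \sum_(j <- r) F j x) = 0.
Proof.
move=> H H0; elim=> [|j r IH].
  have n0 : dominatedC 0 (fun _ : V => 0 : C) by split=> [|x]; [exact: cc_cst|rewrite normc0 mul0r].
  rewrite (_ : (fun x => _) = fun x => 0 * 0); first by rewrite (Ig_Z _ n0) mul0r.
  by apply/funext => x; rewrite big_nil mulr0.
rewrite (_ : (fun x => _) = fun x => F j x + \sum_(j <- r) F j x); last by apply/funext => x; rewrite big_cons.
by rewrite (Ig_D (H j) (dominatedC_sum H r)) IH H0 addr0.
Qed.

(** E (ibp_op u) differs from E u by i times the divergence of the vector field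
   (E l_j u / lam)_j. *)
Lemma ibp c u : 0 <= c -> Dc 1 (fun _ x => c * cauchyw x) u ->
  Ig (fun x => E x * u x) = Ig (fun x => E x * ibp_op u x).
Proof.
move=> c0 Hu; have [d d0 Hd] := vJ_bound 1.
have cu := Dc_cc Hu.
have Dv j := Hd _ _ j Hu.
have cv j : ccontinuous (vJ u j) := Dc_cc (Dv j).
have s1 x : s x `^ (- 1) <= 1 by rewrite powRN powRr1 ?invf_le1 ?sf_ge1 ?sf_gt0// ltW// sf_gt0.
have bv j x : normc (vJ u j x) <= d * (c * cauchyw x * s x `^ (- 1)) := Dc_bound x (Dv j).
have bv1 j x : normc (vJ u j x) <= d * c * cauchyw x.
  by apply: le_trans (bv j x) _; rewrite -[leRHS]mulrA ler_wpM2l// ler_piMr// mulr_ge0 ?cauchyw_ge0.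
pose dEv j x := ('i%C * (dotv (l j) x)%:C * E x) * vJ u j x + E x * pderiv j (vJ u j) x.
have dEvP j : isD j (fun x => E x * vJ u j x) (dEv j).
  by apply: isDM; [exact: dE|exact: (Dc_isD (Dv j) j).1].
have nEv j : dominatedC (d * c) (fun x => E x * vJ u j x).
  split=> [|x]; first exact: ccM.
  by rewrite normcM (le_trans _ (bv1 j x))// ler_piMl ?normc_ge0.
have nI : normc ('i%C : C) = 1 by rewrite /= expr0n expr1n add0r sqrtr1.
have ndEv0 j : lJ j = 0 -> dEv j = fun=> 0.
  move=> j0; apply/funext => x; rewrite /dEv /vJ j0.
  have z : (fun x : V => (dotv 0 x)%:C * (linv x * u x)) = fun=> 0.
    by apply/funext => y; rewrite dot0 mul0r.
  rewrite z dot0 mul0r !mulr0 add0r.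
  by rewrite pderiv_cst mulr0.
have ndEv j : dominatedC (d * c + d * c) (dEv j).
  have [jE|/ndEv0 ->] := lJP j; last first.
    by split=> [|x]; [exact: cc_cst|rewrite normc0 mulr_ge0 ?cauchyw_ge0// addr_ge0// mulr_ge0].
  have Dp := (Dc_isD (Dv j) j).2.
  split=> [|x].
    apply: ccD; apply: ccM => //; last exact: Dc_cc Dp.
    apply: ccM => //; apply: ccM; first exact: cc_cst.
    by apply: cc_real; exact: continuous_form.
  rewrite (le_trans (normcD _ _))// mulrDl; apply: lerD.
    rewrite (normcM ('i%C * (dotv (l j) x)%:C * E x)) (normcM ('i%C * _)) (normcM 'i%C).
    rewrite nI mul1r normcR; apply: (@le_trans _ _ (s x * (d * (c * cauchyw x * s x `^ (- 1))))).
      rewrite ler_pM ?normc_ge0 ?mulr_ge0 ?normr_ge0 ?normc_ge0//.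
      rewrite -jE -[leRHS]mulr1 ler_pM ?normr_ge0 ?normc_ge0//.
      exact: form_le_sf.
    rewrite powRN powRr1 ?(ltW (sf_gt0 _ _))//.
    by rewrite le_eqVlt; apply/orP; left; apply/eqP; field; rewrite gt_eqF// sf_gt0.
  rewrite (normcM (E x)); apply: (@le_trans _ _ (1 * (d * (c * cauchyw x * s x `^ (- 1))))).
    by rewrite ler_pM ?normc_ge0 ?(Dc_bound x Dp).
  by rewrite mul1r -[leRHS]mulrA ler_wpM2l// ler_piMr// mulr_ge0 ?cauchyw_ge0.
have Ij j : Ig (dEv j) = 0.
  have [lj|lj] := eqVneq (lJ j) 0; last first.
    apply: (Ig_d lj (dEvP j) _ (ndEv j)); apply: dominatedC_le (nEv j).
    by rewrite lerDl mulr_ge0.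
  rewrite (ndEv0 j lj); have n0 : dominatedC 0 (fun _ : V => 0 : C) by split=> [|x]; [exact: cc_cst|rewrite normc0 mul0r].
  rewrite (_ : (fun x => _) = fun x => 0 * 0); first by rewrite (Ig_Z _ n0) mul0r.
  by apply/funext => x; rewrite mulr0.
have nEu : dominatedC c (fun x => E x * u x).
  split=> [|x]; first exact: ccM.
  by rewrite normcM (le_trans _ (Dc_bound x Hu))// ler_piMl ?normc_ge0.
have nS := dominatedC_sum ndEv (index_enum 'I_n).
have nS2 : dominatedC ((d * c + d * c) *+ size (index_enum 'I_n)) (fun x => 'i%C * \sum_(j : 'I_n) dEv j x).
  case: nS => cS bS; split=> [|x]; first by apply: ccM => //; exact: cc_cst.
  by rewrite normcM nI mul1r.
rewrite (_ : (fun x => E x * ibp_op u x) = (fun x => E x * u x + 'i%C * \sum_j dEv j x)).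
  by rewrite (Ig_D nEu nS2) (Ig_Z _ nS) (Ig_sum0 ndEv Ij) mulr0 addr0.
apply/funext => x; rewrite /ibp_op /dEv big_split /= -mulr_sumr mulrDr.
rewrite [in RHS]mulrDr addrA mulrCA [E x * ('i%C * _)]mulrCA; congr (_ + _).
pose S : R := \sum_j dotv (lJ j) x ^+ 2.
have ii : ('i%C : C) * 'i%C = -1 by rewrite -expr2 sqr_i.
have hl : linv x * (1 + S%:C) = 1.
  have -> : 1 + S%:C = (lamf lJ x)%:C by rewrite /lamf rmorphD rmorph1.
  by rewrite -rmorphM mulVf ?rmorph1// gt_eqF// (lamf_gt0 lJ x).
have -> : \sum_(j < n) 'i%C * (dotv (l j) x)%:C * E x * vJ u j x =
   'i%C * (S%:C * (linv x * u x) * E x).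
  rewrite [X in X%:C](_ : _ = \sum_j dotv (lJ j) x * dotv (l j) x); last first.
    apply: eq_bigr => j _; rewrite expr2; have [->//|->] := lJP j.
    by rewrite dot0 !mul0r.
  rewrite rmorph_sum /= 2!mulr_suml mulr_sumr; apply: eq_bigr => j _.
  by rewrite /vJ rmorphM /=; ring.
move: (linv x) (u x) (E x) (S%:C) hl => L U EE SS hl.
transitivity (EE * ((L * (1 + SS)) * U) + ('i%C * 'i%C) * (SS * (L * U) * EE)).
  by rewrite ii; ring.
by rewrite hl mul1r; ring.
Qed.

Lemma ibp_iter m c u : 0 <= c -> Dc m (fun _ x => c * cauchyw x) u ->
  Ig (fun x => E x * u x) = Ig (fun x => E x * iter m ibp_op u x).
Proof.
elim: m c u => [//|m IH] c u c0 Hu.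
rewrite (ibp c0 (Dc_leq (isT : (0 < m.+1)%N) Hu)).
have [d d0 Hd] := ibp_op_bound m.
have Hp : Dc m (fun _ x => d * c * cauchyw x) (ibp_op u).
  apply: Dc_le (Hd _ _ Hu) => j x _; rewrite -[leRHS]mulrA ler_wpM2l// ler_piMr//.
    by rewrite mulr_ge0 ?cauchyw_ge0.
  by rewrite powRN powRr1 ?invf_le1 ?sf_ge1 ?sf_gt0// ltW// sf_gt0.
by rewrite (IH _ _ (mulr_ge0 d0 c0) Hp) iterSr.
Qed.
End functional.

Lemma pderiv_near (f g : V -> C) j (x : V) : (\near x, f x = g x) -> pderiv j f x = pderiv j g x.
Proof.
move=> fg; rewrite /pderiv; congr (_ +i* _); apply: near_eq_derive;
  by apply: filterS fg => y ->.
Qed.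

Lemma ibp_op_local u u' (x : V) : (\near x, u x = u' x) -> \near x, ibp_op u x = ibp_op u' x.
Proof.
move=> /near_join uu; apply: filterS uu => y uu.
rewrite /ibp_op (nbhs_singleton uu); congr (_ + _ * _); apply: eq_bigr => j _.
by apply: pderiv_near; apply: filterS uu => z; rewrite /vJ => ->.
Qed.

(** [ibp_op] is a differential operator; this is what makes cutoffs disappear in
   the limit, since they are equal to 1 near any given point. *)
Lemma iterP_local m u u' (x : V) : (\near x, u x = u' x) -> iter m ibp_op u x = iter m ibp_op u' x.
Proof.
move=> H; suff : \near x, iter m ibp_op u x = iter m ibp_op u' x by exact: nbhs_singleton.
by elim: m => //= m IH; exact: ibp_op_local.
Qed.

(** Functions of the remaining variables commute with the integration by parts. *)
Lemma ibp_op_mulr w u (F : V -> C) : (forall j, lJ j != 0 -> isD j F (fun=> 0)) ->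
  Dc 1 (fun _ => w) u -> ibp_op (fun x => u x * F x) = (fun x => ibp_op u x * F x).
Proof.
move=> HF Hu; have [d d0 Hd] := vJ_bound 1; have Dv j := Hd _ _ j Hu.
apply/funext => x; rewrite /ibp_op mulrDl -!mulrA; congr (_ + _ * _).
rewrite mulr_suml; apply: eq_bigr => j _.
have E0 : vJ (fun x => u x * F x) j = (fun x => vJ u j x * F x).
  by apply/funext => y; rewrite /vJ !mulrA.
rewrite E0; have [lj|lj] := eqVneq (lJ j) 0.
  have z : vJ u j = fun=> 0 by apply/funext => y; rewrite /vJ lj dot0 mul0r.
  rewrite z pderiv_cst mul0r (_ : (fun x : V => 0 * F x) = fun=> 0) ?pderiv_cst//.
  by apply/funext => y; rewrite mul0r.
have [_ ->] := isD_pderiv (isDM (Dc_isD (Dv j) j).1 (HF j lj)).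
by rewrite mulr0 addr0.
Qed.

Lemma iterP_mulr m w u (F : V -> C) : (forall j, lJ j != 0 -> isD j F (fun=> 0)) ->
  Dc m (fun _ => w) u -> iter m ibp_op (fun x => u x * F x) = (fun x => iter m ibp_op u x * F x).
Proof.
move=> HF; elim: m w u => // m IH w u Hu.
have [d d0 Hd] := ibp_op_bound m.
rewrite !iterSr (ibp_op_mulr HF (Dc_leq (isT : (0 < m.+1)%N) Hu)).
exact: IH (Hd _ _ Hu).
Qed.
End oscillation.

(** * Operations on Schwartz functions *)

Section schwartz_tools.
Variable R : realType.
Local Notation C := R[i].

Lemma schwDc n (f : 'cV[R]_n -> C) : schw f <->
  forall k K : nat, exists2 c : R, 0 <= c & Dc k (fun _ x => c * japanese x `^ (- K%:R)) f.
Proof.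
split=> H k K.
  exact: symk_Dc (@japanese_ge1 R n) (lexx 0) (H k K).
have [c c0 Hc] := H k K; exists c => //; apply: Dc_le Hc => j x _.
by rewrite /one1 mul1r mul0r subr0.
Qed.

Lemma Dc_monoc n m k (w : 'cV[R]_m -> R) (G : 'cV[R]_n -> 'cV[R]_m) (e : R) f : monomial_map e G ->
  0 <= e <= 1 -> Dc k (fun _ => w) f -> Dc k (fun _ Z => w (G Z)) (fun Z => f (G Z)).
Proof.
move=> mG e01 Hf; apply: (Dc_mono mG e01 (W := fun _ => w)) => // j x.
exact: Dc_ge0 Hf.
Qed.

Lemma mono_usubmx a b : @monomial_map R _ _ 1 (@usubmx R a b 1).
Proof.
apply: (@monomial_mapP _ _ _ _ _ (fun i => Some (lshift b i)) (fun=> 0)) => [Z i|i i' j [<-] []].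
  by rewrite mxE mul1r.
by move=> ii; apply/val_inj.
Qed.

Lemma mono_dsubmx a b : @monomial_map R _ _ 1 (@dsubmx R a b 1).
Proof.
apply: (@monomial_mapP _ _ _ _ _ (fun i => Some (rshift a i)) (fun=> 0)) => [Z i|i i' j [<-] []].
  by rewrite mxE mul1r.
by move=> /addnI ii; apply/val_inj.
Qed.

Lemma mono_scale n (e : R) : @monomial_map R n n e (fun x => e *: x).
Proof.
apply: (@monomial_mapP _ _ _ _ _ (fun i => Some i) (fun=> 0)) => [Z i|i i' j [<-] []//].
by rewrite mxE.
Qed.

Lemma le01 : 0 <= (1 : R) <= 1. Proof. by rewrite ler01 lexx. Qed.

Lemma japanese_split a b (Z : 'cV[R]_(a + b)) :
  japanese Z <= japanese (usubmx Z) * japanese (dsubmx Z).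
Proof. by rewrite -{1}(vsubmxK Z) japanese_col_mxM. Qed.

Lemma japanese_usub a b (Z : 'cV[R]_(a + b)) : japanese (usubmx Z) <= japanese Z.
Proof. by rewrite -{2}(vsubmxK Z) japanese_col_mxl. Qed.

Lemma japanese_dsub a b (Z : 'cV[R]_(a + b)) : japanese (dsubmx Z) <= japanese Z.
Proof. by rewrite -{2}(vsubmxK Z) japanese_col_mxr. Qed.

Lemma powR_antimono (x y r : R) : 0 < x -> x <= y -> 0 <= r -> y `^ (- r) <= x `^ (- r).
Proof.
move=> x0 xy r0; have y0 := lt_le_trans x0 xy.
rewrite !powRN lef_pV2 ?posrE ?powR_gt0//.
by apply: ge0_ler_powR => //; rewrite nnegrE ltW.
Qed.

Lemma schw_tensor a b (f : 'cV[R]_a -> C) (g : 'cV[R]_b -> C) : schw f -> schw g ->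
  schw (fun Z : 'cV[R]_(a + b) => f (usubmx Z) * g (dsubmx Z)).
Proof.
move=> /schwDc Hf /schwDc Hg; apply/schwDc => k K.
have [c c0 Hc] := Hf k K; have [d d0 Hd] := Hg k K.
exists (2 ^+ k * (c * d)); first by rewrite mulr_ge0 ?exprn_ge0// mulr_ge0.
have h1 := Dc_monoc (mono_usubmx a b) le01 Hc.
have h2 := Dc_monoc (mono_dsubmx a b) le01 Hd.
apply: Dc_le (Dc_mulc h1 h2) => j Z _.
rewrite -[leRHS]mulrA ler_wpM2l ?exprn_ge0// mulrACA ler_wpM2l ?mulr_ge0//.
rewrite -powRM ?(ltW (japanese_gt0 _))//.
by apply: powR_antimono => //; [exact: japanese_gt0|exact: japanese_split].
Qed.

Lemma schwM_temp n (f g : 'cV[R]_n -> C) : schw f ->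
  (forall k, exists m : nat, exists2 c : R, 0 <= c & Dc k (fun _ x => c * japanese x `^ m%:R) g) ->
  schw (fun x => f x * g x).
Proof.
move=> /schwDc Hf Hg; apply/schwDc => k K.
have [m [d d0 Hd]] := Hg k; have [c c0 Hc] := Hf k (K + m)%N.
exists (2 ^+ k * (c * d)); first by rewrite mulr_ge0 ?exprn_ge0// mulr_ge0.
apply: Dc_le (Dc_mulc Hc Hd) => j Z _.
rewrite -[leRHS]mulrA ler_wpM2l ?exprn_ge0// mulrACA ler_wpM2l ?mulr_ge0//.
by rewrite -powR_add ?japanese_gt0// ler_powR ?japanese_ge1// natrD opprD addrNK.
Qed.

Lemma schw_conj n (f : 'cV[R]_n -> C) : schw f -> schw (fun x => conjc (f x)).
Proof. by move=> H k K; exact: symk_conj. Qed.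

Lemma schw_bounded n (f : 'cV[R]_n -> C) k : schw f -> exists2 c : R, 0 <= c & Dc k (fun _ _ => c) f.
Proof.
move=> /schwDc/(_ k 0%N)[c c0 H]; exists c => //; apply: Dc_le H => j x _.
by rewrite oppr0 powRr0 mulr1.
Qed.

Lemma schw_cauchyw n (f : 'cV[R]_n -> C) k : schw f -> exists2 c : R, 0 <= c & Dc k (fun _ x => c * cauchyw x) f.
Proof.
move=> /schwDc/(_ k (2 * n)%N)[c c0 H]; exists c => //; apply: Dc_le H => j x _.
by rewrite ler_wpM2l// natrM japanese_cauchyw.
Qed.

(** The bump function decreases from 1 to 0 between 1 and 2. *)
Lemma integral_bump_line : \int[@lebesgue_measure R]_(t in setT) (- dbump 1 t) = 1.
Proof.
have z (t : R) : ~ `[(0 : R), 3]%classic t -> dbump 1 t = 0.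
  move=> nt; have [t1|t1] := ltP t 1; first exact: dbump_lt1.
  apply: dbump_gt2; rewrite ltNge; apply/negP => t2; apply: nt.
  by rewrite /= in_itv /= (le_trans _ t1)//= (le_trans t2)// ler_nat.
rewrite (_ : (fun t => _) = (fun t => - dbump 1 t) \_ `[(0 : R), 3]); last first.
  apply/funext => t; rewrite patchE; case: ifPn => // /negP; rewrite inE => /z ->.
  by rewrite oppr0.
rewrite -Rintegral_mkcond /Rintegral (@continuous_FTC2 _ _ (fun t => - bump t))//.
- by rewrite bump0 ?bump1 //= ?ler01 ?ler_nat// oppr0 sub0r opprK.
- apply: continuous_subspaceT; apply: copp; exact: (Ck_line_cont (Ck_line_dbump R 0 1)).
- have cb : continuous (fun t : R => - bump t) by apply: copp; exact: (Ck_line_cont (Ck_line_dbump R 0 0)).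
  split.
  + by move=> t _; have [] := is_deriveN (is_derive_dbump 0 t).
  + exact/cvg_at_right_filter/cb.
  + exact/cvg_at_left_filter/cb.
- by move=> t _; rewrite derive1E; have [_ ->] := is_deriveN (is_derive_dbump 0 t).
Qed.

Lemma schw_dbump1 : schw (fun x : 'cV[R]_1 => (- dbump 1 (x 0 0))%:C).
Proof.
suff H (i : nat) : schw (fun x : 'cV[R]_1 => (dbump i.+1 (x 0 0))%:C).
  move=> k K; rewrite (_ : (fun x => _) = (fun x : 'cV[R]_1 => - 1 * (dbump 1 (x 0 0))%:C)).
    by apply: symkZ => //; exact: (H 0%N).
  by apply/funext => x; rewrite mulN1r rmorphN.
move=> k K; elim: k i => [|k IH] i.
all: have cc : ccontinuous (fun x : 'cV[R]_1 => (dbump i.+1 (x 0 0))%:C).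
1,3: by apply: cc_real; exact: (ccomp (@coord_cont _ 1 0) (Ck_line_cont (Ck_line_dbump R 0 i.+1))).
all: have bd : exists2 c : R, 0 <= c & forall x : 'cV[R]_1,
  normc ((dbump i.+1 (x 0 0))%:C) <= c * (one1 x * japanese x `^ (- K%:R)).
1,3: have [c c0 Hc] := dbump_bounded R i.+1;
  exists (c * 3 ^+ K) => [|x]; first (by rewrite mulr_ge0// exprn_ge0);
  rewrite normcR /one1 mul1r powRN powR_mulrn ?(ltW (japanese_gt0 _))//;
  rewrite ler_pdivlMr ?exprn_gt0 ?japanese_gt0//;
  have [x1|x1] := ltP (x 0 0) 1; [by rewrite dbump_lt1// normr0 mul0r mulr_ge0// exprn_ge0|];
  have [x2|x2] := ltP 2 (x 0 0); [by rewrite dbump_gt2// normr0 mul0r mulr_ge0// exprn_ge0|];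
  rewrite ler_pM// ?exprn_ge0 ?(ltW (japanese_gt0 _))//;
  rewrite lerXn2r ?nnegrE ?(ltW (japanese_gt0 _))//;
  rewrite -(ler_pXn2r (n := 2)) ?nnegrE ?(ltW (japanese_gt0 _))// japanese2 /dotv big_ord1; nra.
  exact: symk0.
apply: symk_S => // j; exists (fun x : 'cV[R]_1 => (dbump i.+2 (x 0 0))%:C * (0 == j)%:R%:C).
  apply: isD_real_comp => [t|x]; first exact: is_derive_dbump.
  exact: is_derive_coord.
rewrite subr0 (ord1 j) eqxx (_ : (fun x => _) = (fun x : 'cV[R]_1 => (dbump i.+2 (x 0 0))%:C)); first exact: IH.
by apply/funext => x; rewrite mulr1.
Qed.

Lemma schw_dominatedC n (f : 'cV[R]_n -> C) : schw f -> exists2 c : R, 0 <= c & dominatedC c f.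
Proof.
move=> /(schw_cauchyw 0)[c c0 H]; exists c => //; split; first exact: Dc_cc H.
by move=> x; exact: Dc_bound H.
Qed.

(** Tensor powers of minus the derivative of the bump function. *)
Lemma schw_unit n : exists2 psi : 'cV[R]_n -> C, schw psi & integralC psi = 1.
Proof.
elim: n => [|n [psi spsi ipsi]].
  exists (fun=> 1).
    apply/schwDc => k K; exists 1 => //; apply: Dc_cst => [x|j x _].
      rewrite normc1 mul1r (_ : japanese x = 1) ?powR1//.
      by rewrite /japanese /enorm /dotv big_ord0 sqrtr0 expr0n addr0 sqrtr1.
    by rewrite mulr_ge0// powR_ge0.
  have n1 : dominated 1 (fun _ : 'cV[R]_0 => 1 : R).
    by split=> [|x]; [exact: ccst|rewrite normr1 mul1r /cauchyw big_ord0].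
  have n0 : dominated 1 (fun _ : 'cV[R]_0 => 0 : R).
    by split=> [|x]; [exact: ccst|rewrite normr0 mul1r /cauchyw big_ord0].
  by rewrite /integralC (integralR0 n1) (integralR0 n0).
pose p1 (x : 'cV[R]_1) : C := (- dbump 1 (x 0 0))%:C.
exists (fun Z : 'cV[R]_(1 + n) => p1 (usubmx Z) * psi (dsubmx Z)).
  exact: (@schw_tensor 1 n _ _ schw_dbump1 spsi).
have sT := schw_tensor schw_dbump1 spsi.
have [c c0 nT] := schw_dominatedC sT; have [d d0 nP] := schw_dominatedC spsi.
have [e e0 n1] := schw_dominatedC schw_dbump1.
rewrite (@integralC_block _ 1 n _ _ nT).
rewrite (_ : (fun u => _) = p1); last first.
  apply/funext => u; rewrite (_ : (fun v => _) = (fun v => p1 u * psi v)).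
    by rewrite (integralCZ _ nP) ipsi mulr1.
  by apply/funext => v; rewrite col_mxKu col_mxKd.
have nR := dominatedC_Re n1; have nI := dominatedC_Im n1.
rewrite /integralC (_ : integralR (fun x => Im (p1 x)) = 0); last exact: integralR_cst0.
rewrite (_ : integralR (fun x => Re (p1 x)) = 1)//.
rewrite (@integralR_step _ 0 _ _ nR) -integral_bump_line; congr Rintegral.
apply/funext => x; rewrite (@integralR0 _ (e * cauchyw (const_mx x : 'cV[R]_1))); last exact: (@dominated_slicer _ 1 0 _ _ _ nR).
rewrite -[LHS]/(- dbump 1 ((col_mx (const_mx x) 0 : 'cV[R]_(1 + 0)) 0 0)); congr (- dbump _ _).
by rewrite (_ : 0 = lshift 0 0 :> 'I_(1 + 0)) ?col_mxEu ?mxE//; apply/val_inj.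
Qed.
End schwartz_tools.

(** * Removal of cutoffs *)

Section regularized_limits.
Variables (R : realType) (n : nat).
Local Notation C := R[i].
Local Notation V := 'cV[R]_n.

Lemma ccvg_near (u : nat -> C) (l : C) : (\forall k \near \oo, u k = l) -> ccvg u l.
Proof.
move=> H; apply: cvg_near_cst; apply: filterS H => k ->.
by rewrite subrr normc0.
Qed.

(** What is used of the cutoffs kappa(eps theta) as eps tends to 0.  Products of
   cutoffs in different groups of variables belong to this class. *)
Definition reg (k0 : nat) (r : nat -> V -> C) :=
  (exists2 c : R, 0 <= c & forall k, Dc k0 (fun _ _ => c) (r k)) /\
  forall Z : V, \forall k \near \oo, \forall Z' \near Z, r k Z' = 1.

Lemma regM k0 r r' : reg k0 r -> reg k0 r' -> reg k0 (fun k Z => r k Z * r' k Z).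
Proof.
move=> [[c c0 Hc] Hr] [[d d0 Hd] Hr']; split.
  exists (2 ^+ k0 * (c * d)) => [|k]; first by rewrite mulr_ge0 ?exprn_ge0// mulr_ge0.
  by apply: Dc_le (Dc_mulc (Hc k) (Hd k)).
move=> Z; apply: filterS2 (Hr Z) (Hr' Z) => k h h'.
by apply: filterS2 h h' => Z' -> ->; rewrite mulr1.
Qed.

Variables (l lJ : 'I_n -> V).
Hypothesis lJP : forall j, lJ j = l j \/ lJ j = 0.
Variable E : V -> C.
Hypotheses (cE : ccontinuous E) (E1 : forall x, normc (E x) <= 1)
  (dE : forall j, isD j E (fun x => ('i%C * (dotv (l j) x)%:C) * E x)).
Variables (m0 : nat) (w : V -> R).
Hypothesis dom : exists2 C1 : R, 0 <= C1 & forall c u, 0 <= c ->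
  Dc m0 (fun _ x => c * w x) u -> dominatedC (C1 * c) (fun x => E x * iter m0 (ibp_op lJ) u x).

Lemma reg_cont c u r : 0 <= c -> Dc m0 (fun _ x => c * w x) u -> reg m0 r ->
  ccvg (fun k => integralC (fun x => E x * iter m0 (ibp_op lJ) (fun y => r k y * u y) x))
    (integralC (fun x => E x * iter m0 (ibp_op lJ) u x)).
Proof.
move=> c0 Hu [[d d0 Hd] Hr]; have [C1 C10 HC] := dom.
apply: (@integralC_dct _ _ (C1 * (2 ^+ m0 * d * c))) => [k|x].
  apply: HC; first by rewrite mulr_ge0// mulr_ge0// exprn_ge0.
  by apply: Dc_le (Dc_mulc (Hd k) Hu) => j x _; apply: eqle; ring.
apply: ccvg_near; apply: filterS (Hr x) => k Hk; congr (_ * _).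
by apply: iterP_local; apply: filterS Hk => y ->; rewrite mul1r.
Qed.

(** For each k the integrand decays, which justifies the integrations by parts;
   the resulting integrand is dominated independently of k. *)
Lemma reg_lim c u r : 0 <= c -> Dc m0 (fun _ x => c * w x) u -> reg m0 r ->
  (forall k, exists2 d : R, 0 <= d & Dc m0 (fun _ x => d * cauchyw x) (fun x => r k x * u x)) ->
  ccvg (fun k => integralC (fun x => E x * (r k x * u x)))
    (integralC (fun x => E x * iter m0 (ibp_op lJ) u x)).
Proof.
move=> c0 Hu Hr Hn; apply: ccvg_eq (reg_cont c0 Hu Hr) => k.
have [d d0 Hd] := Hn k.
rewrite -(@ibp_iter _ _ l lJ lJP E cE E1 dE (@integralC R n) _ _ _ m0 d)//.
- exact: (@integralCD R n).
- exact: (@integralCZ R n).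
- by move=> j e f df _; exact: integralC_isD0.
Qed.

Lemma dominated_lim c u r : 0 <= c -> Dc m0 (fun _ x => c * cauchyw x) u -> reg m0 r ->
  ccvg (fun k => integralC (fun x => E x * (r k x * u x)))
    (integralC (fun x => E x * u x)).
Proof.
move=> c0 Hu [[d d0 Hd] Hr].
apply: (@integralC_dct _ _ (d * c)) => [k|x].
  split=> [|x].
    by apply: ccM => //; apply: ccM; [exact: Dc_cc (Hd k)|exact: Dc_cc Hu].
  rewrite normcM (@le_trans _ _ (1 * normc (r k x * u x)))//.
    by rewrite ler_wpM2r ?normc_ge0.
  rewrite mul1r normcM -mulrA ler_pM ?normc_ge0//.
    exact: Dc_bound (Hd k).
  exact: Dc_bound Hu.
apply: ccvg_near; apply: filterS (Hr x) => k Hk; congr (_ * _).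
by rewrite (nbhs_singleton Hk) mul1r.
Qed.
End regularized_limits.

Lemma near_scale (R : realType) n (K : 'cV[R]_n -> R[i]) (T : topologicalType) (G : T -> 'cV[R]_n) (Z : T)
    (e : nat -> R) : (forall k, 0 < e k) -> e k @[k --> \oo] --> (0 : R) ->
  continuous G -> (\forall x \near (0 : 'cV[R]_n), K x = 1) ->
  \forall k \near \oo, \forall Z' \near Z, K (e k *: G Z') = 1.
Proof.
move=> e0 e_to0 cG /nbhs_ballP[d /= d0 Hd].
have c1 : \forall Z' \near Z, `|G Z'| < `|G Z| + 1.
  have /cvgrPdist_lt/(_ _ ltr01) := cG Z; apply: filterS => Z' /= h.
  by rewrite -ltrBlDl (le_lt_trans (lerB_dist _ _))// distrC.
have g0 : 0 < `|G Z| + 1 by rewrite ltr_wpDl.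
have /cvgrPdist_lt/(_ _ (divr_gt0 d0 g0)) := e_to0; apply: filterS => k /=.
rewrite sub0r normrN gtr0_norm// ltr_pdivlMr// => hk.
apply: filterS c1 => Z' hZ; apply: Hd; rewrite -ball_normE /ball_ /= sub0r normrN normrZ gtr0_norm//.
by apply: le_lt_trans hk; rewrite ler_pM2l// ltW.
Qed.

Section dilated_cutoffs.
Variables (R : realType) (m : nat) (K : 'cV[R]_m -> R[i]).
Hypotheses (sK : schw K) (K1 : forall x, enorm x <= 1 -> K x = 1).

Lemma cutoff_near1 : \forall x \near (0 : 'cV[R]_m), K x = 1.
Proof.
have : continuous (fun x : 'cV[R]_m => dotv x x) by exact: continuous_sqnorm.
move=> /(_ 0)/cvgrPdist_lt/(_ _ ltr01); apply: filterS => x /=.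
rewrite [X in `|X - _|](_ : _ = 0); last by rewrite /dotv big1// => i _; rewrite mxE mul0r.
rewrite sub0r normrN ger0_norm ?dotv_ge0// => x1; apply: K1.
by rewrite /enorm -[leRHS]sqrtr1 ler_sqrt ?ltW// ler01.
Qed.

(** As e k <= 1, derivatives do not increase under dilation. *)
Lemma reg_dilated n (G : 'cV[R]_n -> 'cV[R]_m) (e : nat -> R) k0 : monomial_map 1 G ->
  (forall k, 0 < e k <= 1) -> e k @[k --> \oo] --> (0 : R) ->
  reg k0 (fun k Z => K (e k *: G Z)).
Proof.
move=> mG e01 e_to0; split.
  have [c c0 Hc] := schw_bounded k0 sK; exists c => // k.
  have /andP[ek0 ek1] := e01 k.
  have h := Dc_monoc mG (le01 R) (Dc_monoc (mono_scale m (e k)) _ Hc).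
  by apply: h; rewrite (ltW ek0).
move=> Z; apply: near_scale => //; first by move=> k; case/andP: (e01 k).
  by case: mG.
exact: cutoff_near1.
Qed.

Lemma schw_dilate (e : R) : 0 < e <= 1 -> schw (fun x => K (e *: x)).
Proof.
move=> /andP[e0 e1]; apply/schwDc => k N; have [c c0 Hc] := (schwDc K).1 sK k N.
have h : 0 <= e <= 1 by rewrite (ltW e0).
have H := Dc_monoc (mono_scale m e) h Hc.
exists (c * e^-1 `^ N%:R); first by rewrite mulr_ge0// powR_ge0.
apply: Dc_le H => j x _; rewrite -mulrA ler_wpM2l//.
have hx : e * japanese x <= japanese (e *: x).
  rewrite -(ler_pXn2r (n := 2)) ?nnegrE ?mulr_ge0 ?(ltW e0) ?(ltW (japanese_gt0 _))//.
  rewrite exprMn !japanese2 dotvZr dotvC dotvZr mulrDr mulr1 lerD//.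
    by rewrite expr_le1// ltW.
  by apply: eqle; ring.
apply: (@le_trans _ _ ((e * japanese x) `^ (- N%:R))).
  by apply: powR_antimono; rewrite // mulr_gt0 ?japanese_gt0.
rewrite powRM ?(ltW e0) ?(ltW (japanese_gt0 _))// ler_wpM2r ?powR_ge0//.
by rewrite powRN !powR_mulrn ?invr_ge0 ?(ltW e0)// exprVn.
Qed.
End dilated_cutoffs.

(** * Convergent oscillatory integrals, over all or over the fibre variables *)

Section phase_space.
Variables (R : realType) (a b : nat).
Local Notation C := R[i].
Local Notation V := 'cV[R]_(a + b).
Local Notation jap := (@japanese R _).

Variable l : 'I_(a + b) -> V.
Variable E : V -> C.
Hypotheses (cE : ccontinuous E) (E1 : forall x, normc (E x) <= 1)
  (dE : forall j, isD j E (fun x => ('i%C * (dotv (l j) x)%:C) * E x)).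

(** Each derivative of E costs a factor of growth 1, that is, E has type -1. *)
Lemma symk_E k : symk k one1 (@japanese R (a + b)) 0 (- 1) E.
Proof.
have bE : exists2 c : R, 0 <= c & forall x, normc (E x) <= c * (one1 x * jap x `^ 0).
  by exists 1 => // x; rewrite powRr0 /one1 !mulr1.
elim: k => [|k IH]; first exact: symk0.
apply: symk_S => // j; exists (fun x => ('i%C * (dotv (l j) x)%:C) * E x); first exact: dE.
rewrite (_ : 0 - - 1 = 1 + 0 :> R); last by ring.
apply: symkM1 => //; first exact: japanese_ge1.
apply: symkZ => //; by apply: symk_le (symk_dotv k (l j)) => //; exact: japanese_ge1.
Qed.

Lemma Dc_E k : exists2 c : R, 0 <= c & Dc k (fun _ x => c * jap x `^ k%:R) E.
Proof.
have [c c0 Hc] := symk_E k; exists c => //; apply: Dc_le Hc => j x jk.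
rewrite /one1 mul1r ler_wpM2l// ler_powR ?japanese_ge1//.
by rewrite sub0r mulN1r opprK ler_nat.
Qed.

Lemma jap0 n (x : 'cV[R]_n) r : 0 <= jap x `^ r. Proof. exact: powR_ge0. Qed.

Variable M : nat.
(** A number of integrations by parts that compensates an amplitude of growth <Z>^M
   and leaves the integrable factor <Z>^(-2(a+b)). *)
Definition m0 := (M + 2 * (a + b))%N.

Lemma jap_m0 (Z : V) : jap Z `^ M%:R * jap Z `^ (- m0%:R) <= cauchyw Z.
Proof.
rewrite -powR_add ?japanese_gt0//; apply: japanese_powR_cauchyw.
by rewrite /m0 natrD opprD addrA subrr sub0r natrM.
Qed.

Section total.
Hypothesis inj : exists2 C0 : R, 0 <= C0 & forall Z : V, jap Z <= C0 * (jap (usubmx Z) * sf l Z).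

(** The size of an amplitude of growth M multiplied by a Schwartz function of the
   base variables. *)
Definition total_weight (Z : V) : R := jap Z `^ M%:R * jap (usubmx Z) `^ (- m0%:R).

(** By the hypothesis on the phase, <Z> is controlled by the product of the bracket
   of the base variables and of the size of the gradient.  The former is
   compensated by the decay in the base variables, the latter by the gain of m0
   integrations by parts. *)
Lemma osc_dom : exists2 C1 : R, 0 <= C1 & forall c u, 0 <= c ->
  Dc m0 (fun _ x => c * total_weight x) u -> dominatedC (C1 * c) (fun x => E x * iter m0 (ibp_op l) u x).
Proof.
have [C0 C00 HC0] := inj.
have lP j : l j = l j \/ l j = 0 by left.
have [d d0 Hd] := iterP_bound l 0 m0.
exists (d * C0 `^ m0%:R); first by rewrite mulr_ge0// powR_ge0.
move=> c u c0; rewrite -[X in Dc X]addn0 => /Hd Hu; split=> [|Z].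
  by apply: ccM => //; exact: Dc_cc Hu.
rewrite normcM (@le_trans _ _ (1 * normc (iter m0 (ibp_op l) u Z)))//.
  by rewrite ler_wpM2r ?normc_ge0.
rewrite mul1r (le_trans (Dc_bound Z Hu))//.
rewrite -2!mulrA ler_wpM2l// [leRHS]mulrCA -[leLHS]mulrA ler_wpM2l//.
have s0 := sf_gt0 l Z; have jx := japanese_gt0 (usubmx Z).
have h : jap Z `^ m0%:R <= C0 `^ m0%:R * (jap (usubmx Z) `^ m0%:R * sf l Z `^ m0%:R).
  rewrite -!powRM ?mulr_ge0 ?(ltW jx) ?(ltW s0)//.
  by apply: ge0_ler_powR; rewrite // nnegrE ?mulr_ge0 ?(ltW jx) ?(ltW s0) ?(ltW (japanese_gt0 _)).
rewrite /total_weight -mulrA; apply: (@le_trans _ _ (jap Z `^ M%:R * (C0 `^ m0%:R * jap Z `^ (- m0%:R)))).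
  rewrite ler_wpM2l ?jap0// !powRN -invfM ler_pdivlMr ?powR_gt0 ?japanese_gt0//.
  by rewrite mulrC ler_pdivrMr ?mulr_gt0 ?powR_gt0.
by rewrite mulrCA ler_wpM2l ?powR_ge0// jap_m0.
Qed.
End total.

(** The components of the gradient in the fibre variables. *)
Definition lth (j : 'I_(a + b)) : V := match fintype.split j with inl _ => 0 | inr _ => l j end.

Lemma lthP j : lth j = l j \/ lth j = 0.
Proof. by rewrite /lth; case: fintype.split; [right|left]. Qed.

Lemma lth_lshift i : lth (lshift b i) = 0.
Proof. by rewrite /lth (unsplitK (inl i)). Qed.

Lemma lth_rshift i : lth (rshift a i) = l (rshift a i).
Proof. by rewrite /lth (unsplitK (inr i)). Qed.

Lemma dominatedC_slicer c (f : V -> C) u : dominatedC c f -> dominatedC (c * cauchyw u) (fun v => f (col_mx u v)).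
Proof.
case=> -[cr ci] fc; split.
  by split; [exact: (ccomp (@col_mx_contr _ a b u) cr)|exact: (ccomp (@col_mx_contr _ a b u) ci)].
by move=> v; rewrite -mulrA -cauchyw_col_mx.
Qed.

Lemma isD_slicer (f df : V -> C) u i : isD (rshift a i) f df ->
  isD i (fun v => f (col_mx u v)) (fun v => df (col_mx u v)).
Proof. by move=> H v; have [h1 h2] := H (col_mx u v); split; apply: is_derive_slicer. Qed.

Lemma slice_ibp m c u X : 0 <= c -> Dc m (fun _ x => c * cauchyw x) u ->
  integralC (fun v => E (col_mx X v) * u (col_mx X v)) =
  integralC (fun v => E (col_mx X v) * iter m (ibp_op lth) u (col_mx X v)).
Proof.
move=> c0 Hu.
apply: (@ibp_iter _ _ l lth lthP E cE E1 dE (fun f => integralC (fun v => f (col_mx X v))) _ _ _ m c) => //.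
- by move=> d d' f g nf ng; exact: (integralCD (dominatedC_slicer X nf) (dominatedC_slicer X ng)).
- by move=> d k f nf; exact: (integralCZ k (dominatedC_slicer X nf)).
- move=> j d f df; rewrite -(splitK j); case: (fintype.split j) => i /=.
    by rewrite lth_lshift eqxx.
  by move=> _ /(isD_slicer X) H nf ndf; exact: integralC_isD0 H (dominatedC_slicer X nf) (dominatedC_slicer X ndf).
Qed.

Section remainder.
Variables (chi : V -> R) (r : V -> C).
Hypotheses (Hr : forall k, exists2 c : R, 0 <= c & Dc k (fun _ Z => c * (chi Z * jap Z `^ M%:R)) r)
  (Hchi : exists2 C0 : R, 0 <= C0 & forall Z, chi Z = 0 \/ (chi Z = 1 /\ jap Z <= C0 * sf lth Z)).

Lemma chi_sf (m : nat) : exists2 C1 : R, 0 <= C1 & forall Z,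
  chi Z * jap Z `^ M%:R * sf lth Z `^ (- m%:R) <= C1 * (jap Z `^ M%:R * jap Z `^ (- m%:R)).
Proof.
have [C0 C00 H] := Hchi; exists (C0 `^ m%:R); first exact: powR_ge0.
move=> Z; have s0 := sf_gt0 lth Z; case: (H Z) => [->|[-> hZ]].
  by rewrite !mul0r mulr_ge0 ?powR_ge0// mulr_ge0 ?powR_ge0.
rewrite mul1r [leRHS]mulrCA ler_wpM2l ?powR_ge0// !powRN.
rewrite ler_pdivlMr ?powR_gt0 ?japanese_gt0// mulrC ler_pdivrMr ?powR_gt0//.
rewrite -powRM ?(ltW s0)//; apply: ge0_ler_powR; rewrite // nnegrE ?mulr_ge0 ?(ltW s0)//.
exact/ltW/japanese_gt0.
Qed.

Lemma rem_iter k m : exists2 c : R, 0 <= c &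
  Dc k (fun _ Z => c * (jap Z `^ M%:R * jap Z `^ (- m%:R))) (iter m (ibp_op lth) r).
Proof.
have [d d0 Hd] := iterP_bound lth k m; have [c c0 Hc] := Hr (m + k).
have [C1 C10 H1] := chi_sf m.
exists (d * (c * C1)); first by rewrite mulr_ge0// mulr_ge0.
apply: Dc_le (Hd _ _ Hc) => j Z _; rewrite -[leRHS]mulrA ler_wpM2l//.
by rewrite -[leLHS]mulrA -[leRHS]mulrA ler_wpM2l.
Qed.

Lemma rem_dom : exists2 C1 : R, 0 <= C1 & forall c u, 0 <= c ->
  Dc m0 (fun _ x => c * (chi x * jap x `^ M%:R)) u -> dominatedC (C1 * c) (fun x => E x * iter m0 (ibp_op lth) u x).
Proof.
have [d d0 Hd] := iterP_bound lth 0 m0; have [C1 C10 H1] := chi_sf m0.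
exists (d * C1); first exact: mulr_ge0.
move=> c u c0; rewrite -[X in Dc X]addn0 => /Hd Hu; split=> [|Z].
  by apply: ccM => //; exact: Dc_cc Hu.
rewrite normcM (@le_trans _ _ (1 * normc (iter m0 (ibp_op lth) u Z)))//.
  by rewrite ler_wpM2r ?normc_ge0.
rewrite mul1r (le_trans (Dc_bound Z Hu))//.
rewrite -2!mulrA ler_wpM2l// [leRHS]mulrCA -[leLHS]mulrA ler_wpM2l//.
by apply: le_trans (H1 Z) _; rewrite ler_wpM2l// jap_m0.
Qed.

(** The kernel of the part of the amplitude supported where the gradient in the
   fibre variables dominates <Z>; there integrations by parts in the fibre alone
   give convergence, for each fixed X. *)
Definition Kr (X : 'cV[R]_a) : C :=
  integralC (fun v => E (col_mx X v) * iter m0 (ibp_op lth) r (col_mx X v)).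

(** The number of integrations by parts may be increased at will without changing
   the integral.  Each of them gains a power of <Z> on the support of r, which
   compensates the growth produced by the derivatives of E in X and gives any
   decay in X. *)
Lemma schw_Kr : schw Kr.
Proof.
apply/schwDc => k K.
(* k powers for the derivatives of E, K for the decay in X, 2b for the integral over the fibre. *)
pose m' := (k + K + 2 * b)%N; pose m := (m' + m0)%N.
have KE X : Kr X = integralC (fun v => E (col_mx X v) * iter m (ibp_op lth) r (col_mx X v)).
  rewrite /m iterD; have [c c0 Hc] := rem_iter m' m0.
  apply: (@slice_ibp _ c) => //; apply: Dc_le Hc => j Z _.
  by rewrite ler_wpM2l// jap_m0.
have [c c0 Hc] := rem_iter k m; have [d d0 Hd] := Dc_E k.
pose B := 2 ^+ k * (d * c).
have B0 : 0 <= B by rewrite mulr_ge0 ?exprn_ge0// mulr_ge0.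
have H : Dc k (fun _ Z => (B * jap (usubmx Z) `^ (- K%:R)) * cauchyw (dsubmx Z))
    (fun Z => E Z * iter m (ibp_op lth) r Z).
  apply: Dc_le (Dc_mulc Hd Hc) => j Z _.
  have -> : 2 ^+ k * (d * jap Z `^ k%:R * (c * (jap Z `^ M%:R * jap Z `^ (- m%:R)))) =
    B * (jap Z `^ k%:R * (jap Z `^ M%:R * jap Z `^ (- m%:R))) by rewrite /B; ring.
  rewrite -[leRHS]mulrA ler_wpM2l//.
  rewrite -(powR_add _ _ (japanese_gt0 Z)) -(powR_add _ _ (japanese_gt0 Z)).
  apply: (@le_trans _ _ (jap Z `^ (- K%:R + - (2 * b%:R)))).
    have mE : m%:R = k%:R + K%:R + 2 * b%:R + (M%:R + 2 * (a%:R + b%:R)) :> R.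
      by rewrite -(natrD _ a b) -!natrM -!natrD.
    rewrite ler_powR ?japanese_ge1// mE.
    have := ler0n R a; have := ler0n R b; move: (k%:R : R) (K%:R : R) (M%:R : R) => *; lra.
  rewrite powR_add ?japanese_gt0// ler_pM ?powR_ge0//.
    by apply: powR_antimono; rewrite // ?japanese_gt0// japanese_usub.
  apply: le_trans (japanese_cauchyw (dsubmx Z)).
  by apply: powR_antimono; rewrite // ?japanese_gt0 ?mulr_ge0// japanese_dsub.
have Hp := @Dc_partial R a b k (fun _ X => B * jap X `^ (- K%:R)) B _ _ _ H.
exists (B * (2 * integralR (@cauchyw R b))).
  by rewrite mulr_ge0// mulr_ge0// integralR_cauchyw_ge0.
rewrite (_ : Kr = (fun u => integralC (fun v => E (col_mx u v) * iter m (ibp_op lth) r (col_mx u v)))); last exact/funext.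
apply: Dc_le (Hp _ _) => [j u _|j u _|j u].
- by apply: eqle; ring.
- rewrite ler_piMr// powRN invf_le1 ?powR_gt0 ?japanese_gt0//.
  by rewrite -[leLHS](powRr0 (jap u)) ler_powR ?japanese_ge1.
- by rewrite mulr_ge0// powR_ge0.
Qed.

Lemma rem_lim (F : 'cV[R]_a -> C) rho : schw F -> reg m0 rho ->
  (forall k, exists2 d : R, 0 <= d & Dc m0 (fun _ x => d * cauchyw x) (fun x => rho k x * (r x * F (usubmx x)))) ->
  ccvg (fun k => integralC (fun x => E x * (rho k x * (r x * F (usubmx x)))))
    (integralC (fun X => F X * Kr X)).
Proof.
move=> sF Hrho Hn.
have [c c0 Hc] := Hr m0; have [e e0 He] := schw_bounded m0 sF.
have HrF : Dc m0 (fun _ x => 2 ^+ m0 * (c * e) * (chi x * jap x `^ M%:R)) (fun x => r x * F (usubmx x)).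
  apply: Dc_le (Dc_mulc Hc (Dc_monoc (mono_usubmx R a b) (le01 R) He)) => j x _.
  by apply: eqle; ring.
have c1 : 0 <= 2 ^+ m0 * (c * e) by rewrite mulr_ge0 ?exprn_ge0// mulr_ge0.
have := reg_lim lthP cE E1 dE rem_dom c1 HrF Hrho Hn.
rewrite (@iterP_mulr _ _ lth m0 _ r (fun x => F (usubmx x)) _ Hc); last first.
  move=> j; rewrite -(splitK j); case: (fintype.split j) => i /=; first by rewrite lth_lshift eqxx.
  move=> _; apply: isD_mono0 => Z h; apply/colP => k; rewrite !mxE.
  rewrite (_ : (lshift b k == rshift a i) = false) ?mulr0 ?addr0//.
  by apply/negP => /eqP/(congr1 val) /= ki; have := ltn_ord k; rewrite ki ltnNge leq_addr.
have [C1 C10 HC1] := rem_dom; have nr := HC1 _ _ c0 Hc.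
have [cF bF] : ccontinuous (fun x : V => F (usubmx x)) /\ forall x : V, normc (F (usubmx x)) <= e.
  have H := Dc_monoc (mono_usubmx R a b) (le01 R) He; split; first exact: Dc_cc H.
  by move=> x; exact: Dc_bound H.
have nrF : dominatedC (C1 * c * e) (fun x => E x * (iter m0 (ibp_op lth) r x * F (usubmx x))).
  case: nr => cr br; split=> [|x].
    rewrite (_ : (fun x => _) = (fun x => E x * iter m0 (ibp_op lth) r x * F (usubmx x))); first exact: ccM.
    by apply/funext => x; rewrite mulrA.
  rewrite mulrA normcM [leRHS]mulrAC ler_pM ?normc_ge0//.
rewrite (integralC_block nrF); congr ccvg; congr integralC; apply/funext => X.
rewrite /Kr -(integralCZ (F X) (dominatedC_slicer X nr)); congr integralC; apply/funext => v.
by rewrite col_mxKu mulrA mulrC.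
Qed.

Hypothesis EE : forall x, E x * conjc (E x) = 1.
Variable psi : 'cV[R]_b -> C.
Hypotheses (spsi : schw psi) (ipsi : integralC psi = 1).

(** Multiplied by E and integrated over the fibre, this amplitude gives back the
   kernel [Kr]. *)
Definition samp (Z : V) : C := Kr (usubmx Z) * psi (dsubmx Z) * conjc (E Z).

Lemma schw_samp : schw samp.
Proof.
apply: schwM_temp; first exact: schw_tensor schw_Kr spsi.
move=> k; exists k; have [c c0 Hc] := Dc_E k; exists c => //; exact: Dc_conj.
Qed.

Lemma samp_lim (F : 'cV[R]_a -> C) rho : schw F -> reg m0 rho ->
  ccvg (fun k => integralC (fun x => E x * (rho k x * (samp x * F (usubmx x)))))
    (integralC (fun X => F X * Kr X)).
Proof.
move=> sF Hrho.
have [c c0 Hc] := schw_cauchyw m0 schw_samp; have [e e0 He] := schw_bounded m0 sF.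
have HsF : Dc m0 (fun _ x => 2 ^+ m0 * (c * e) * cauchyw x) (fun x => samp x * F (usubmx x)).
  apply: Dc_le (Dc_mulc Hc (Dc_monoc (mono_usubmx R a b) (le01 R) He)) => j x _.
  by apply: eqle; ring.
have c1 : 0 <= 2 ^+ m0 * (c * e) by rewrite mulr_ge0 ?exprn_ge0// mulr_ge0.
have := dominated_lim cE E1 c1 HsF Hrho; congr ccvg.
have nE : dominatedC (2 ^+ m0 * (c * e)) (fun x => E x * (samp x * F (usubmx x))).
  split=> [|x]; first by apply: ccM => //; exact: Dc_cc HsF.
  rewrite normcM (le_trans _ (Dc_bound x HsF))// ler_piMl ?normc_ge0//.
rewrite (integralC_block nE); congr integralC; apply/funext => X.
have [d d0 nP] := schw_dominatedC spsi.
rewrite (_ : (fun v => _) = (fun v => F X * Kr X * psi v)).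
  by rewrite (integralCZ _ nP) ipsi mulr1.
apply/funext => v; rewrite /samp col_mxKu col_mxKd.
transitivity (F X * Kr X * psi v * (E (col_mx X v) * conjc (E (col_mx X v)))); first by ring.
by rewrite EE mulr1.
Qed.
End remainder.
End phase_space.

(** * Quadratic phases *)

Section quadratic_phase.
Variables (R : realType) (n : nat) (S : 'M[R]_n).
Hypothesis Ssym : S^T = S.
Local Notation C := R[i].
Local Notation V := 'cV[R]_n.

Lemma dotv_mx m (u v : 'cV[R]_m) : dotv u v = (u^T *m v) 0 0.
Proof. by rewrite mxE; apply: eq_bigr => i _; rewrite mxE. Qed.

Lemma dotv_mulmx m p (A : 'M[R]_(m, p)) u v : dotv u (A^T *m v) = dotv (A *m u) v.
Proof. by rewrite !dotv_mx trmx_mul mulmxA. Qed.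

Definition quad (Z : V) : R := 2^-1 * dotv Z (S *m Z).
Definition qform (j : 'I_n) : V := (row j S)^T.

Lemma qformE j Z : dotv (qform j) Z = (S *m Z) j 0.
Proof. by rewrite dotv_mx trmxK -row_mul mxE. Qed.

Lemma is_derive_quad Z j : is_derive Z (ebase R j) quad (dotv (qform j) Z).
Proof.
apply/is_deriveP.
rewrite (_ : (fun h => _) = (fun h : R => quad Z + h * dotv (qform j) Z + h * (h * quad (ebase R j)))).
  apply: is_derive_eq; rewrite /GRing.scale /=; ring.
apply/funext => h; rewrite /quad mulmxDr -scalemxAr dotvDr dotvZr.
rewrite ![dotv (Z + _) _]dotvC !dotvDr !dotvZr.
have -> : dotv (S *m ebase R j) Z = dotv (qform j) Z.
  by rewrite qformE -dotv_mulmx Ssym dotvC dotv_ebase.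
have -> : dotv (S *m Z) (ebase R j) = dotv (qform j) Z by rewrite dotv_ebase qformE.
rewrite ![dotv (S *m _) _]dotvC.
by field.
Qed.

Definition Eph (Z : V) : C := expi (quad Z).

Lemma continuous_quad : continuous quad.
Proof.
rewrite /quad; apply: cmul; first exact: ccst.
rewrite (_ : (fun Z => _) = (fun Z : V => \sum_j Z j 0 * dotv (qform j) Z)); last first.
  by apply/funext => Z; rewrite /dotv; apply: eq_bigr => j _; rewrite -qformE.
elim: (index_enum _) => [|i s IH].
  rewrite (_ : (fun _ => _) = cst 0); first exact: cst_continuous.
  by apply/funext => y; rewrite big_nil.
rewrite (_ : (fun _ => _) = (fun x : V => x i 0 * dotv (qform i) x + \sum_(j <- s) x j 0 * dotv (qform j) x)).
  by apply: cadd => //; apply: cmul; [exact: coord_cont|exact: continuous_form].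
by apply/funext => y; rewrite big_cons.
Qed.

Lemma cc_Eph : ccontinuous Eph.
Proof.
split; [apply: (ccomp continuous_quad)|apply: (ccomp continuous_quad)] => t.
  exact: continuous_cos.
exact: continuous_sin.
Qed.

Lemma normc_Eph Z : normc (Eph Z) <= 1.
Proof. by rewrite /Eph /expi /= cos2Dsin2 sqrtr1. Qed.

Lemma Eph_conj Z : Eph Z * conjc (Eph Z) = 1.
Proof.
apply/eqP; rewrite eq_complex ReM ImM /=.
apply/andP; split; apply/eqP; last by ring.
by rewrite mulrN opprK -!expr2 cos2Dsin2.
Qed.

Lemma dEph j : isD j Eph (fun Z => ('i%C * (dotv (qform j) Z)%:C) * Eph Z).
Proof.
move=> Z; split.
  rewrite ReM ReM ImM /= (_ : _ - _ = - sin (quad Z) * dotv (qform j) Z); last by ring.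
  apply: (@is_derive_real_comp _ _ (@cos R) (fun t => - sin t)); last exact: is_derive_quad.
rewrite ImM ReM ImM /= (_ : _ + _ = cos (quad Z) * dotv (qform j) Z); last by ring.
apply: (@is_derive_real_comp _ _ (@sin R) (@cos R)); last exact: is_derive_quad.
Qed.
End quadratic_phase.

Section linear_bounds.
Variable R : realType.

(** Bound Z = D (B Z) for a left inverse D of B. *)
Lemma injective_bound m n (B : 'M[R]_(m, n)) :
  (forall Z : 'cV[R]_n, B *m Z = 0 -> Z = 0) ->
  exists2 c : R, 1 <= c & forall Z : 'cV[R]_n, dotv Z Z <= c * dotv (B *m Z) (B *m Z).
Proof.
move=> HB.
have : row_full B.
  rewrite /row_full -mxrank_tr -[_ == _]/(row_free B^T) -kermx_eq0; apply/eqP/row_matrixP => i; rewrite row0.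
  apply: (can_inj (@trmxK _ _ _)); rewrite trmx0; apply: HB.
  by apply: (can_inj (@trmxK _ _ _)); rewrite trmx_mul trmxK trmx0 -row_mul mulmx_ker row0.
case/row_fullP => D DB.
pose c i := \sum_j `|D i j|.
exists (1 + \sum_i c i ^+ 2); first by rewrite lerDl sumr_ge0// => i _; exact: sqr_ge0.
move=> Z; set W := B *m Z; have ZE : Z = D *m W by rewrite mulmxA DB mul1mx.
have hW j : `|W j 0| <= enorm W.
  rewrite /enorm -sqrtr_sqr ler_sqrt ?dotv_ge0// /dotv (bigD1 j)//= expr2 lerDl.
  by apply: sumr_ge0 => i _; rewrite -expr2 sqr_ge0.
have hZ i : `|Z i 0| <= c i * enorm W.
  rewrite {1}ZE mxE (le_trans (ler_norm_sum _ _ _))// /c mulr_suml ler_sum// => j _.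
  by rewrite normrM ler_wpM2l.
have e2 : enorm W ^+ 2 = dotv W W by rewrite sqr_sqrtr ?dotv_ge0.
apply: (@le_trans _ _ ((\sum_i c i ^+ 2) * dotv W W)).
  rewrite /dotv mulr_suml ler_sum// => i _; rewrite -/(dotv W W) -e2 -expr2 -exprMn.
  rewrite -real_normK ?num_real// lerXn2r// ?nnegrE// (le_trans _ (hZ i))//.
by rewrite ler_wpM2r ?dotv_ge0// lerDr.
Qed.

Lemma jap_bound m n p (B : 'M[R]_(m, n)) (G : 'M[R]_(p, n)) :
  (forall Z : 'cV[R]_n, B *m Z = 0 -> G *m Z = 0 -> Z = 0) ->
  exists2 c : R, 1 <= c & forall Z : 'cV[R]_n, japanese Z ^+ 2 <=
    c * (japanese (B *m Z) ^+ 2 + dotv (G *m Z) (G *m Z)).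
Proof.
move=> H; have [c c1 Hc] : exists2 c : R, 1 <= c & forall Z : 'cV[R]_n,
    dotv Z Z <= c * dotv (col_mx B G *m Z) (col_mx B G *m Z).
  apply: injective_bound => Z; rewrite mul_col_mx => E0.
  have [E1 E2] : B *m Z = 0 /\ G *m Z = 0.
    by rewrite -(col_mx0 R m p 1) in E0; exact: eq_col_mx E0.
  exact: H.
exists c => // Z; rewrite !japanese2.
apply: (le_trans (lerD (lexx 1) (Hc Z))); rewrite mul_col_mx dotv_col_mx.
rewrite -addrA [leRHS]mulrDr mulr1 lerD2r//.
Qed.
End linear_bounds.

Section phases.
Variables (R : realType) (d N : nat) (phi : phase R d N).
Local Notation C := R[i].

Definition hess : 'M[R]_(d + d + N) := block_mx (phaseF phi) (phaseL phi) (phaseL phi)^T (phaseQ phi).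

Lemma hess_sym : hess^T = hess.
Proof. by rewrite /hess tr_block_mx trmxK phaseF_sym phaseQ_sym. Qed.

Lemma hess_col (X : 'cV[R]_(d + d)) (theta : 'cV[R]_N) : hess *m col_mx X theta =
  col_mx (phaseF phi *m X + phaseL phi *m theta) ((phaseL phi)^T *m X + phaseQ phi *m theta).
Proof. by rewrite /hess mul_block_col. Qed.

Lemma phase_quad (X : 'cV[R]_(d + d)) (theta : 'cV[R]_N) : phase_fun phi X theta = quad hess (col_mx X theta).
Proof.
rewrite /quad hess_col dotv_col_mx !dotvDr dotv_mulmx /phase_fun [dotv (_ *m theta) X]dotvC.
by field.
Qed.

Lemma grad_theta (X : 'cV[R]_(d + d)) (theta : 'cV[R]_N) : gradient (phase_fun phi X) theta = dsubmx (hess *m col_mx X theta).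
Proof.
apply/colP => i; rewrite !mxE.
have := is_derive_slicer (is_derive_quad hess_sym (col_mx X theta) (rshift (d + d) i)).
rewrite (_ : (fun v => _) = phase_fun phi X); last by apply/funext => t; rewrite phase_quad.
by move=> H; rewrite (@derive_val _ _ _ _ _ _ _ H) qformE mxE.
Qed.

Lemma grad_X (X : 'cV[R]_(d + d)) (theta : 'cV[R]_N) : gradient (phase_fun phi ^~ theta) X = usubmx (hess *m col_mx X theta).
Proof.
apply/colP => i; rewrite !mxE.
have := is_derive_slicel (is_derive_quad hess_sym (col_mx X theta) (lshift N i)).
rewrite (_ : (fun v => _) = phase_fun phi ^~ theta); last by apply/funext => t; rewrite phase_quad.
by move=> H; rewrite (@derive_val _ _ _ _ _ _ _ H) qformE mxE.
Qed.

Lemma lagrangianE : lagrangian phi = [set p | exists (X : 'cV[R]_(d + d)) (theta : 'cV[R]_N),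
  dsubmx (hess *m col_mx X theta) = 0 /\ p = (X, usubmx (hess *m col_mx X theta))].
Proof.
apply/seteqP; split=> p [X [theta [h ->]]]; exists X, theta.
  by rewrite -grad_theta -grad_X.
by rewrite grad_theta grad_X.
Qed.

(** The injectivity condition in the definition of phase functions. *)
Lemma hess_inj (Z : 'cV[R]_(d + d + N)) : usubmx Z = 0 -> hess *m Z = 0 -> Z = 0.
Proof.
rewrite -(vsubmxK Z) col_mxKu => ->; rewrite hess_col !mulmx0 !add0r => H.
rewrite (_ : dsubmx Z = 0) ?col_mx0//.
by apply: (@phase_inj _ _ _ phi); rewrite mulmx0 mul_col_mx H.
Qed.

(** The hypothesis under which oscillatory integrals converge: the base variables
   and the gradient of the phase together control all the variables. *)
Lemma phase_bound : exists2 C0 : R, 0 <= C0 & forall Z : 'cV[R]_(d + d + N),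
  japanese Z <= C0 * (japanese (usubmx Z) * sf (qform hess) Z).
Proof.
have uE (Z : 'cV[R]_(d + d + N)) : row_mx 1%:M 0 *m Z = usubmx Z :> 'cV[R]_(d + d).
  by rewrite -{1}(vsubmxK Z) mul_row_col mul1mx mul0mx addr0.
have H (Z : 'cV[R]_(d + d + N)) : (row_mx 1%:M 0 : 'M[R]_(d + d, _)) *m Z = 0 -> hess *m Z = 0 -> Z = 0.
  by rewrite uE => u0 h0; exact: hess_inj.
have [c c1 Hc] := jap_bound H; exists c => [|Z]; first exact: le_trans c1.
have c0 : 0 <= c by exact: le_trans c1.
have := Hc Z; rewrite uE.
have -> : dotv (hess *m Z) (hess *m Z) = sf (qform hess) Z ^+ 2 - 1.
  rewrite sf2 /lamf addrC addKr /dotv; apply: eq_bigr => j _.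
  by rewrite -[X in _ = X ^+ 2]/(dotv _ _) qformE expr2.
set p := japanese (usubmx Z); set s := sf _ Z => h.
have p1 : 1 <= p by exact: japanese_ge1.
have s1 : 1 <= s by exact: sf_ge1.
have z1 := japanese_ge1 Z.
rewrite -(ler_pXn2r (n := 2)) ?nnegrE ?mulr_ge0//; [|lra..].
apply: (le_trans h); rewrite !exprMn.
apply: (@le_trans _ _ (c * (p ^+ 2 * s ^+ 2))).
  rewrite ler_wpM2l//; have : 0 <= (p ^+ 2 - 1) * (s ^+ 2 - 1); last by lra.
  by rewrite mulr_ge0// subr_ge0 exprn_ege1.
apply: ler_wpM2r; first by rewrite mulr_ge0 ?sqr_ge0.
by rewrite expr2 ler_peMl.
Qed.
End phases.

(** * The phase of the composition *)

Section graphs.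
Variables (R : realType) (d : nat).
Implicit Types (chi : 'M[R]_(d + d)).

Lemma sigma_nondegenerate (u : 'cV[R]_(d + d)) : (forall v, sigma u v = 0) -> u = 0.
Proof.
move=> H; have dotv_refl n (x : 'cV[R]_n) : dotv x x = 0 -> x = 0.
  move=> x0; apply/colP => i; rewrite mxE; apply/eqP; rewrite -sqrf_eq0 eq_le sqr_ge0 andbT.
  rewrite -x0 /dotv (bigD1 i)//= -expr2 lerDl; apply: sumr_ge0 => k _.
  by rewrite -expr2 sqr_ge0.
rewrite -(vsubmxK u); have := H (col_mx (dsubmx u) (- usubmx u)).
rewrite /sigma col_mxKu col_mxKd => h.
have h0 : dotv (dsubmx u) (dsubmx u) + dotv (usubmx u) (usubmx u) = 0.
  rewrite -h; congr (_ + _); rewrite /dotv -sumrN; apply: eq_bigr => i _.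
  by rewrite [(- usubmx u) i 0]mxE mulrN opprK.
move: h0 => /eqP; rewrite paddr_eq0 ?dotv_ge0// => /andP[/eqP/dotv_refl -> /eqP/dotv_refl ->].
exact: col_mx0.
Qed.

Lemma symplectic_inj chi (u : 'cV[R]_(d + d)) : symplectic chi -> chi *m u = 0 -> u = 0.
Proof.
move=> Hchi u0; apply: sigma_nondegenerate => v; rewrite -Hchi u0 /sigma.
by rewrite !linear0 /dotv !big1 ?subr0// => i _; rewrite !mxE ?mul0r ?mulr0.
Qed.

Variables (N : nat) (phi : phase R d N) (chi : 'M[R]_(d + d)).
Hypothesis Lchi : lagrangian phi = twisted_graph chi.

(** The twist of the graph is the sign of the covector at the source. *)
Lemma graph_of_critical (x z xi zeta : 'cV[R]_d) (theta : 'cV[R]_N) :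
  hess phi *m col_mx (col_mx x z) theta = col_mx (col_mx xi zeta) 0 ->
  col_mx x xi = chi *m col_mx z (- zeta).
Proof.
move=> H; have : lagrangian phi (col_mx x z, col_mx xi zeta).
  by rewrite lagrangianE; exists (col_mx x z), theta; rewrite H col_mxKu col_mxKd.
rewrite Lchi => -[x' [z' [xi' [zeta' [[/eq_col_mx[-> ->] /eq_col_mx[-> ->]] E']]]]].
by rewrite opprK.
Qed.

Lemma critical_of_graph (x z xi zeta : 'cV[R]_d) : col_mx x xi = chi *m col_mx z zeta ->
  exists theta, hess phi *m col_mx (col_mx x z) theta = col_mx (col_mx xi (- zeta)) 0.
Proof.
move=> H; have : twisted_graph chi (col_mx x z, col_mx xi (- zeta)) by exists x, z, xi, zeta.
rewrite -Lchi lagrangianE => -[X [theta [h [-> ->]]]]; exists theta.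
by rewrite -h vsubmxK.
Qed.

(** Nondegeneracy, at a critical point over the zero of the cotangent space. *)
Lemma critical_inj (x z xi zeta : 'cV[R]_d) (theta : 'cV[R]_N) :
  hess phi *m col_mx (col_mx x z) theta = col_mx (col_mx xi zeta) 0 ->
  x = 0 -> z = 0 -> xi = 0 -> zeta = 0 -> theta = 0.
Proof.
move=> H x0 z0 xi0 zeta0; have : col_mx (col_mx x z) theta = 0.
  apply: (@hess_inj _ _ _ phi); first by rewrite col_mxKu x0 z0 col_mx0.
  by rewrite H xi0 zeta0 !col_mx0.
by rewrite -(col_mx0 R (d + d) N 1) => /eq_col_mx[].
Qed.
End graphs.

Section composite.
Variables (R : realType) (d N1 N2 : nat) (phi1 : phase R d N1) (phi2 : phase R d N2).
Local Notation N := (d + (N2 + N1))%N.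
Local Notation V := 'cV[R]_(d + d + N).

(** The coordinates are Z = ((x,y), (z, (tau,theta))), where (x,y) are the base
   variables.  [A1] extracts ((x,z), theta), the variables of the first factor,
   and [A2] extracts ((z,y), tau), those of the second one. *)
Definition A1 : 'M[R]_(d + d + N1, d + d + N) :=
  col_mx (col_mx (row_mx (row_mx 1%:M 0) 0) (row_mx 0 (row_mx 1%:M 0)))
    (row_mx 0 (row_mx 0 (row_mx 0 1%:M))).
Definition A2 : 'M[R]_(d + d + N2, d + d + N) :=
  col_mx (col_mx (row_mx 0 (row_mx 1%:M 0)) (row_mx (row_mx 0 1%:M) 0))
    (row_mx 0 (row_mx 0 (row_mx 1%:M 0))).

Definition pack (x y z : 'cV[R]_d) (tau : 'cV[R]_N2) (theta : 'cV[R]_N1) : V :=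
  col_mx (col_mx x y) (col_mx z (col_mx tau theta)).

Lemma packP (Z : V) : exists x y z tau theta, Z = pack x y z tau theta.
Proof.
exists (usubmx (usubmx Z)), (dsubmx (usubmx Z)), (usubmx (dsubmx Z)),
  (usubmx (dsubmx (dsubmx Z))), (dsubmx (dsubmx (dsubmx Z))).
by rewrite /pack !vsubmxK.
Qed.

Lemma A1_pack x y z tau theta : A1 *m pack x y z tau theta = col_mx (col_mx x z) theta.
Proof.
by rewrite /A1 /pack !mul_col_mx !mul_row_col !mul0mx !mul1mx !addr0 !add0r.
Qed.

Lemma A2_pack x y z tau theta : A2 *m pack x y z tau theta = col_mx (col_mx z y) tau.
Proof.
by rewrite /A2 /pack !mul_col_mx !mul_row_col !mul0mx !mul1mx !addr0 !add0r.
Qed.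

Definition total_hess : 'M[R]_(d + d + N) :=
  A1^T *m hess phi1 *m A1 + A2^T *m hess phi2 *m A2.

Lemma total_hess_sym : total_hess^T = total_hess.
Proof. by rewrite /total_hess linearD /= !trmx_mul !hess_sym !trmxK !mulmxA. Qed.

(** The variable z belongs to both factors, so that its two covectors add up. *)
Lemma total_hess_pack x y z tau theta a1 b1 c1 a2 b2 c2 :
  hess phi1 *m col_mx (col_mx x z) theta = col_mx (col_mx a1 b1) c1 ->
  hess phi2 *m col_mx (col_mx z y) tau = col_mx (col_mx a2 b2) c2 ->
  total_hess *m pack x y z tau theta = pack a1 b2 (b1 + a2) c2 c1.
Proof.
move=> h1 h2; rewrite mulmxDl -!mulmxA A1_pack A2_pack h1 h2 /A1 /A2.
rewrite !tr_col_mx !tr_row_mx !mul_row_col !mul_col_mx.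
rewrite !trmx0 !trmx1 !mul0mx !mul1mx.
by rewrite -!(col_mx0 R) !add_col_mx !addr0 !add0r.
Qed.

Lemma total_hess_packE x y z tau theta : exists a1 b1 c1 a2 b2 c2,
  [/\ hess phi1 *m col_mx (col_mx x z) theta = col_mx (col_mx a1 b1) c1,
  hess phi2 *m col_mx (col_mx z y) tau = col_mx (col_mx a2 b2) c2 &
  total_hess *m pack x y z tau theta = pack a1 b2 (b1 + a2) c2 c1].
Proof.
set h1 := hess phi1 *m _; set h2 := hess phi2 *m _.
exists (usubmx (usubmx h1)), (dsubmx (usubmx h1)), (dsubmx h1),
  (usubmx (usubmx h2)), (dsubmx (usubmx h2)), (dsubmx h2).
by rewrite !vsubmxK; split => //; apply: total_hess_pack; rewrite !vsubmxK.
Qed.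

Lemma pack_eq0 x y z tau theta : pack x y z tau theta = 0 ->
  [/\ x = 0, y = 0, z = 0, tau = 0 & theta = 0].
Proof.
by rewrite /pack -!(col_mx0 R) => /eq_col_mx[/eq_col_mx[-> ->] /eq_col_mx[-> /eq_col_mx[-> ->]]].
Qed.

Lemma quad_total (Z : V) : quad total_hess Z =
  quad (hess phi1) (A1 *m Z) + quad (hess phi2) (A2 *m Z).
Proof.
by rewrite /quad -mulrDr mulmxDl dotvDr -!mulmxA !dotv_mulmx.
Qed.

Variables chi1 chi2 : 'M[R]_(d + d).
Hypotheses (S1 : symplectic chi1) (S2 : symplectic chi2).
Hypotheses (L1 : lagrangian phi1 = twisted_graph chi1) (L2 : lagrangian phi2 = twisted_graph chi2).

(** If x, z, theta and the gradient in the fibre vanish, then so does the gradient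
   of phi2 in z; hence (z,zeta) = 0 = chi2 (y,eta), so that y = 0, eta = 0 by
   injectivity of chi2, and tau = 0 by nondegeneracy of phi2. *)
Lemma critical_A1 (Z : V) : A1 *m Z = 0 -> dsubmx total_hess *m Z = 0 -> Z = 0.
Proof.
have [x [y [z [tau [theta ->]]]]] := packP Z; rewrite A1_pack -!(col_mx0 R).
move=> /eq_col_mx[/eq_col_mx[-> ->] ->]; rewrite mul_dsub_mx.
have [a1 [b1 [c1 [a2 [b2 [c2 [h1 h2 ->]]]]]]] := total_hess_packE 0 y 0 tau 0.
move: h1; rewrite !col_mx0 mulmx0 -!(col_mx0 R) => /eq_col_mx[/eq_col_mx[<- <-] <-].
rewrite /pack col_mxKd add0r => /eq_col_mx[a20 /eq_col_mx[c20 _]].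
rewrite c20 in h2; have := graph_of_critical L2 h2; rewrite a20 col_mx0.
move=> /esym/(symplectic_inj S2); rewrite -(col_mx0 R) => /eq_col_mx[y0 /eqP]; rewrite oppr_eq0 => /eqP b20.
rewrite b20 in h2.
by rewrite y0 (critical_inj h2).
Qed.

(** Here (x,xi) = chi1 (z,zeta) = 0, and theta = 0 by nondegeneracy of phi1. *)
Lemma critical_A2 (Z : V) : A2 *m Z = 0 -> dsubmx total_hess *m Z = 0 -> Z = 0.
Proof.
have [x [y [z [tau [theta ->]]]]] := packP Z; rewrite A2_pack -!(col_mx0 R).
move=> /eq_col_mx[/eq_col_mx[-> ->] ->]; rewrite mul_dsub_mx.
have [a1 [b1 [c1 [a2 [b2 [c2 [h1 h2 ->]]]]]]] := total_hess_packE x 0 0 0 theta.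
move: h2; rewrite !col_mx0 mulmx0 -!(col_mx0 R) => /eq_col_mx[/eq_col_mx[<- <-] <-].
rewrite /pack col_mxKd addr0 => /eq_col_mx[b10 /eq_col_mx[_ c10]].
rewrite c10 in h1; have := graph_of_critical L1 h1.
rewrite b10 oppr0 col_mx0 mulmx0 -(col_mx0 R) => /eq_col_mx[x0 a10].
by rewrite x0 (critical_inj h1).
Qed.

(** If x, y and the whole gradient vanish, then (0,0) = chi1 (z,zeta); injectivity
   of chi1 gives z = 0, zeta = 0, and nondegeneracy gives theta = 0, tau = 0. *)
Lemma total_hess_inj (Z : V) : usubmx Z = 0 -> total_hess *m Z = 0 -> Z = 0.
Proof.
have [x [y [z [tau [theta ->]]]]] := packP Z; rewrite /pack col_mxKu -(col_mx0 R).
move=> /eq_col_mx[-> ->]; rewrite -/(pack _ _ _ _ _).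
have [a1 [b1 [c1 [a2 [b2 [c2 [h1 h2 ->]]]]]]] := total_hess_packE 0 0 z tau theta.
move=> /pack_eq0[a10 b20 /eqP ba c20 c10].
rewrite c10 in h1; have := graph_of_critical L1 h1; rewrite a10 col_mx0.
move=> /esym/(symplectic_inj S1); rewrite -(col_mx0 R) => /eq_col_mx[z0 /eqP]; rewrite oppr_eq0 => /eqP b10.
move: ba; rewrite b10 add0r => /eqP a20.
rewrite c20 in h2.
by rewrite z0 (critical_inj h1)// (critical_inj h2)// /pack !col_mx0.
Qed.

Lemma total_phase_inj : injective (fun Theta : 'cV[R]_N =>
  col_mx (ursubmx total_hess) (drsubmx total_hess) *m Theta).
Proof.
move=> u v /= uv; apply/eqP; rewrite -subr_eq0; apply/eqP.
have : total_hess *m col_mx 0 (u - v) = 0.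
  rewrite -[total_hess]submxK mul_block_col !mulmx0 !add0r -mul_col_mx mulmxBr uv subrr//.
move=> /total_hess_inj; rewrite col_mxKu => /(_ erefl).
by rewrite -[in RHS](col_mx0 R (d + d) N 1) => /eq_col_mx[].
Qed.

Lemma total_F_sym : (ulsubmx total_hess)^T = ulsubmx total_hess.
Proof. by rewrite trmx_ulsub total_hess_sym. Qed.

Lemma total_Q_sym : (drsubmx total_hess)^T = drsubmx total_hess.
Proof. by rewrite trmx_drsub total_hess_sym. Qed.

Definition total_phase : phase R d N := Phase total_F_sym total_Q_sym total_phase_inj.

Lemma hess_total : hess total_phase = total_hess.
Proof. by rewrite /hess /= trmx_ursub total_hess_sym submxK. Qed.

(** The vanishing of the gradient in z identifies the covector at z in both
   factors; this is the composition of the two graphs. *)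
Lemma total_lagrangian : lagrangian total_phase = twisted_graph (chi1 *m chi2).
Proof.
rewrite lagrangianE hess_total; apply/seteqP; split=> p.
  case=> X [Th]; have [x [y [z [tau [theta EZ]]]]] := packP (col_mx X Th).
  rewrite EZ; case/eq_col_mx: EZ => -> _.
  have [a1 [b1 [c1 [a2 [b2 [c2 [h1 h2 ->]]]]]]] := total_hess_packE x y z tau theta.
  rewrite /pack col_mxKu col_mxKd -!(col_mx0 R) => -[/eq_col_mx[/eqP ba /eq_col_mx[c20 c10]] ->].
  rewrite c10 in h1; rewrite c20 in h2.
  have g1 := graph_of_critical L1 h1; have g2 := graph_of_critical L2 h2.
  exists x, y, a1, (- b2); split; first by rewrite opprK.
  rewrite g1 -mulmxA -g2; congr (_ *m col_mx _ _).
  by apply/eqP; rewrite eq_sym -addr_eq0 addrC.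
move=> [x [y [xi [eta [-> Hx]]]]]; set w := chi2 *m col_mx y eta.
have [tau h2] := critical_of_graph L2 (vsubmxK w).
have [theta h1] : exists theta, hess phi1 *m col_mx (col_mx x (usubmx w)) theta =
    col_mx (col_mx xi (- dsubmx w)) 0.
  by apply: (critical_of_graph L1); rewrite vsubmxK mulmxA.
exists (col_mx x y), (col_mx (usubmx w) (col_mx tau theta)).
rewrite -/(pack _ _ _ _ _) (total_hess_pack h1 h2) /pack col_mxKu col_mxKd addNr.
by rewrite !col_mx0.
Qed.

End composite.

(** * Kernels of oscillatory integrals *)

Section schwartz_partial.
Variable R : realType.
Local Notation C := R[i].

Lemma schw_partial a b (f : 'cV[R]_(a + b) -> C) : schw f ->
  schw (fun u => integralC (fun v => f (col_mx u v))).
Proof.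
move=> sf; apply/schwDc => k K.
have [c c0 Hc] := (schwDc f).1 sf k (K + 2 * b)%N.
have H : Dc k (fun _ Z => (c * japanese (usubmx Z) `^ (- K%:R)) * cauchyw (dsubmx Z)) f.
  apply: Dc_le Hc => j Z _; rewrite -[leRHS]mulrA ler_wpM2l//.
  rewrite natrD opprD (powR_add _ _ (japanese_gt0 Z)).
  apply: ler_pM; [exact: powR_ge0|exact: powR_ge0| |].
    by apply: powR_antimono; rewrite // ?japanese_gt0// japanese_usub.
  apply: le_trans (japanese_cauchyw (dsubmx Z)).
  by rewrite natrM; apply: powR_antimono; rewrite // ?japanese_gt0 ?mulr_ge0// japanese_dsub.
have Hp := @Dc_partial R a b k (fun _ X => c * japanese X `^ (- K%:R)) c _ _ _ H.
exists (c * (2 * integralR (@cauchyw R b))).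
  by rewrite mulr_ge0// mulr_ge0// integralR_cauchyw_ge0.
apply: Dc_le (Hp _ _) => [j u _|j u _|j u].
- by apply: eqle; ring.
- rewrite ler_piMr// powRN invf_le1 ?powR_gt0 ?japanese_gt0//.
  by rewrite -[leLHS](powRr0 (japanese u)) ler_powR ?japanese_ge1.
- by rewrite mulr_ge0// powR_ge0.
Qed.

Lemma schw_monoc n m (G : 'cV[R]_n -> 'cV[R]_m) (f : 'cV[R]_m -> C) :
  monomial_map 1 G -> (forall Z, japanese Z <= japanese (G Z)) -> schw f -> schw (fun Z => f (G Z)).
Proof.
move=> mG jG /schwDc Hf; apply/schwDc => k K; have [c c0 Hc] := Hf k K; exists c => //.
apply: Dc_le (Dc_monoc mG (le01 R) Hc) => j Z _; apply: (ler_wpM2l c0).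
by apply: powR_antimono; rewrite ?japanese_gt0.
Qed.

(** Amplitudes of growth M, with no gain from derivatives, which is enough for the
   convergence of oscillatory integrals. *)
Definition tempered n (M : nat) (f : 'cV[R]_n -> C) :=
  forall k, exists2 c : R, 0 <= c & Dc k (fun _ x => c * japanese x `^ M%:R) f.

Lemma schw_tempered n M (f g : 'cV[R]_n -> C) : schw f -> tempered M g ->
  schw (fun x => f x * g x).
Proof. by move=> sf tg; apply: schwM_temp => // k; exists M. Qed.

Lemma temperedM n M M' (f g : 'cV[R]_n -> C) : tempered M f -> tempered M' g ->
  tempered (M + M') (fun x => f x * g x).
Proof.
move=> tf tg k; have [c c0 Hc] := tf k; have [c' c0' Hc'] := tg k.
exists (2 ^+ k * (c * c')); first by rewrite mulr_ge0 ?exprn_ge0// mulr_ge0.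
apply: Dc_le (Dc_mulc Hc Hc') => j x _; apply: eqle.
by rewrite natrD powR_add ?japanese_gt0//; ring.
Qed.

Lemma tempered_schw n M (f : 'cV[R]_n -> C) : schw f -> tempered M f.
Proof.
move=> sf k; have [c c0 Hc] := schw_bounded k sf; exists c => //.
apply: Dc_le Hc => j x _; rewrite -[leLHS]mulr1 ler_wpM2l//.
by rewrite -[leLHS](powRr0 (japanese x)) ler_powR ?japanese_ge1.
Qed.

Lemma temperedD n M (f g : 'cV[R]_n -> C) : tempered M f -> tempered M g ->
  tempered M (fun x => f x + g x).
Proof.
move=> tf tg k; have [c c0 Hc] := tf k; have [c' c0' Hc'] := tg k.
exists (c + c'); first exact: addr_ge0.
have := DcD Hc Hc'; apply: Dc_le => j x _; apply: eqle; ring.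
Qed.

Lemma tempered_monoc n m M (G : 'cV[R]_n -> 'cV[R]_m) (f : 'cV[R]_m -> C) :
  monomial_map 1 G -> (forall Z, japanese (G Z) <= japanese Z) -> tempered M f ->
  tempered M (fun Z => f (G Z)).
Proof.
move=> mG jG Hf k; have [c c0 Hc] := Hf k; exists c => //.
apply: Dc_le (Dc_monoc mG (le01 R) Hc) => j Z _; apply: (ler_wpM2l c0).
by apply: ge0_ler_powR; rewrite // nnegrE ltW// japanese_gt0.
Qed.

Lemma shubin_tempered n M m rho (f : 'cV[R]_n -> C) : 0 <= rho -> m <= M%:R ->
  shubin m rho f -> tempered M f.
Proof.
move=> r0 mM /shubin_symk sf k.
have [c c0 Hc] := symk_Dc (@japanese_ge1 _ _) r0 (sf k); exists c => //.
by apply: Dc_le Hc => j x _; rewrite ler_wpM2l// ler_powR ?japanese_ge1.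
Qed.
End schwartz_partial.

Section oscillatory_integral.
Variables (R : realType) (d N : nat) (phi : phase R d N) (M : nat).
Local Notation C := R[i].
Local Notation V := 'cV[R]_(d + d + N).
Local Notation E := (Eph (hess phi)).
Local Notation l := (qform (hess phi)).
Local Notation m0 := (m0 (d + d) N M).

(** The value of the oscillatory integral with phase phi and amplitude u, as an
   absolutely convergent integral. *)
Definition osc (u : V -> C) : C := integralC (fun Z => E Z * iter m0 (ibp_op l) u Z).

Let cE := @cc_Eph R _ (hess phi).
Let E1 := @normc_Eph R _ (hess phi).
Let dE := dEph (hess_sym phi).

(** A function on which [osc] is defined: amplitude times Schwartz function of the
   base variables. *)
Lemma osc_amp (a : V -> C) (F : 'cV[R]_(d + d) -> C) : tempered M a -> schw F ->
  exists2 c : R, 0 <= c & Dc m0 (fun _ Z => c * total_weight M Z) (fun Z => a Z * F (usubmx Z)).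
Proof.
move=> ta sF; have [c c0 Hc] := ta m0; have [c' c0' Hc'] := (schwDc F).1 sF m0 m0.
have H' := Dc_monoc (mono_usubmx R (d + d) N) (le01 R) Hc'.
exists (2 ^+ m0 * (c * c')); first by rewrite mulr_ge0 ?exprn_ge0// mulr_ge0.
apply: Dc_le (Dc_mulc Hc H') => j Z _; apply: eqle; rewrite /total_weight.
by rewrite -[RHS]mulrA; congr (_ * _); rewrite mulrACA.
Qed.

Lemma osc_lim c u r : 0 <= c -> Dc m0 (fun _ Z => c * total_weight M Z) u -> reg m0 r ->
  (forall k, schw (fun Z => r k Z * u Z)) ->
  ccvg (fun k => integralC (fun Z => E Z * (r k Z * u Z))) (osc u).
Proof.
move=> c0 Hu Hr sr; have lP j : l j = l j \/ l j = 0 by left.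
have dom := osc_dom cE E1 M (phase_bound phi).
by apply: (reg_lim lP cE E1 dE dom c0 Hu Hr) => k; exact: schw_cauchyw (sr k).
Qed.

Lemma osc_cont c u r : 0 <= c -> Dc m0 (fun _ Z => c * total_weight M Z) u -> reg m0 r ->
  ccvg (fun k => osc (fun Z => r k Z * u Z)) (osc u).
Proof.
by move=> c0 Hu Hr; exact: (reg_cont (osc_dom cE E1 M (phase_bound phi)) c0 Hu Hr).
Qed.

Lemma schw_reg_integrand (a : V -> C) (F : 'cV[R]_(d + d) -> C) (kappa : 'cV[R]_N -> C) (e : R) :
  tempered M a -> schw F -> schw kappa -> 0 < e <= 1 ->
  schw (fun Z => kappa (e *: dsubmx Z) * (a Z * F (usubmx Z))).
Proof.
move=> ta sF sk e01.
have := schw_tempered (schw_tensor sF (schw_dilate sk e01)) ta; congr schw.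
by apply/funext => Z; ring.
Qed.

Lemma regularized_integralE (a : V -> C) (F : 'cV[R]_(d + d) -> C) (kappa : 'cV[R]_N -> C) (e : R) :
  regularized_integral phi a kappa F e =
  integralC (fun Z => E Z * (kappa (e *: dsubmx Z) * (a Z * conjc (F (usubmx Z))))).
Proof.
rewrite /regularized_integral; congr integralC; apply/funext => Z /=.
by rewrite phase_quad vsubmxK -/(E Z); ring.
Qed.

Lemma regularized_lim (a : V -> C) (F : 'cV[R]_(d + d) -> C) (kappa : 'cV[R]_N -> C) (e : nat -> R) :
  tempered M a -> schw F -> schw kappa -> (forall x, enorm x <= 1 -> kappa x = 1) ->
  (forall k, 0 < e k <= 1) -> e k @[k --> \oo] --> (0 : R) ->
  ccvg (fun k => regularized_integral phi a kappa F (e k)) (osc (fun Z => a Z * conjc (F (usubmx Z)))).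
Proof.
move=> ta sF sk k1 e01 e0.
have [c c0 Hc] := osc_amp ta (schw_conj sF).
have rd := reg_dilated sk k1 m0 (mono_dsubmx R (d + d) N) e01 e0.
have := osc_lim c0 Hc rd (fun k => schw_reg_integrand ta (schw_conj sF) sk (e01 k)).
by apply: ccvg_eq => k; rewrite regularized_integralE.
Qed.

(** The limit eps -> 0+ is taken along sequences, which are replaced by their
   minimum with 1 to fit the class of dilated cutoffs. *)
Lemma osc_is_osc_kernel (a : V -> C) : tempered M a ->
  is_osc_kernel phi a (fun F => osc (fun Z => a Z * conjc (F (usubmx Z)))).
Proof.
move=> ta kappa k1 F; apply/cvg_at_rightP => u [u0 u_to0].
(* The minimum with 1 is eventually inactive. *)
pose e k := Num.min (u k) 1.
have e01 k : 0 < e k <= 1 by rewrite /e lt_min u0 ltr01 ge_min lexx orbT.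
have ue : \forall k \near \oo, e k = u k.
  have /cvgrPdist_lt/(_ _ ltr01) := u_to0; apply: filterS => k /=.
  by rewrite sub0r normrN gtr0_norm// /e => /ltW u1; rewrite min_l.
have e_to0 : e k @[k --> \oo] --> (0 : R).
  apply: cvg_trans u_to0; apply: near_eq_cvg.
  by apply: filterS ue => k ->.
have sF := (schwP F).1 (schwartzP F); have sk := (schwP kappa).1 (schwartzP kappa).
have := regularized_lim ta sF sk k1 e01 e_to0; apply: cvg_trans; apply: near_eq_cvg.
by apply: filterS ue => k /= ->.
Qed.

Lemma schwartz_cutoff n : exists2 kappa : schwartz R n,
  schw kappa & forall x, enorm x <= 1 -> kappa x = 1.
Proof.
have sb := schw_bump R n; exists (Schwartz ((schwP _).2 sb)) => //= x x1.
rewrite bump1// -(sqr_sqrtr (dotv_ge0 x)) expr_le1// /enorm ?sqrtr_ge0//.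
Qed.

(** The values of an oscillatory kernel are determined by its phase and its
   amplitude, by uniqueness of limits for one particular cutoff. *)
Lemma osc_kernelE (a : V -> C) K (F : schwartz R (d + d)) : tempered M a ->
  is_osc_kernel phi a K -> K F = osc (fun Z => a Z * conjc (F (usubmx Z))).
Proof.
move=> ta HK; have [kappa sk k1] := schwartz_cutoff N.
pose e k : R := k.+1%:R^-1.
have e01 k : 0 < e k <= 1 by rewrite invr_gt0 ltr0n/= invf_le1 ?ltr0n// ler1n.
have e_to0 : e k @[k --> \oo] --> (0 : R) by exact: cvg_harmonic.
have sF := (schwP F).1 (schwartzP F).
apply: ccvg_unique (regularized_lim ta sF sk k1 e01 e_to0).
have /cvg_at_rightP := HK kappa k1 F; apply; split=> // k.
by case/andP: (e01 k).
Qed.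
End oscillatory_integral.

(** * Rearranging the variables of the composition *)

Section projections.
Variables (R : realType) (d N1 N2 : nat).
Local Notation C := R[i].
Local Notation N := (d + (N2 + N1))%N.
Local Notation V := 'cV[R]_(d + d + N).
Local Notation A1 := (A1 R d N1 N2).
Local Notation A2 := (A2 R d N1 N2).
Local Notation jap := (@japanese R _).

Lemma mono_comp n m p (f : 'cV[R]_n -> 'cV[R]_m) (g : 'cV[R]_m -> 'cV[R]_p) :
  monomial_map 1 f -> monomial_map 1 g -> monomial_map 1 (fun x => g (f x)).
Proof.
move=> [cf Hf] [cg Hg]; split; first exact: (ccomp cf cg).
move=> j; case: (Hf j) => [[i Hi]|H0]; last by right => Z h; rewrite H0.
case: (Hg i) => [[k Hk]|H0]; last by right => Z h; rewrite Hi H0.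
by left; exists k => Z h; rewrite Hi Hk !mul1r.
Qed.

Lemma mono_select n m (p : 'I_m -> 'I_n) (G : 'cV[R]_n -> 'cV[R]_m) : injective p ->
  (forall Z i, G Z i 0 = Z (p i) 0) -> monomial_map 1 G.
Proof.
move=> pi GE; apply: (@monomial_mapP _ _ _ _ _ (Some \o p) (fun=> 0)) => [Z i|i i' j [<-] []].
  by rewrite GE /= mul1r.
by move=> /pi.
Qed.

Lemma mono_A1 : monomial_map 1 (fun Z : V => A1 *m Z).
Proof.
pose p (i : 'I_(d + d + N1)) : 'I_(d + d + N) := match fintype.split i with
  | inl k => match fintype.split k with inl i => lshift _ (lshift _ i) | inr i => rshift _ (lshift _ i) end
  | inr i => rshift _ (rshift _ (rshift _ i)) end.
apply: (@mono_select _ _ p) => [i i'|Z i].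
  move=> /(congr1 val); rewrite /p.
  case: (splitP i) => k ik; [case: (splitP k) => r kr; have := ltn_ord r|have := ltn_ord k];
  (case: (splitP i') => k' ik'; [case: (splitP k') => r' kr'; have := ltn_ord r'|have := ltn_ord k'])
    => /= *; apply/val_inj => /=; lia.
have [x [y [z [tau [theta ->]]]]] := packP Z; rewrite A1_pack /p.
rewrite -{1}(splitK i); case: (fintype.split i) => k /=; last by rewrite /pack !col_mxEd.
rewrite -{1}(splitK k); case: (fintype.split k) => r /=.
  by rewrite /pack !col_mxEu.
by rewrite /pack !col_mxEu col_mxEd col_mxEd col_mxEu.
Qed.

Lemma mono_A2 : monomial_map 1 (fun Z : V => A2 *m Z).
Proof.
pose p (i : 'I_(d + d + N2)) : 'I_(d + d + N) := match fintype.split i with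
  | inl k => match fintype.split k with inl i => rshift _ (lshift _ i) | inr i => lshift _ (rshift _ i) end
  | inr i => rshift _ (rshift _ (lshift _ i)) end.
apply: (@mono_select _ _ p) => [i i'|Z i].
  move=> /(congr1 val); rewrite /p.
  case: (splitP i) => k ik; [case: (splitP k) => r kr; have := ltn_ord r|have := ltn_ord k];
  (case: (splitP i') => k' ik'; [case: (splitP k') => r' kr'; have := ltn_ord r'|have := ltn_ord k'])
    => /= *; apply/val_inj => /=; lia.
have [x [y [z [tau [theta ->]]]]] := packP Z; rewrite A2_pack /p.
rewrite -{1}(splitK i); case: (fintype.split i) => k /=; last by rewrite /pack !col_mxEd col_mxEu.
rewrite -{1}(splitK k); case: (fintype.split k) => r /=.
  by rewrite /pack !col_mxEu col_mxEd col_mxEu.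
by rewrite /pack !col_mxEu !col_mxEd.
Qed.

Lemma japanese_A1 (Z : V) : jap (A1 *m Z) <= jap Z.
Proof.
have [x [y [z [tau [theta ->]]]]] := packP Z; rewrite A1_pack /pack.
rewrite -(ler_pXn2r (n := 2)) ?nnegrE ?(ltW (japanese_gt0 _))// !japanese2 !dotv_col_mx.
have := dotv_ge0 y; have := dotv_ge0 tau; lra.
Qed.

Lemma japanese_A2 (Z : V) : jap (A2 *m Z) <= jap Z.
Proof.
have [x [y [z [tau [theta ->]]]]] := packP Z; rewrite A2_pack /pack.
rewrite -(ler_pXn2r (n := 2)) ?nnegrE ?(ltW (japanese_gt0 _))// !japanese2 !dotv_col_mx.
have := dotv_ge0 x; have := dotv_ge0 theta; lra.
Qed.

(** The weight of z appears twice on the left-hand side, and is at most 1. *)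
Lemma cauchyw_A (Z : V) : cauchyw (A2 *m Z) * cauchyw (A1 *m Z) <= cauchyw Z.
Proof.
have [x [y [z [tau [theta ->]]]]] := packP Z; rewrite A1_pack A2_pack /pack !cauchyw_col_mx.
rewrite (_ : _ * _ = cauchyw z * (cauchyw x * cauchyw y * (cauchyw z * (cauchyw tau * cauchyw theta)))); last by ring.
by rewrite ler_piMl ?cauchyw_le1// !mulr_ge0 ?cauchyw_ge0.
Qed.

Lemma schw_product (g : 'cV[R]_(d + d + N2) -> C) (h : 'cV[R]_(d + d + N1) -> C) : schw g -> schw h ->
  schw (fun Z : V => g (A2 *m Z) * h (A1 *m Z)).
Proof.
move=> /schwDc Hg /schwDc Hh; apply/schwDc => k K.
have [c c0 Hc] := Hg k K; have [c' c0' Hc'] := Hh k K.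
have B1 := Dc_monoc mono_A2 (le01 R) Hc.
have B2 := Dc_monoc mono_A1 (le01 R) Hc'.
exists (2 ^+ k * (c * c')); first by rewrite mulr_ge0 ?exprn_ge0// mulr_ge0.
apply: Dc_le (Dc_mulc B1 B2) => j Z _.
rewrite -[leRHS]mulrA; apply: ler_wpM2l; first exact: exprn_ge0.
rewrite mulrACA; apply: ler_wpM2l; first exact: mulr_ge0.
rewrite -powRM ?(ltW (japanese_gt0 _))//.
apply: powR_antimono; rewrite ?japanese_gt0//.
rewrite -(ler_pXn2r (n := 2)) ?nnegrE ?mulr_ge0 ?(ltW (japanese_gt0 _))//.
have [x [y [z [tau [theta ->]]]]] := packP Z; rewrite A1_pack A2_pack /pack exprMn !japanese2 !dotv_col_mx.
have := dotv_ge0 x; have := dotv_ge0 y; have := dotv_ge0 z; have := dotv_ge0 tau; have := dotv_ge0 theta.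
move: (dotv x x) (dotv y y) (dotv z z) (dotv tau tau) (dotv theta theta) => p q r s t *.
have : 0 <= (r + q + s) * (p + r + t) by rewrite mulr_ge0 ?addr_ge0.
lra.
Qed.
End projections.

Section fubini.
Variables (R : realType) (d N1 N2 : nat).
Local Notation C := R[i].
Local Notation N := (d + (N2 + N1))%N.
Local Notation V := 'cV[R]_(d + d + N).

Lemma eq_integralC n (f g : 'cV[R]_n -> C) : f =1 g -> integralC f = integralC g.
Proof. by move=> fg; congr integralC; apply/funext. Qed.

(** Iterated integrals, since z lies between the variables x and theta. *)
Definition out_xtheta (h : 'cV[R]_(d + d + N1) -> C) (z : 'cV[R]_d) : C :=
  integralC (fun x => integralC (fun theta => h (col_mx (col_mx x z) theta))).

Lemma dominatedC_slicel a b c (f : 'cV[R]_(a + b) -> C) v : dominatedC c f -> dominatedC (c * cauchyw v) (fun u => f (col_mx u v)).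
Proof.
case=> -[cr ci] fc; split.
  by split; [exact: (ccomp (@col_mx_contl _ a b v) cr)|exact: (ccomp (@col_mx_contl _ a b v) ci)].
by move=> u; rewrite -mulrA [cauchyw v * _]mulrC -cauchyw_col_mx.
Qed.

Definition vswap (Z : 'cV[R]_(d + d)) : 'cV[R]_(d + d) := col_mx (dsubmx Z) (usubmx Z).

Lemma mono_vswap : monomial_map 1 vswap.
Proof.
pose p (i : 'I_(d + d)) : 'I_(d + d) :=
  match fintype.split i with inl i => rshift _ i | inr i => lshift _ i end.
apply: (@mono_select _ _ _ p) => [i i'|Z i].
  move=> /(congr1 val); rewrite /p.
  case: (splitP i) => k ik; case: (splitP i') => k' ik'; have := ltn_ord k; have := ltn_ord k' => /= *;
  apply/val_inj => /=; lia.
rewrite -{1}(splitK i) /p /vswap; case: (fintype.split i) => k /=.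
  by rewrite col_mxEu mxE.
by rewrite col_mxEd mxE.
Qed.

Lemma japanese_vswap Z : japanese (vswap Z) = japanese Z.
Proof.
have -> : japanese (vswap Z) = Num.sqrt (1 + enorm (vswap Z) ^+ 2) by [].
rewrite -[in RHS](vsubmxK Z) /japanese /enorm /vswap !dotv_col_mx.
by rewrite [dotv (dsubmx Z) _ + _]addrC.
Qed.

Lemma cauchyw_vswap Z : cauchyw (vswap Z) = cauchyw Z.
Proof. by rewrite /vswap cauchyw_col_mx mulrC -cauchyw_col_mx vsubmxK. Qed.

Lemma out_xthetaE h : out_xtheta h =
  (fun z => integralC (fun x => integralC (fun theta => h (col_mx (vswap (col_mx z x)) theta)))).
Proof.
apply/funext => z; rewrite /out_xtheta; apply: eq_integralC => x.
by rewrite /vswap col_mxKu col_mxKd.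
Qed.

Lemma schw_out_xtheta h : schw h -> schw (out_xtheta h).
Proof.
move=> sh.
have jv Z : japanese Z <= japanese (vswap Z) by rewrite japanese_vswap.
rewrite out_xthetaE; exact: schw_partial (schw_monoc mono_vswap jv (schw_partial sh)).
Qed.

Definition bddC n (c : R) (f : 'cV[R]_n -> C) := ccontinuous f /\ forall x, normc (f x) <= c.

Lemma dominatedC_bdd n c (f : 'cV[R]_n -> C) : 0 <= c -> dominatedC c f -> bddC c f.
Proof.
move=> c0 [cf bf]; split=> // x; apply: le_trans (bf x) _.
by rewrite ler_piMr// cauchyw_le1.
Qed.

Lemma bddC_comp n m (G : 'cV[R]_n -> 'cV[R]_m) c (f : 'cV[R]_m -> C) : continuous G -> bddC c f ->
  bddC c (fun x => f (G x)).
Proof. by move=> cG [[cr ci] bf]; split=> //; split; [exact: (ccomp cG cr)|exact: (ccomp cG ci)]. Qed.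

Lemma dominatedC_mulr n c b (f g : 'cV[R]_n -> C) : dominatedC c f -> bddC b g -> dominatedC (c * b) (fun x => f x * g x).
Proof.
move=> [cf bf] [cg bg]; split=> [|x]; first exact: ccM.
by rewrite normcM mulrAC ler_pM ?normc_ge0.
Qed.

Lemma integralC_mulr n c (f : 'cV[R]_n -> C) k : dominatedC c f ->
  integralC (fun x => f x * k) = integralC f * k.
Proof.
move=> nf; rewrite mulrC -(integralCZ k nf); apply: eq_integralC => x.
by rewrite mulrC.
Qed.

Lemma dominatedC_const n c (f : 'cV[R]_n -> C) : dominatedC c f -> 0 <= c.
Proof.
by move=> [_ /(_ 0)] /(le_trans (normc_ge0 _)); rewrite pmulr_lge0 ?cauchyw_gt0.
Qed.

Lemma cont_usub a b : continuous (@usubmx R a b 1). Proof. by case: (mono_usubmx R a b). Qed.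
Lemma cont_dsub a b : continuous (@dsubmx R a b 1). Proof. by case: (mono_dsubmx R a b). Qed.

Lemma dominatedC_out_xtheta c h : dominatedC c h ->
  dominatedC (c * (2 * integralR (@cauchyw R N1)) * (2 * integralR (@cauchyw R d))) (out_xtheta h).
Proof.
move=> nh; have np := dominatedC_partial nh; have [cv _] := mono_vswap.
have nv : dominatedC (c * (2 * integralR (@cauchyw R N1)))
    (fun Z => integralC (fun theta => h (col_mx (vswap Z) theta))).
  have [cb _] := bddC_comp cv (dominatedC_bdd (dominatedC_const np) np).
  by split=> // Z; rewrite -(cauchyw_vswap Z); case: np => _; exact.
rewrite out_xthetaE; exact: dominatedC_partial nv.
Qed.

Lemma fubini_middle c b (h : 'cV[R]_(d + d + N1) -> C) (k : 'cV[R]_d -> C) : dominatedC c h -> bddC b k ->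
  integralC (fun W => h W * k (dsubmx (usubmx W))) = integralC (fun z => out_xtheta h z * k z).
Proof.
move=> nh bk; have bk1 := bddC_comp (@cont_dsub d d) bk.
have bk2 := bddC_comp (@cont_usub (d + d) N1) bk1.
rewrite (integralC_block (dominatedC_mulr nh bk2)).
rewrite (_ : (fun u => _) = (fun u => integralC (fun v => h (col_mx u v)) * k (dsubmx u))); last first.
  apply/funext => u; rewrite -(integralC_mulr _ (dominatedC_slicer u nh)).
  by apply: eq_integralC => v; rewrite col_mxKu.
have np := dominatedC_partial nh; have nq := dominatedC_mulr np bk1.
rewrite (integralC_block nq) (integralC_swap nq); apply: eq_integralC => z.
rewrite -(integralC_mulr _ (dominatedC_slicel z np)).
by apply: eq_integralC => x; rewrite col_mxKd.
Qed.

(** Three variables x, z, y in a chain: g depends on (z,y) and k on (x,z). *)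
Lemma fubini_chain c c' (g k : 'cV[R]_(d + d) -> C) : dominatedC c g -> dominatedC c' k ->
  integralC (fun x => integralC (fun y => integralC (fun z => g (col_mx z y) * k (col_mx x z)))) =
  integralC (fun z => integralC (fun y => g (col_mx z y)) * integralC (fun x => k (col_mx x z))).
Proof.
move=> ng nk; have bk := dominatedC_bdd (dominatedC_const nk) nk.
have step x : integralC (fun y => integralC (fun z => g (col_mx z y) * k (col_mx x z))) =
    integralC (fun z => integralC (fun y => g (col_mx z y)) * k (col_mx x z)).
  have bx := bddC_comp (@cont_usub d d) (bddC_comp (@col_mx_contr _ d d x) bk).
  have := integralC_swap (dominatedC_mulr ng bx) => sw.
  transitivity (integralC (fun y => integralC (fun z => g (col_mx z y) * k (col_mx x (usubmx (col_mx z y)))))).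
    by apply: eq_integralC => y; apply: eq_integralC => z; rewrite col_mxKu.
  rewrite -sw; apply: eq_integralC => z.
  rewrite -(integralC_mulr _ (dominatedC_slicer z ng)).
  by apply: eq_integralC => y; rewrite col_mxKu.
under [in LHS]eq_fun do rewrite step.
have np := dominatedC_partial ng; have bp := dominatedC_bdd (dominatedC_const np) np.
have nq := dominatedC_mulr nk (bddC_comp (@cont_dsub d d) bp).
transitivity (integralC (fun x => integralC (fun z => k (col_mx x z) *
   integralC (fun y => g (col_mx (dsubmx (col_mx x z)) y))))).
  by apply: eq_integralC => x; apply: eq_integralC => z; rewrite col_mxKd mulrC.
rewrite (integralC_swap nq); apply: eq_integralC => z; rewrite mulrC.
rewrite -(integralC_mulr _ (dominatedC_slicel z nk)).
by apply: eq_integralC => x; rewrite col_mxKd.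
Qed.

Lemma dominatedC_product c c' (g : 'cV[R]_(d + d + N2) -> C) (h : 'cV[R]_(d + d + N1) -> C) :
  dominatedC c g -> dominatedC c' h -> dominatedC (c * c') (fun Z : V => g (A2 R d N1 N2 *m Z) * h (A1 R d N1 N2 *m Z)).
Proof.
move=> ng nh; have c0 := dominatedC_const ng; have c0' := dominatedC_const nh.
case: ng => cg bg; case: nh => ch bh.
have [cA1 _] := mono_A1 R d N1 N2; have [cA2 _] := mono_A2 R d N1 N2.
have [cg' _] := bddC_comp cA2 (dominatedC_bdd c0 (conj cg bg)).
have [ch' _] := bddC_comp cA1 (dominatedC_bdd c0' (conj ch bh)).
split=> [|Z]; first exact: ccM.
rewrite normcM (le_trans (ler_pM (normc_ge0 _) (normc_ge0 _) (bg _) (bh _)))//.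
by rewrite mulrACA ler_wpM2l ?mulr_ge0// cauchyw_A.
Qed.

(** Integrating out tau and theta leaves a chain in x, z, y. *)
Lemma fubini_composite c c' (g : 'cV[R]_(d + d + N2) -> C) (h : 'cV[R]_(d + d + N1) -> C) :
  dominatedC c g -> dominatedC c' h ->
  integralC (fun Z : V => g (A2 R d N1 N2 *m Z) * h (A1 R d N1 N2 *m Z)) =
  integralC (fun W => g W * out_xtheta h (usubmx (usubmx W))).
Proof.
move=> ng nh; have nf := dominatedC_product ng nh.
have ngp := dominatedC_partial ng; have nhp := dominatedC_partial nh.
rewrite (integralC_block nf) (integralC_block (dominatedC_partial nf)).
transitivity (integralC (fun x => integralC (fun y => integralC (fun z =>
    integralC (fun tau => g (col_mx (col_mx z y) tau)) *
    integralC (fun theta => h (col_mx (col_mx x z) theta)))))).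
  apply: eq_integralC => x; apply: eq_integralC => y.
  have nf1 := dominatedC_slicer (col_mx x y) nf.
  rewrite (integralC_block nf1); apply: eq_integralC => z.
  have nf2 := dominatedC_slicer z nf1.
  rewrite (integralC_block nf2) -(integralC_mulr _ (dominatedC_slicer (col_mx z y) ng)).
  apply: eq_integralC => tau.
  rewrite -(integralCZ _ (dominatedC_slicer (col_mx x z) nh)); apply: eq_integralC => theta.
  by rewrite -/(pack x y z tau theta) A1_pack A2_pack.
rewrite (fubini_chain ngp nhp).
have no := dominatedC_out_xtheta nh; have bh := dominatedC_bdd (dominatedC_const no) no.
have bh1 := bddC_comp (@cont_usub d d) bh; have bh2 := bddC_comp (@cont_usub (d + d) N2) bh1.
rewrite (integralC_block (dominatedC_mulr ng bh2)).
rewrite (_ : (fun u => integralC (fun v => g (col_mx u v) * _)) =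
    (fun u => integralC (fun v => g (col_mx u v)) * out_xtheta h (usubmx u))); last first.
  apply/funext => u; rewrite -(integralC_mulr _ (dominatedC_slicer u ng)).
  by apply: eq_integralC => v; rewrite (col_mxKu u v).
rewrite (integralC_block (dominatedC_mulr ngp bh1)); apply: eq_integralC => z.
rewrite -(integralC_mulr _ (dominatedC_slicer z ngp)).
by apply: eq_integralC => y; rewrite (col_mxKu z y).
Qed.

End fubini.

(** * The amplitude of the composition *)

Section comparable_weights.
Variables (R : realType) (n : nat).
Local Notation C := R[i].

Lemma powR_compare (c s s' r : R) : 1 <= c -> 0 < s -> 0 < s' -> s <= c * s' -> s' <= c * s ->
  s' `^ r <= c `^ `|r| * s `^ r.
Proof.
move=> c1 s0 s0' h h'; have c0 : 0 <= c by exact: le_trans c1.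
have [r0|r0] := leP 0 r.
  rewrite ger0_norm// -powRM ?(ltW s0)//.
  by apply: ge0_ler_powR; rewrite ?nnegrE ?mulr_ge0 ?(ltW s0) ?(ltW s0').
rewrite ltr0_norm// -[in s `^ r](opprK r) -[in s' `^ r](opprK r) !(powRN _ (- r)).
have t0 : 0 <= - r by rewrite oppr_ge0 ltW.
rewrite ler_pdivlMr ?powR_gt0// mulrC ler_pdivrMr ?powR_gt0//.
rewrite -powRM ?(ltW s0')//.
by apply: ge0_ler_powR; rewrite ?nnegrE ?mulr_ge0 ?(ltW s0) ?(ltW s0').
Qed.

(** On the region chi, which carries f, the two weights are comparable, so that
   orders with respect to either of them add up. *)
Lemma symkM_compare k (chi s s' : 'cV[R]_n -> R) m m' rho (f g : 'cV[R]_n -> C) :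
  (forall x, 0 <= chi x) -> (forall x, 0 < s x) -> (forall x, 0 < s' x) -> 0 <= rho ->
  (exists2 c : R, 1 <= c & forall x, chi x != 0 -> s x <= c * s' x /\ s' x <= c * s x) ->
  symk k chi s m rho f -> symk k one1 s' m' rho g ->
  symk k chi s (m + m') rho (fun x => f x * g x).
Proof.
move=> chi0 s0 s0' r0 [c c1 Hc] [e e0 H] [e' e0' H'].
exists (2 ^+ k * (e * e') * c `^ (`|m'| + rho * k%:R)).
  by rewrite !mulr_ge0 ?exprn_ge0 ?powR_ge0.
apply: DcM H H' _ => i j x ijk.
rewrite /one1 mul1r.
set A := s x `^ _; set B := s' x `^ _; set D := s x `^ _; set Q := c `^ _.
have -> : 2 ^+ k * (e * (chi x * A) * (e' * B)) = 2 ^+ k * (e * e') * (chi x * (A * B)) by ring.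
have -> : 2 ^+ k * (e * e') * Q * (chi x * D) = 2 ^+ k * (e * e') * (chi x * (Q * D)) by ring.
apply: ler_wpM2l; first by rewrite !mulr_ge0 ?exprn_ge0.
have [->|chix] := eqVneq (chi x) 0; first by rewrite !mul0r.
apply: ler_wpM2l => //; rewrite {}/A {}/B {}/D {}/Q.
have [h h'] := Hc x chix.
rewrite (_ : m + m' - _ = (m - rho * i%:R) + (m' - rho * j%:R)); last by rewrite natrD; ring.
rewrite (powR_add (m - rho * i%:R) (m' - rho * j%:R) (s0 x)) [leRHS]mulrCA; apply: ler_wpM2l; first exact: powR_ge0.
apply: le_trans (powR_compare _ c1 (s0 x) (s0' x) h h') _.
apply: ler_wpM2r; first exact: powR_ge0.
rewrite ler_powR// (le_trans (ler_normB _ _))// lerD2l ger0_norm ?mulr_ge0//.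
by rewrite ler_wpM2l// ler_nat (leq_trans (leq_addl i j)).
Qed.
End comparable_weights.

Section amplitude.
Variables (R : realType) (d N1 N2 : nat) (phi1 : phase R d N1) (phi2 : phase R d N2).
Local Notation C := R[i].
Local Notation N := (d + (N2 + N1))%N.
Local Notation V := 'cV[R]_(d + d + N).
Local Notation A1 := (A1 R d N1 N2).
Local Notation A2 := (A2 R d N1 N2).
Local Notation S := (total_hess phi1 phi2).
Local Notation lS := (lth (a := d + d) (b := N) (qform S)).

(** The forms in the fibre variables are the rows of the lower half of the
   Hessian, so that their sum of squares is the |G|^2 of the linear bounds. *)
Lemma sum_lth (Z : V) : \sum_j dotv (lS j) Z ^+ 2 = dotv (dsubmx S *m Z) (dsubmx S *m Z).
Proof.
rewrite big_split_ord /= big1 ?add0r => [|i _].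
  rewrite /dotv; apply: eq_bigr => j _; rewrite lth_rshift -/(dotv _ _) qformE expr2.
  by rewrite mul_dsub_mx !mxE.
by rewrite lth_lshift /dotv big1 ?expr0n// => k _; rewrite mxE mul0r.
Qed.

Variables chi1 chi2 : 'M[R]_(d + d).
Hypotheses (S1 : symplectic chi1) (S2 : symplectic chi2).
Hypotheses (L1 : lagrangian phi1 = twisted_graph chi1) (L2 : lagrangian phi2 = twisted_graph chi2).

(** On the support of the cutoff, |G| is so small that it can be absorbed in the
   bound of <Z> by <A_j Z> and |G|; on the support of its complement |G| controls
   <Z> directly. *)
Lemma cut_constant : exists2 c : R, 1 <= c & forall Z : V,
  (uform lS c Z <= 2 -> japanese Z <= c * japanese (A1 *m Z) /\ japanese Z <= c * japanese (A2 *m Z)) /\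
  (1 <= uform lS c Z -> japanese Z <= c * sf lS Z).
Proof.
have [c1 c11 H1] := jap_bound (@critical_A1 R d N1 N2 phi1 phi2 _ S2 L2).
have [c2 c21 H2] := jap_bound (@critical_A2 R d N1 N2 phi1 phi2 _ L1).
pose c0 := c1 + c2; have c01 : 1 <= c0 by rewrite /c0; lra.
have c0_ge1 : c1 <= c0 by rewrite /c0; lra.
have c0_ge2 : c2 <= c0 by rewrite /c0; lra.
have c00 : 0 <= c0 by lra.
(* With the constant 4 c0, the bound uform <= 2 means 2 c0 |G|^2 <= <Z>^2, so that the term c0 |G|^2 is at most half of <Z>^2. *)
exists (4 * c0) => [|Z]; first by lra.
rewrite /uform sum_lth.
have := H1 Z; have := H2 Z; have := sf2 lS Z; rewrite /lamf sum_lth.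
have -> : 1 + \sum_a dotv (ebase R a) Z ^+ 2 = japanese Z ^+ 2 by rewrite japanese_sf sf2.
have := dotv_ge0 (dsubmx S *m Z); set G := dotv _ _ => G0 s2 h2 h1.
have J0 := japanese_gt0 Z; have J2 : 0 < japanese Z ^+ 2 by rewrite exprn_gt0.
have b (p t : R) : 1 <= t -> 0 <= p -> japanese Z ^+ 2 <= t * p ^+ 2 -> japanese Z <= t * p.
  move=> t1 p0 h; rewrite -(ler_pXn2r (n := 2)) ?nnegrE ?mulr_ge0 ?(ltW J0)//; last by lra.
  rewrite exprMn (le_trans h)// ler_wpM2r ?sqr_ge0// expr2 ler_peMl//; lra.
split.
  rewrite ler_pdivrMr// => hG.
  have key (p c : R) : 0 <= p -> c <= c0 -> japanese Z ^+ 2 <= c * (p ^+ 2 + G) -> japanese Z <= 4 * c0 * p.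
    move=> p0 cc h; apply: b => //; first by lra.
    have : c * (p ^+ 2 + G) <= c0 * (p ^+ 2 + G) by rewrite ler_wpM2r// addr_ge0// sqr_ge0.
    have : 0 <= c0 * p ^+ 2 by rewrite mulr_ge0// sqr_ge0.
    move: (p ^+ 2) (japanese Z ^+ 2) h hG => q J h hG hq; rewrite mulrDr => h'; lra.
  by split; [apply: key h1|apply: key h2]; rewrite // ltW// japanese_gt0.
rewrite ler_pdivlMr// mul1r => hG; apply: b => //; first by lra.
  exact/ltW/sf_gt0.
rewrite s2 (le_trans hG)// ler_wpM2l//; first by lra.
by rewrite lerDr.
Qed.

Variables (rho m1 m2 : R) (a1 : 'cV[R]_(d + d + N1) -> C) (a2 : 'cV[R]_(d + d + N2) -> C).
Hypotheses (rho01 : 0 <= rho <= 1) (Ha1 : shubin m1 rho a1) (Ha2 : shubin m2 rho a2).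

Definition amp (Z : V) : C := a1 (A1 *m Z) * a2 (A2 *m Z).

Variable c : R.
Hypotheses (c1 : 1 <= c) (Hc : forall Z : V,
  (uform lS c Z <= 2 -> japanese Z <= c * japanese (A1 *m Z) /\ japanese Z <= c * japanese (A2 *m Z)) /\
  (1 <= uform lS c Z -> japanese Z <= c * sf lS Z)).

(** The cutoff carries the product to the region where both brackets <A_j Z> are
   comparable with <Z>. *)
Lemma shubin_cut_amp : shubin (m1 + m2) rho (fun Z => wcut lS c Z * amp Z).
Proof.
have /andP[r0 r1] := rho01; apply: symk_shubin => k.
pose chi (Z : V) : R := (uform lS c Z <= 2)%R%:R.
have chi0 Z : 0 <= chi Z by rewrite ler0n.
have hw : symk k chi (@japanese R _) 0 rho (wcut lS c).
  by apply: symk_le (symk_wcut lS c k) => //; exact: japanese_ge1.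
have h1 := symk_mono (mono_A1 R d N1 N2) (le01 R) (@one1_ge0 R _) (shubin_symk Ha1 k).
have h2 := symk_mono (mono_A2 R d N1 N2) (le01 R) (@one1_ge0 R _) (shubin_symk Ha2 k).
have cmp1 : exists2 c : R, 1 <= c & forall x, chi x != 0 ->
    japanese x <= c * japanese (A1 *m x) /\ japanese (A1 *m x) <= c * japanese x.
  exists c => // Z; rewrite /chi pnatr_eq0 eqb0 negbK => /(Hc Z).1[h _]; split=> //.
  by rewrite (le_trans (japanese_A1 Z))// ler_peMl// ltW// japanese_gt0.
have cmp2 : exists2 c : R, 1 <= c & forall x, chi x != 0 ->
    japanese x <= c * japanese (A2 *m x) /\ japanese (A2 *m x) <= c * japanese x.
  exists c => // Z; rewrite /chi pnatr_eq0 eqb0 negbK => /(Hc Z).1[_ h]; split=> //.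
  by rewrite (le_trans (japanese_A2 Z))// ler_peMl// ltW// japanese_gt0.
have j0 m n (B : 'M[R]_(m, n)) x : 0 < japanese (B *m x :> 'cV[R]_m) by exact: japanese_gt0.
have hh1 := symkM_compare chi0 (@japanese_gt0 _ _) (j0 _ _ A1) r0 cmp1 hw h1.
have hh2 := symkM_compare chi0 (@japanese_gt0 _ _) (j0 _ _ A2) r0 cmp2 hh1 h2.
rewrite add0r in hh2.
rewrite (_ : (fun Z => _) = (fun Z => wcut lS c Z * a1 (A1 *m Z) * a2 (A2 *m Z))).
  by apply: symk_chi hh2 => // Z; rewrite /chi /one1 lern1 leq_b1.
by apply/funext => Z; rewrite mulrA.
Qed.

Variables M1 M2 : nat.
Hypotheses (m1M : m1 <= M1%:R) (m2M : m2 <= M2%:R).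

Lemma tempered_amp : tempered (M1 + M2) amp.
Proof.
have /andP[r0 _] := rho01; apply: temperedM.
  exact: tempered_monoc (mono_A1 R d N1 N2) (@japanese_A1 R d N1 N2) (shubin_tempered r0 m1M Ha1).
exact: tempered_monoc (mono_A2 R d N1 N2) (@japanese_A2 R d N1 N2) (shubin_tempered r0 m2M Ha2).
Qed.

(** The part of the product amplitude supported where |G| dominates <Z>. *)
Definition rest (Z : V) : C := (1 - wcut lS c Z) * amp Z.
Definition rest_chi (Z : V) : R := (1 <= uform lS c Z)%R%:R.

Lemma rest_Dc k : exists2 c : R, 0 <= c &
  Dc k (fun _ Z => c * (rest_chi Z * japanese Z `^ (M1 + M2)%:R)) rest.
Proof.
have [e e0 He] := symk_1wcut lS c k; have [e' e0' He'] := tempered_amp k.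
exists (2 ^+ k * (e * e')); first by rewrite mulr_ge0 ?exprn_ge0// mulr_ge0.
have H : Dc k (fun _ Z => e * rest_chi Z) (fun x => 1 - wcut lS c x).
  apply: Dc_le He => j Z _; rewrite ler_wpM2l// ler_piMr ?ler0n//.
  rewrite -[leRHS](powRr0 (japanese Z)) ler_powR ?japanese_ge1// mul1r sub0r.
apply: Dc_le (Dc_mulc H He') => j Z _; apply: eqle.
by rewrite -[RHS]mulrA; congr (_ * _); rewrite mulrACA.
Qed.

Lemma rest_chiP : exists2 C0 : R, 0 <= C0 &
  forall Z, rest_chi Z = 0 \/ (rest_chi Z = 1 /\ japanese Z <= C0 * sf lS Z).
Proof.
exists c => [|Z]; first exact: le_trans c1.
rewrite /rest_chi; have [h|_] := boolP (1 <= uform lS c Z)%R; [right|by left].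
by split=> //; exact: (Hc Z).2.
Qed.
End amplitude.

(** * The pairing of the composition with test functions *)

Section composed_kernel.
Variables (R : realType) (d N1 N2 : nat) (phi1 : phase R d N1) (phi2 : phase R d N2).
Local Notation C := R[i].
Local Notation N := (d + (N2 + N1))%N.
Local Notation V := 'cV[R]_(d + d + N).
Local Notation A1 := (A1 R d N1 N2).
Local Notation A2 := (A2 R d N1 N2).
Variables (chi1 : 'M[R]_(d + d)) (S1 : symplectic chi1) (L1 : lagrangian phi1 = twisted_graph chi1).
Local Notation Phi := (total_phase phi2 S1 L1).
Local Notation E1 := (Eph (hess phi1)).
Local Notation E2 := (Eph (hess phi2)).
Local Notation E := (Eph (hess Phi)).

Lemma Eph_total Z : E Z = E1 (A1 *m Z) * E2 (A2 *m Z).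
Proof.
rewrite hess_total /Eph quad_total /expi; apply/eqP.
by rewrite eq_complex ReM ImM /= cosD sinD; apply/andP; split; apply/eqP; ring.
Qed.

Lemma schwartz_schw n (k : schwartz R n) : schw k.
Proof. exact: (schwP k).1 (schwartzP k). Qed.

Lemma schw_Eph n (S : 'M[R]_n) (u : 'cV[R]_n -> C) : S^T = S -> schw u -> schw (fun Z => Eph S Z * u Z).
Proof.
move=> Ss su; rewrite (_ : (fun Z => _) = (fun Z => u Z * Eph S Z)); last first.
  by apply/funext => Z; rewrite mulrC.
apply: schwM_temp => // k; exists k.
exact: (@Dc_E R 0 n (qform S) (Eph S) (@cc_Eph R n S) (@normc_Eph R n S) (dEph Ss)).
Qed.

Variables (M1 M2 : nat) (a1 : 'cV[R]_(d + d + N1) -> C) (a2 : 'cV[R]_(d + d + N2) -> C).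
Hypotheses (ta1 : tempered M1 a1) (ta2 : tempered M2 a2).
Variables (kz : schwartz R d) (k1 : schwartz R N1) (k2 : schwartz R N2).
Hypotheses (kz1 : forall x, enorm x <= 1 -> kz x = 1)
  (k11 : forall x, enorm x <= 1 -> k1 x = 1) (k21 : forall x, enorm x <= 1 -> k2 x = 1).
Variables (f g : schwartz R d).

Let e (k : nat) : R := k.+1%:R^-1.

Lemma harmonic01 k : 0 < e k <= 1.
Proof. by rewrite invr_gt0 ltr0n/= invf_le1 ?ltr0n// ler1n. Qed.

Lemma harmonic_to0 : e k @[k --> \oo] --> (0 : R).
Proof. exact: cvg_harmonic. Qed.

(** The amplitude of the first factor multiplied by cutoffs and by the test
   function.  Both this and [right_amp] contain a cutoff in z, so that each of
   them is a Schwartz function. *)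
Definition left_amp (n : nat) (W : 'cV[R]_(d + d + N1)) : C :=
  k1 (e n *: dsubmx W) * (a1 W * (conjc (g (usubmx (usubmx W))) * kz (e n *: dsubmx (usubmx W)))).

Definition right_amp (n k : nat) (W : 'cV[R]_(d + d + N2)) : C :=
  k2 (e k *: dsubmx W) * (a2 W * (kz (e n *: usubmx (usubmx W)) * f (dsubmx (usubmx W)))).

Lemma schw_left_amp n : schw (left_amp n).
Proof.
have sT := schw_tensor (schw_conj (schwartz_schw g)) (schw_dilate (schwartz_schw kz) (harmonic01 n)).
exact: schw_reg_integrand ta1 sT (schwartz_schw k1) (harmonic01 n).
Qed.

Lemma schw_right_amp n k : schw (right_amp n k).
Proof.
have sT := schw_tensor (schw_dilate (schwartz_schw kz) (harmonic01 n)) (schwartz_schw f).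
exact: schw_reg_integrand ta2 sT (schwartz_schw k2) (harmonic01 k).
Qed.

Definition left_part n W := E1 W * left_amp n W.
Definition right_part n k W := E2 W * right_amp n k W.

Lemma schw_left_part n : schw (left_part n).
Proof. by apply: schw_Eph; [exact: hess_sym|exact: schw_left_amp]. Qed.

Lemma schw_right_part n k : schw (right_part n k).
Proof. by apply: schw_Eph; [exact: hess_sym|exact: schw_right_amp]. Qed.

(** The regularized first kernel paired with g: a Schwartz function of the middle
   variable, to be tested against the second operator. *)
Definition half_pairing (n : nat) (z : 'cV[R]_d) : C := out_xtheta (left_part n) z * kz (e n *: z).

Lemma schw_half_pairing n : schw (half_pairing n).
Proof.
apply: schw_tempered (schw_out_xtheta (schw_left_part n)) _.
exact: (tempered_schw 0 (schw_dilate (schwartz_schw kz) (harmonic01 n))).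
Qed.

Definition half_pairing_conj n : schwartz R d := Schwartz ((schwP _).2 (schw_conj (schw_half_pairing n))).

Lemma schw_tensor_conj (u v : schwartz R d) : schw (tensor_conj u v).
Proof. exact: schw_tensor (schwartz_schw u) (schw_conj (schwartz_schw v)). Qed.

Definition tensor_schwartz (u v : schwartz R d) : schwartz R (d + d) :=
  Schwartz ((schwP _).2 (schw_tensor_conj u v)).

Lemma conj_tensor (u v : 'cV[R]_d -> C) X :
  conjc (tensor_conj u v X) = conjc (u (usubmx X)) * v (dsubmx X).
Proof. by rewrite /tensor_conj rmorphM /= conjcK. Qed.

Lemma bdd_schw n (u : 'cV[R]_n -> C) : schw u -> exists c, bddC c u.
Proof. by move=> /schw_dominatedC[c c0 nu]; exists c; exact: dominatedC_bdd. Qed.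

(** The first operator applied to u, paired with g, as a limit of pairings of u
   with Schwartz functions; in the composition u will be the image of f by the
   second operator. *)
Lemma left_lim (u : schwartz R d) :
  ccvg (fun n => pairing u (half_pairing_conj n)) (osc phi1 M1 (fun W => a1 W * conjc (tensor_conj g u (usubmx W)))).
Proof.
have sT : schw (fun X => conjc (tensor_conj g u X)) by apply: schw_conj; exact: schw_tensor_conj.
have [c c0 Hc] := osc_amp ta1 sT.
have mz := mono_comp (mono_usubmx R (d + d) N1) (mono_dsubmx R d d).
have rz := reg_dilated (schwartz_schw kz) kz1 (m0 (d + d) N1 M1) mz harmonic01 harmonic_to0.
have r1 := reg_dilated (schwartz_schw k1) k11 (m0 (d + d) N1 M1) (mono_dsubmx R (d + d) N1) harmonic01 harmonic_to0.
have rr := regM r1 (regM rz rz).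
have sr n : schw (fun W => k1 (e n *: dsubmx W) *
    (kz (e n *: dsubmx (usubmx W)) * kz (e n *: dsubmx (usubmx W))) *
    (a1 W * conjc (tensor_conj g u (usubmx W)))).
  have sz := schw_dilate (schwartz_schw kz) (harmonic01 n).
  have sF := schw_tensor (schw_conj (schwartz_schw g))
    (schw_tempered sz (temperedM (tempered_schw 0 sz) (tempered_schw 0 (schwartz_schw u)))).
  have := schw_reg_integrand ta1 sF (schwartz_schw k1) (harmonic01 n).
  rewrite [X in schw X -> _](_ : _ = (fun W => k1 (e n *: dsubmx W) *
    (kz (e n *: dsubmx (usubmx W)) * kz (e n *: dsubmx (usubmx W))) *
    (a1 W * conjc (tensor_conj g u (usubmx W)))))//.
  by apply/funext => W; rewrite conj_tensor; ring.
apply: ccvg_eq (osc_lim phi1 c0 Hc rr sr) => n.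
have [b bu] := bdd_schw (schw_tempered (schw_dilate (schwartz_schw kz) (harmonic01 n)) (tempered_schw 0 (schwartz_schw u))).
have [b' b0 nl] := schw_dominatedC (schw_left_part n).
transitivity (integralC (fun z => out_xtheta (left_part n) z * (kz (e n *: z) * u z))).
  rewrite -(fubini_middle nl bu); apply: eq_integralC => W.
  by rewrite /left_part /left_amp conj_tensor; ring.
apply: eq_integralC => z; rewrite /= conjcK /half_pairing; ring.
Qed.

(** Squaring the cutoff in z lets both factors decay in z. *)
Definition cutoffs (n : nat) (Z : V) : C := k1 (e n *: dsubmx (A1 *m Z)) *
  (kz (e n *: dsubmx (usubmx (A1 *m Z))) * kz (e n *: dsubmx (usubmx (A1 *m Z)))).

Lemma reg_cutoffs k0 : reg k0 cutoffs.
Proof.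
have mz := mono_comp (mono_comp (mono_A1 R d N1 N2) (mono_usubmx R (d + d) N1)) (mono_dsubmx R d d).
have m1 := mono_comp (mono_A1 R d N1 N2) (mono_dsubmx R (d + d) N1).
have rz := reg_dilated (schwartz_schw kz) kz1 k0 mz harmonic01 harmonic_to0.
have r1 := reg_dilated (schwartz_schw k1) k11 k0 m1 harmonic01 harmonic_to0.
exact: regM r1 (regM rz rz).
Qed.

Local Notation F := (fun X : 'cV[R]_(d + d) => conjc (tensor_conj g f X)).
Local Notation M := (M1 + M2)%N.
Local Notation m0 := (m0 (d + d) N M).

Lemma tempered_product : tempered M (amp a1 a2).
Proof.
apply: temperedM.
  exact: tempered_monoc (mono_A1 R d N1 N2) (@japanese_A1 R d N1 N2) ta1.
exact: tempered_monoc (mono_A2 R d N1 N2) (@japanese_A2 R d N1 N2) ta2.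
Qed.

Lemma amp_split n k Z : k2 (e k *: dsubmx (A2 *m Z)) * (cutoffs n Z * (amp a1 a2 Z * F (usubmx Z))) =
  right_amp n k (A2 *m Z) * left_amp n (A1 *m Z).
Proof.
rewrite /= conj_tensor /right_amp /left_amp /cutoffs /amp.
have [x [y [z [tau [theta ->]]]]] := packP Z.
rewrite A1_pack A2_pack /pack !(col_mxKu, col_mxKd); ring.
Qed.

Lemma integrand_split n k Z : right_part n k (A2 *m Z) * left_part n (A1 *m Z) =
  E Z * (k2 (e k *: dsubmx (A2 *m Z)) * (cutoffs n Z * (amp a1 a2 Z * F (usubmx Z)))).
Proof. by rewrite amp_split Eph_total /right_part /left_part; ring. Qed.

(** For fixed n, the kernel of the second operator is tested on a Schwartz function;
   the cutoff k2 (e k *: tau) makes Fubini applicable, and disappears as k tends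
   to infinity. *)
Lemma right_lim n : osc phi2 M2 (fun W => a2 W * conjc (tensor_conj (half_pairing_conj n) f (usubmx W))) =
  osc Phi M (fun Z => cutoffs n Z * (amp a1 a2 Z * F (usubmx Z))).
Proof.
have sF : schw F by apply: schw_conj; exact: schw_tensor_conj.
have [c c0 Hc] := osc_amp tempered_product sF.
have [[c' c0' Hc'] _] := reg_cutoffs m0.
have Hu : Dc m0 (fun _ Z => 2 ^+ m0 * (c' * c) * total_weight M Z) (fun Z => cutoffs n Z * (amp a1 a2 Z * F (usubmx Z))).
  apply: Dc_le (Dc_mulc (Hc' n) Hc) => j Z _; apply: eqle.
  by rewrite -mulrA; congr (_ * _); rewrite mulrA.
have cc0 : 0 <= 2 ^+ m0 * (c' * c) by rewrite mulr_ge0 ?exprn_ge0// mulr_ge0.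
have m2 := mono_comp (mono_A2 R d N1 N2) (mono_dsubmx R (d + d) N2).
have r2 := reg_dilated (schwartz_schw k2) k21 m0 m2 harmonic01 harmonic_to0.
have sT := schw_tensor_conj (half_pairing_conj n) f.
apply: ccvg_unique (regularized_lim phi2 ta2 sT (schwartz_schw k2) k21 harmonic01 harmonic_to0) _.
have sr k : schw (fun Z => k2 (e k *: dsubmx (A2 *m Z)) * (cutoffs n Z * (amp a1 a2 Z * F (usubmx Z)))).
  rewrite (_ : (fun Z => _) = (fun Z => right_amp n k (A2 *m Z) * left_amp n (A1 *m Z))).
    exact: schw_product (schw_right_amp n k) (schw_left_amp n).
  by apply/funext => Z; exact: amp_split.
apply: ccvg_eq (osc_lim Phi cc0 Hu r2 sr) => k; rewrite regularized_integralE.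
have [b b0 nl] := schw_dominatedC (schw_left_part n).
have [b' b0' nr] := schw_dominatedC (schw_right_part n k).
transitivity (integralC (fun Z => right_part n k (A2 *m Z) * left_part n (A1 *m Z))).
  by apply: eq_integralC => Z; rewrite integrand_split.
rewrite (fubini_composite nr nl); apply: eq_integralC => W.
by rewrite conj_tensor /right_part /right_amp /= conjcK /half_pairing; ring.
Qed.

(** The cutoffs in z and theta, indexed by n, disappear in their turn. *)
Lemma composed_pairing (K1 K2 : schwartz R d -> schwartz R d) K1k K2k :
  is_osc_kernel phi1 a1 K1k -> is_osc_kernel phi2 a2 K2k ->
  (forall u v : schwartz R d, pairing (K1 u) v = K1k (tensor_conj v u)) ->
  (forall u v : schwartz R d, pairing (K2 u) v = K2k (tensor_conj v u)) ->
  pairing (K1 (K2 f)) g = osc Phi M (fun Z => amp a1 a2 Z * F (usubmx Z)).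
Proof.
move=> h1 h2 HK1 HK2.
have q1 : K1k (tensor_conj g (K2 f)) = _ := osc_kernelE (tensor_schwartz g (K2 f)) ta1 h1.
rewrite HK1 q1.
apply: ccvg_unique (left_lim (K2 f)) _.
have sF : schw F by apply: schw_conj; exact: schw_tensor_conj.
have [c c0 Hc] := osc_amp tempered_product sF.
apply: ccvg_eq (osc_cont Phi c0 Hc (reg_cutoffs m0)) => n.
have q2 : K2k (tensor_conj (half_pairing_conj n) f) = _ :=
  osc_kernelE (tensor_schwartz (half_pairing_conj n) f) ta2 h2.
by rewrite HK2 q2 right_lim.
Qed.
End composed_kernel.

(** * The composition theorem *)

Section removing_the_rest.
Variables (R : realType) (d N : nat) (Phi : phase R d N) (M : nat).
Local Notation C := R[i].
Local Notation V := 'cV[R]_(d + d + N).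
Local Notation E := (Eph (hess Phi)).
Local Notation l := (qform (hess Phi)).
Local Notation m0 := (m0 (d + d) N M).
Variables (A r : V -> C) (chi : V -> R) (psi : 'cV[R]_N -> C).
Hypotheses (tA : tempered M A)
  (Hr : forall k, exists2 c : R, 0 <= c & Dc k (fun _ Z => c * (chi Z * japanese Z `^ M%:R)) r)
  (Hchi : exists2 C0 : R, 0 <= C0 & forall Z, chi Z = 0 \/ (chi Z = 1 /\ japanese Z <= C0 * sf (lth l) Z))
  (spsi : schw psi) (ipsi : integralC psi = 1).
Local Notation s := (samp l E M r psi).

Lemma tempered_rest : tempered M r.
Proof.
move=> k; have [c c0 Hc] := Hr k; exists c => //; apply: Dc_le Hc => j Z _.
apply: ler_wpM2l => //; rewrite ler_piMl ?powR_ge0//.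
by have [C0 _ /(_ Z)[->|[-> _]]] := Hchi.
Qed.

Lemma schw_total_samp : schw s.
Proof.
have Ss := hess_sym Phi.
exact: (schw_samp (@cc_Eph R _ _) (@normc_Eph R _ _) (dEph Ss) Hr Hchi spsi).
Qed.

(** Trading the amplitude r for s does not change the integral, because both have
   the same kernel [Kr]. *)
Lemma osc_replace (F : 'cV[R]_(d + d) -> C) : schw F ->
  osc Phi M (fun Z => A Z * F (usubmx Z)) =
  osc Phi M (fun Z => (A Z - r Z + s Z) * F (usubmx Z)).
Proof.
move=> sF; have [kappa sk k1] := schwartz_cutoff R N.
pose e (k : nat) : R := k.+1%:R^-1.
pose rho (k : nat) (Z : V) := kappa (e k *: dsubmx Z).
have Hrho : reg m0 rho := reg_dilated sk k1 m0 (mono_dsubmx R (d + d) N) (@harmonic01 R) (@harmonic_to0 R).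
have Ss := hess_sym Phi; have cE := @cc_Eph R _ (hess Phi); have E1 := @normc_Eph R _ (hess Phi).
have EE := @Eph_conj R _ (hess Phi).
have ts := tempered_schw M schw_total_samp.
have tr := tempered_rest.
have ta : tempered M (fun Z => A Z - r Z + s Z).
  apply: temperedD => //; apply: temperedD => // k.
  have [c c0 Hc] := tr k; exists c => //.
  rewrite (_ : (fun Z => - r Z) = (fun Z => - 1 * r Z)); last by apply/funext => Z; rewrite mulN1r.
  by apply: Dc_le (DcZ (- 1) Hc) => j Z _; rewrite normcN normc1 mul1r.
have sreg a : tempered M a -> forall k, schw (fun Z => rho k Z * (a Z * F (usubmx Z))).
  by move=> ta' k; exact: schw_reg_integrand ta' sF sk (harmonic01 R k).
have [c c0 Hc] := osc_amp tA sF; have [c' c0' Hc'] := osc_amp ta sF.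
have lA := osc_lim Phi c0 Hc Hrho (sreg _ tA).
have la := osc_lim Phi c0' Hc' Hrho (sreg _ ta).
have lr := rem_lim cE E1 (dEph Ss) Hr Hchi sF Hrho (fun k => schw_cauchyw m0 (sreg _ tr k)).
have ls := samp_lim cE E1 (dEph Ss) Hr Hchi EE spsi ipsi sF Hrho.
(* A + s = (A - r + s) + r, and both s and r contribute the same limit. *)
apply: (@addIr _ (integralC (fun X => F X * Kr l E M r X))).
apply: ccvg_unique (ccvgD lA ls) _.
apply: ccvg_eq (ccvgD la lr) => k.
have nE a : tempered M a -> exists c, dominatedC c (fun Z => E Z * (rho k Z * (a Z * F (usubmx Z)))).
  by move=> ta'; have [b _ nb] := schw_dominatedC (schw_Eph Ss (sreg _ ta' k)); exists b.
have [b1 n1] := nE _ tA; have [b2 n2] := nE _ ta; have [b3 n3] := nE _ tr; have [b4 n4] := nE _ ts.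
rewrite -(integralCD n1 n4) -(integralCD n2 n3); apply: eq_integralC => Z.
by ring.
Qed.
End removing_the_rest.

Lemma shubinD_schw (R : realType) n (m rho : R) (f g : 'cV[R]_n -> R[i]) : 0 <= rho ->
  shubin m rho f -> schw g -> shubin m rho (fun x => f x + g x).
Proof.
move=> r0 /shubin_symk Hf sg; apply: symk_shubin => k; apply: symkD => //.
pose K := (Num.truncn (`|m| + rho * k%:R)).+1.
have hK : `|m| + rho * k%:R <= K%:R by exact/ltW/truncnS_gt.
have [c c0 Hc] := (schwDc g).1 sg k K; exists c => //; apply: Dc_le Hc => j x jk.
rewrite /one1 mul1r; apply: ler_wpM2l => //; rewrite ler_powR ?japanese_ge1//.
have : rho * j%:R <= rho * k%:R by rewrite ler_wpM2l// ler_nat.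
have := ler_norm (- m); rewrite normrN; lra.
Qed.

Theorem proposition4p10 (R : realType) (d : nat) (rho m1 m2 : R)
    (chi1 chi2 : 'M[R]_(d + d)) (K1 K2 : schwartz R d -> schwartz R d) :
  0 <= rho <= 1 ->
  symplectic chi1 -> symplectic chi2 ->
  fio m1 rho chi1 K1 -> fio m2 rho chi2 K2 ->
  fio (m1 + m2) rho (chi1 *m chi2) (K1 \o K2).
Proof.
move=> rho01 S1 S2 [K1k [N1 [phi1 [a1 [Ha1 L1 osc1]]]] HK1] [K2k [N2 [phi2 [a2 [Ha2 L2 osc2]]]] HK2].
have /andP[r0 r1] := rho01.
have big (m : R) : exists M : nat, m <= M%:R.
  by exists (Num.truncn m).+1; exact/ltW/truncnS_gt.
have [M1 m1M] := big m1; have [M2 m2M] := big m2.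
have [c c1 Hc] := @cut_constant R d N1 N2 phi1 phi2 _ _ S2 L1 L2.
pose Phi := total_phase phi2 S1 L1; pose M := (M1 + M2)%N.
pose r := rest phi1 phi2 a1 a2 c; pose chi := rest_chi phi1 phi2 c.
have hS : hess Phi = total_hess phi1 phi2 := hess_total phi2 S1 L1.
have Hr := @rest_Dc R d N1 N2 phi1 phi2 rho m1 m2 a1 a2 rho01 Ha1 Ha2 c M1 M2 m1M m2M.
have Hchi := rest_chiP c1 Hc; rewrite -hS in Hchi.
have [psi spsi ipsi] := schw_unit R (d + (N2 + N1)).
pose s := samp (qform (hess Phi)) (Eph (hess Phi)) M r psi.
have ss : schw s := schw_total_samp Hr Hchi spsi.
(* As r = (1 - w) A, this is w A + s. *)
pose a Z := amp a1 a2 Z - r Z + s Z.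
have tA : tempered M (amp a1 a2) := tempered_amp rho01 Ha1 Ha2 m1M m2M.
have Sa : shubin (m1 + m2) rho a.
  have := shubinD_schw r0 (@shubin_cut_amp R d N1 N2 phi1 phi2 rho m1 m2 a1 a2 rho01 Ha1 Ha2 c c1 Hc) ss.
  rewrite [X in shubin _ _ X -> _](_ : _ = a)//; apply/funext => Z.
  by rewrite /a /r /rest; congr (_ + _); ring.
have ta : tempered M a.
  by apply: shubin_tempered Sa; rewrite // natrD lerD.
exists (fun F => osc Phi M (fun Z => a Z * conjc (F (usubmx Z)))).
  exists (d + (N2 + N1))%N, Phi, a; split=> //; first exact: total_lagrangian.
  exact: osc_is_osc_kernel.
move=> f g.
have [kz _ kz1] := schwartz_cutoff R d; have [k1 _ k11] := schwartz_cutoff R N1.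
have [k2 _ k21] := schwartz_cutoff R N2.
have t1 := shubin_tempered r0 m1M Ha1; have t2 := shubin_tempered r0 m2M Ha2.
rewrite /= (composed_pairing S1 L1 t1 t2 kz1 k11 k21 f g osc1 osc2 HK1 HK2).
exact: (osc_replace tA Hr Hchi spsi ipsi (schw_conj (schw_tensor_conj g f))).
Qed.
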